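(* Let $k$ be a commutative ring of characteristic $0$ and let $(A,\mu,\alpha)$ be a regular unital (multiplicative) hom-associative algebra over $k$. Then the pair $(H^\bullet_\alpha(A),H_\bullet^\alpha(A))$ of Hochschild cohomology and Hochschild homology of $A$, with the operations $\cup$, $[\ ,\ ]$, $i$, $\mathcal L$ and $B$ induced from the (co)chain-level operations described in the context, is a (noncommutative differential) calculus.
   Context: All modules, linear maps and tensor products are over $k$. **Hom-associative algebras.** A (multiplicative) hom-associative algebra is a $k$-module $A$ with a bilinear map $\mu:A\otimes A\to A$, $(a,b)\mapsto a\cdot b$, and a linear map $\alpha:A\to A$ with $(a\cdot b)\cdot\alpha(c)=\alpha(a)\cdot(b\cdot c)$ and $\alpha(a\cdot b)=\alpha(a)\cdot\alpha(b)$. It is regular if $\alpha$ is invertible, and unital if there is $1\in A$ with $\alpha(1)=1$ and $a\cdot 1=1\cdot a=\alpha(a)$ for all $a$. **Cochains.** For $A$ regular unital put $\mathcal O(0)=C^0_\alpha(A)=\{a\in A:\alpha(a)=a\}$ and, for $p\ge1$, $\mathcal O(p)=C^p_\alpha(A)=\{f:A^{\otimes p}\to A\mid \alpha\circ f=f\circ\alpha^{\otimes p}\}$. For $f\in\mathcal O(p)$, $g\in\mathcal O(q)$, $1\le i\le p$, $$(f\circ_i g)(a_1,\dots,a_{p+q-1})=f(\alpha^{q-1}(a_1),\dots,\alpha^{q-1}(a_{i-1}),g(a_i,\dots,a_{i+q-1}),\alpha^{q-1}(a_{i+q}),\dots,\alpha^{q-1}(a_{p+q-1})),$$ where for $q=0$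 the element $g\in A$ is inserted in slot $i$ and $\alpha^{-1}$ is applied to the other arguments. Set $$[f,g]=\sum_{i=1}^p(-1)^{(q-1)(i-1)}f\circ_i g-(-1)^{(p-1)(q-1)}\sum_{i=1}^q(-1)^{(p-1)(i-1)}g\circ_i f,\qquad f\cup g=(\mu\circ_2 f)\circ_1 g.$$ $H^\bullet_\alpha(A)$ (degrees $\ge0$) is the cohomology of the differential $f\mapsto[\mu,f]$, which up to sign is the Hochschild coboundary $(\delta_\alpha f)(a_1,\dots,a_{n+1})=\alpha^{n-1}(a_1)\cdot f(a_2,\dots,a_{n+1})+\sum_{i=1}^n(-1)^i f(\alpha(a_1),\dots,a_i\cdot a_{i+1},\dots,\alpha(a_{n+1}))+(-1)^{n+1}f(a_1,\dots,a_n)\cdot\alpha^{n-1}(a_{n+1})$ for $n\geq 1$, and $\delta_\alpha(a)(b)=\alpha^{-1}(b)\cdot a-a\cdot\alpha^{-1}(b)$ for $n=0$. The operations $\cup$ and $[\ ,\ ]$ make $H^\bullet_\alpha(A)$ a Gerstenhaber algebra. **Chains.** $\mathcal M(n)=A\otimes A^{\otimes n}$, $n\ge0$, with elements written $a_0\otimes a_1\cdots a_n$. For $f\in\mathcal O(p)$ and $1\le i\le n-p+1$, $$f\bullet_i(a_0\otimes a_1\cdots a_n)=\alpha^{p-1}(a_0)\otimes\alpha^{p-1}(a_1)\cdots\alpha^{p-1}(a_{i-1})\,f(a_i,\dots,a_{i+p-1})\,\alpha^{p-1}(a_{i+p})\cdots\alpha^{p-1}(a_n)$$ (for $p=0$: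 insert $f\in A$ just before position $i$ and apply $\alpha^{-1}$ to all $a_j$), and for $p\le n+1$, $f\bullet_0(a_0\otimes a_1\cdots a_n)=f(a_0,\dots,a_{p-1})\otimes\alpha^{p-1}(a_p)\cdots\alpha^{p-1}(a_n)$. Let $t(a_0\otimes a_1\cdots a_n)=a_n\otimes a_0a_1\cdots a_{n-1}$. $H_\bullet^\alpha(A)$ is the homology of $(\mathcal M,d^\alpha)$ with $$d^\alpha(x)=\sum_{i=0}^{n-1}(-1)^i\mu\bullet_i x+(-1)^n\mu\bullet_0 t(x),\qquad x\in\mathcal M(n).$$ **Operations.** For $f\in\mathcal O(p)$, $x\in\mathcal M(n)$: $i_fx=(\mu\circ_2 f)\bullet_0 x\in\mathcal M(n-p)$ (zero if $p>n$); $\mathcal L_fx=\sum_{i=1}^{n-p+1}(-1)^{(p-1)(i-1)}f\bullet_i x+\sum_{i=1}^p(-1)^{n(i-1)+p-1}f\bullet_0t^{i-1}(x)\in \mathcal M(n-p+1)$ if $p<n+1$; $\mathcal L_fx=(-1)^{p-1}\sum_{i=0}^n(-1)^{in}f\bullet_0t^i(x)$ if $p=n+1$; zero if $p>n+1$. The Connes operator is $B(x)=\sum_{i=0}^n(-1)^{in}(\mathrm{id}-t)\,t\,(1\bullet_{n+1}t^i(x))\in\mathcal M(n+1)$. It is considered on the normalized chain complex (the quotient of $\mathcal M$ by the span of the chains $a_0\otimes a_1\cdots a_n$ with some $a_j=1$, $j\ge1$), which has the same homology; similarly, cochains may be normalized (vanishing when some argument equals $1$) without changing cohomology. **Calculus.**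 A Gerstenhaber algebra is a graded $k$-module $\mathcal A=\oplus\mathcal A^i$ with a graded commutative associative product $\cup$ of degree $0$ and a degree $-1$ bracket making $\mathcal A^{\bullet+1}$ a graded Lie algebra, with $[f,g\cup h]=[f,g]\cup h+(-1)^{(p-1)q}g\cup[f,h]$ for $f\in\mathcal A^p,g\in\mathcal A^q$. A pair $(\mathcal A,\Omega)$, with $\Omega$ a graded $k$-module, is a precalculus if $\Omega$ has a graded $(\mathcal A,\cup)$-module structure $i:\mathcal A^p\otimes\Omega_n\to\Omega_{n-p}$ (so $i_{f\cup g}=i_f\circ i_g$) and a graded Lie module structure $\mathcal L:\mathcal A^{p+1}\otimes\Omega_n\to\Omega_{n-p}$ over $\mathcal A^{\bullet+1}$ (so $\mathcal L_{[f,g]}=\mathcal L_f\mathcal L_g-(-1)^{(p-1)(q-1)}\mathcal L_g\mathcal L_f$ for $f\in\mathcal A^p$, $g\in\mathcal A^q$), with $i_{[f,g]}=i_f\circ\mathcal L_g-(-1)^{p(q+1)}\mathcal L_g\circ i_f$ for $f\in\mathcal A^p,g\in\mathcal A^q$. It is a calculus if moreover there is a degree $+1$ map $B:\Omega_\bullet\to\Omega_{\bullet+1}$ with $B^2=0$ and $\mathcal L_f=B\circ i_f-(-1)^p\,i_f\circ B$ for $f\in\mathcal A^p$. *)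

(* Defs.v *)
From HB Require Import structures.
From mathcomp Require Import all_boot all_order all_algebra.
From mathcomp Require Import generic_quotient ring_quotient sesquilinear.
From mathcomp Require Import boolp functions.
From mathcomp Require Import freeg zify.

Set Implicit Arguments.
Unset Strict Implicit.
Unset Printing Implicit Defensive.

Import GRing.Theory.
Local Open Scope ring_scope.
Local Open Scope quotient_scope.

(* [(-1)^e] for an integer exponent, in a ring where [-1] need not be known
   to be invertible. *)
Definition sg (k : comNzRingType) (e : int) : k := (-1) ^+ `|e|%N.
Arguments sg {k} e.

Section Quotients.
Variables (k : comNzRingType) (V : lmodType k).

Definition spanned (P : V -> Prop) : {pred V} := fun x =>
  `[< exists s : seq (k * V),
        (forall c, c \in s -> P c.2) /\ x = \sum_(c <- s) c.1 *: c.2 >].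

Lemma spanned_closed (P : V -> Prop) : submod_closed (spanned P).
Proof.
split; first by apply/asboolP; exists [::]; rewrite big_nil.
move=> a x y /asboolP[s [Ps ->]] /asboolP[t [Pt ->]]; apply/asboolP.
exists ([seq (a * c.1, c.2) | c <- s] ++ t); split.
  move=> c; rewrite mem_cat => /orP[/mapP[d ds ->]|/Pt //]; exact: Ps ds.
rewrite big_cat big_map scaler_sumr /=; congr (_ + _).
by apply: eq_bigr => c _; rewrite scalerA.
Qed.
HB.instance Definition _ P :=
  GRing.isSubmodClosed.Build k V (spanned P) (spanned_closed P).

Lemma spannedP (P : V -> Prop) x : P x -> x \in spanned P.
Proof.
move=> Px; apply/asboolP; exists [:: (1, x)]; split.
  by move=> c; rewrite inE => /eqP ->.
by rewrite big_seq1 scale1r.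
Qed.

Section Quot.
Variable P : V -> Prop.

(* The quotient of [V] by the submodule generated by [P]. *)
Definition quotmod : Type := Quotient.quot (spanned P).
HB.instance Definition _ := GRing.Zmodule.on quotmod.

Definition qproj (x : V) : quotmod := \pi_(Quotient.quot (spanned P)) x.

Lemma qprojP x y : qproj x = qproj y <-> x - y \in spanned P.
Proof. by rewrite Quotient.idealrBE; split=> [/eqP //|/eqP]. Qed.

Lemma qprojD x y : qproj (x + y) = qproj x + qproj y.
Proof. by rewrite /qproj !piE. Qed.

Definition qrepr (q : quotmod) : V := repr (q : Quotient.quot (spanned P)).

Lemma qreprK : cancel qrepr qproj.
Proof. exact: reprK. Qed.

Definition qscale (a : k) (q : quotmod) : quotmod := qproj (a *: qrepr q).

Lemma qprojZ a x : qproj (a *: x) = qscale a (qproj x).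
Proof.
apply/qprojP; rewrite -scalerBr rpredZ //.
by apply/qprojP; rewrite qreprK.
Qed.

Fact qscaleA a b q : qscale a (qscale b q) = qscale (a * b) q.
Proof. by rewrite -[q]qreprK -!qprojZ scalerA. Qed.
Fact qscale1 : left_id 1 qscale.
Proof. by move=> q; rewrite -[q]qreprK -!qprojZ scale1r. Qed.
Fact qscaleDr : right_distributive qscale +%R.
Proof.
move=> a q r; rewrite -[q]qreprK -[r]qreprK -qprojD -!qprojZ.
by rewrite -qprojD scalerDr.
Qed.
Fact qscaleDl q : {morph qscale^~ q : a b / a + b}.
Proof. by move=> a b; rewrite -[q]qreprK -!qprojZ scalerDl qprojD. Qed.

HB.instance Definition _ := GRing.Zmodule_isLmodule.Build k quotmod
  qscaleA qscale1 qscaleDr qscaleDl.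

Fact qproj_linear : linear qproj.
Proof. by move=> a x y; rewrite qprojD qprojZ. Qed.
HB.instance Definition _ := GRing.isLinear.Build k V quotmod *:%R qproj
  qproj_linear.

End Quot.

Section Subquotient.
Variable Z : submodClosed V.

Record submod := Submod { subval : V; _ : subval \in Z }.
HB.instance Definition _ := [isSub for subval].
HB.instance Definition _ := [Choice of submod by <:].
HB.instance Definition _ := [SubChoice_isSubLmodule of submod by <:].
End Subquotient.
End Quotients.

Section Subquot.
Variables (k : comNzRingType) (V : lmodType k) (Z : submodClosed V).
Variable B : V -> Prop.

(* [Z] modulo the submodule generated by the elements of [Z] satisfying [B]. *)
Definition subquot : lmodType k := quotmod (fun z : submod Z => B (val z)).

Definition represents (c : subquot) (x : V) : Prop :=
  exists2 z : submod Z, val z = x & c = qproj _ z.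
End Subquot.

Section TensorPower.
Variables (k : comNzRingType) (A : lmodType k).

Definition multilinear (n : nat) (W : lmodType k) (F : seq A -> W) : Prop :=
  forall (s1 s2 : seq A) (a : k) (x y : A), (size s1 + size s2).+1 = n ->
    F (s1 ++ (a *: x + y) :: s2) = a *: F (s1 ++ x :: s2) + F (s1 ++ y :: s2).

Definition free_tens n (s : seq A) : {freeg (n.-tuple A) / k} :=
  if insub s is Some t then << 1 *g t >> else 0.

Definition tens_rel n (u : {freeg (n.-tuple A) / k}) : Prop :=
  exists (s1 s2 : seq A) (a : k) (x y : A),
    (size s1 + size s2).+1 = n /\
    u = free_tens n (s1 ++ (a *: x + y) :: s2)
        - (a *: free_tens n (s1 ++ x :: s2) + free_tens n (s1 ++ y :: s2)).

Definition tpower n : lmodType k := quotmod (@tens_rel n).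

(* The elementary tensor of the list [s], or 0 if [s] has not length [n]. *)
Definition tens n (s : seq A) : tpower n := qproj (@tens_rel n) (free_tens n s).

(* The linear map induced by a map multilinear on the lists of length [n]. *)
Definition tlift n (W : lmodType k) (F : seq A -> W) (x : tpower n) : W :=
  if `[< multilinear n F >] then fglift (fun t : n.-tuple A => F t) (qrepr x)
  else 0.

Lemma fglift_linear (K : choiceType) (W : lmodType k) (F : K -> W) :
  linear (fglift F : {freeg K / k} -> W).
Proof.
have D : zmod_morphism (fglift F : {freeg K / k} -> W).
  exact: lift_is_additive.
pose G := HB.pack_for {additive {freeg K / k} -> W} (fglift F : {freeg K / k} -> W)
  (GRing.isZmodMorphism.Build _ _ _ D).
have GE x : fglift F x = G x by [].
move=> a x y; rewrite !GE raddfD; congr (_ + _).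
have -> : a *: x = \sum_(i <- dom x) << a * coeff i x *g i >> by [].
rewrite raddf_sum -[in RHS](freeg_sumE x) raddf_sum scaler_sumr.
by apply: eq_bigr => i _; rewrite -!GE !liftU scalerA.
Qed.

Lemma fgliftB (K : choiceType) (W : lmodType k) (F : K -> W)
  (u v : {freeg K / k}) : fglift F u - fglift F v = fglift F (u - v).
Proof.
by rewrite [u - v]addrC -(scaleN1r v) fglift_linear scaleN1r addrC.
Qed.

Lemma fglift_rel n (W : lmodType k) (F : seq A -> W) u :
  multilinear n F -> u \in spanned (@tens_rel n) ->
  fglift (fun t : n.-tuple A => F t) u = 0.
Proof.
move=> mF; have L := @fglift_linear (n.-tuple A) W (fun t : n.-tuple A => F t).
pose G := HB.pack_for {linear {freeg (n.-tuple A) / k} -> W}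
  (fglift (fun t : n.-tuple A => F t) : {freeg (n.-tuple A) / k} -> W)
  (GRing.isLinear.Build _ _ _ _ _ L).
have GE x : fglift (fun t : n.-tuple A => F t) x = G x by [].
have GT s : size s = n -> G (free_tens n s) = F s.
  move=> ss; rewrite /free_tens; case: insubP => [t _ <-|/negP[]]; last exact/eqP.
  by rewrite -GE liftU scale1r.
case/asboolP=> s [Ps ->]; rewrite GE linear_sum big_seq big1 // => c /Ps.
case=> s1 [s2 [a [x [y [ss ->]]]]].
have sz z : size (s1 ++ z :: s2) = n by rewrite size_cat /= addnS.
by rewrite linearZ linearB linearP !GT // mF // subrr /= scaler0.
Qed.

Lemma tlift_linear n (W : lmodType k) (F : seq A -> W) : linear (@tlift n W F).
Proof.
move=> a x y; rewrite /tlift; case: asboolP => [mF|_]; last first.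
  by rewrite scaler0 addr0.
rewrite -fglift_linear; apply/eqP; rewrite -subr_eq0; apply/eqP.
rewrite fgliftB.
by apply: fglift_rel => //; apply/qprojP; rewrite linearP /= !qreprK.
Qed.
HB.instance Definition _ n (W : lmodType k) (F : seq A -> W) :=
  GRing.isLinear.Build k (tpower n) W *:%R (@tlift n W F) (@tlift_linear n W F).

Lemma tens_multilinear n : multilinear n (tens n).
Proof.
move=> s1 s2 a x y ss; rewrite /tens -linearP; apply/qprojP/spannedP.
by exists s1, s2, a, x, y.
Qed.

Lemma tliftE n (W : lmodType k) (F : seq A -> W) s :
  multilinear n F -> size s = n -> tlift F (tens n s) = F s.
Proof.
move=> mF ss; rewrite /tlift asboolT //.
have <- : fglift (fun t : n.-tuple A => F t) (free_tens n s) = F s.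
  rewrite /free_tens; case: insubP => [t _ <-|/negP[]]; last exact/eqP.
  by rewrite liftU scale1r.
apply/eqP; rewrite -subr_eq0; apply/eqP.
rewrite fgliftB; apply: fglift_rel => //.
by apply/qprojP; rewrite qreprK.
Qed.

End TensorPower.

Record homAss (k : comNzRingType) := HomAss {
  carrier :> lmodType k;
  hmul : {bilinear carrier -> carrier -> carrier};
  twist : {linear carrier -> carrier};
  hmulA : forall a b c, hmul (hmul a b) (twist c) = hmul (twist a) (hmul b c);
  twistM : forall a b, twist (hmul a b) = hmul (twist a) (twist b)
}.

Record regUnitalHomAss (k : comNzRingType) := RegUnitalHomAss {
  homass :> homAss k;
  twistV : homass -> homass;
  twistK : cancel (twist homass) twistV;
  twistVK : cancel twistV (twist homass);
  one : homass;
  twist1 : twist homass one = one;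
  hmul1 : forall a, hmul homass a one = twist homass a;
  hmul1l : forall a, hmul homass one a = twist homass a
}.

Section HochschildCochains.
Variables (k : comNzRingType) (A : regUnitalHomAss k).
Local Notation alpha := (twist A).

(* [alpha^(p-1)], which is [alpha^-1] for [p = 0]. *)
Definition twist_pred (p : nat) : A -> A :=
  if p is q.+1 then iter q alpha else @twistV k A.

(* The list obtained from [s] by replacing the [p] consecutive entries from
   position [i] on (counted from 0) by their image under [f], and by applying
   [alpha^(p-1)] to the other entries.  For [p = 0] the element [f [::]] is
   inserted just before the entry at position [i]. *)
Definition insert (p : nat) (f : seq A -> A) (i : nat) (s : seq A) : seq A :=
  map (twist_pred p) (take i s) ++ f (take p (drop i s))
    :: map (twist_pred p) (drop (i + p) s).

(* A linear map from the [p]-th tensor power of [A] to [A] is represented by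
   the corresponding multilinear map on lists of length [p], extended by 0 to
   the lists of other lengths.  For [p = 0] such an [f] amounts to the element
   [f [::]], fixed by [alpha]. *)
Definition cochain (p : nat) : {pred (seq A -> A)} := fun f =>
  `[< [/\ forall s, size s <> p -> f s = 0,
          multilinear p f
        & forall s, alpha (f s) = f (map alpha s)] >].

Definition const_cochain (a : A) : seq A -> A :=
  fun s => if s is [::] then a else 0.

Definition mu : seq A -> A :=
  fun s => if s is [:: a; b] then hmul A a b else 0.

(* [f o_i g], with [i] counted from 1, for [g] of arity [q]. *)
Definition circ (q : nat) (f : seq A -> A) (i : nat) (g : seq A -> A) :
    seq A -> A :=
  fun s => f (insert q g i.-1 s).

Definition bracket (p q : nat) (f g : seq A -> A) : seq A -> A :=
  \sum_(1 <= i < p.+1) sg ((q%:Z - 1) * (i%:Z - 1)) *: circ q f i g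
  - sg ((p%:Z - 1) * (q%:Z - 1)) *:
    \sum_(1 <= i < q.+1) sg ((p%:Z - 1) * (i%:Z - 1)) *: circ p g i f.

Definition cup (p q : nat) (f g : seq A -> A) : seq A -> A :=
  circ q (circ p mu 2 f) 1 g.

Definition coboundary (p : nat) (f : seq A -> A) : seq A -> A :=
  bracket 2 p mu f.

Definition cocycle (p : nat) : {pred (seq A -> A)} := fun f =>
  (f \in cochain p) && (coboundary p f == 0).

Lemma cochain_closed p : submod_closed (cochain p).
Proof.
split; first by apply/asboolP; split=> // [s1 s2 a x y _|s];
  rewrite ?[_ _]/(0 : A) ?scaler0 ?addr0 ?linear0.
move=> a f g /asboolP[f0 fm fe] /asboolP[g0 gm ge]; apply/asboolP; split.
- move=> s ss; rewrite addrfctE scalrfctE.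
  by rewrite f0 // g0 // scaler0 addr0.
- move=> s1 s2 b x y ss; rewrite addrfctE scalrfctE fm // gm //.
  by rewrite !scalerDr !scalerA addrACA [b * a]mulrC.
- move=> s; rewrite addrfctE scalrfctE linearP.
  by rewrite fe ge.
Qed.

Lemma mu_linear s1 s2 : linear (fun x => mu (s1 ++ x :: s2)).
Proof.
move=> a x y; case: s1 s2 => [|b [|c [|d s1]]] [|e [|h s2]] //=;
  rewrite ?scaler0 ?addr0 //; by rewrite ?linearPl ?linearPr.
Qed.

Lemma mu_cochain : mu \in cochain 2.
Proof.
apply/asboolP; split.
- by case=> [|a [|b [|c s]]].
- by move=> s1 s2 a x y _; apply: mu_linear.
- by case=> [|a [|b [|c s]]] /=; rewrite ?linear0 // twistM.
Qed.

Lemma circ_mu_linear p i : linear (circ p mu i).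
Proof.
by move=> a f g; apply/funext => s; rewrite /circ /insert mu_linear.
Qed.

Lemma coboundary_linear p : linear (coboundary p).
Proof.
move=> a f g; rewrite /coboundary /bracket.
under eq_bigr do rewrite circ_mu_linear scalerDr scalerA mulrC -scalerA.
rewrite big_split -scaler_sumr /= scalerBr -!addrA; congr (_ + _).
rewrite [RHS]addrCA; congr (_ + _).
have -> : \sum_(1 <= i < p.+1)
    sg ((2%:Z - 1) * (i%:Z - 1)) *: circ 2 (a *: f + g) i mu =
  a *: (\sum_(1 <= i < p.+1) sg ((2%:Z - 1) * (i%:Z - 1)) *: circ 2 f i mu)
  + \sum_(1 <= i < p.+1) sg ((2%:Z - 1) * (i%:Z - 1)) *: circ 2 g i mu.
  rewrite scaler_sumr -big_split /=; apply: eq_bigr => i _.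
  rewrite scalerA [a * _]mulrC -scalerA -scalerDr; congr (_ *: _).
by rewrite scalerDr opprD !scalerA mulrC.
Qed.

Lemma cocycle_closed p : submod_closed (cocycle p).
Proof.
have [c0 cD] := cochain_closed p.
split.
  apply/andP; split=> //; apply/eqP.
  by have := coboundary_linear p (-1) 0 0; rewrite scaler0 addr0 scaleN1r addNr.
move=> a f g /andP[cf /eqP df] /andP[cg /eqP dg]; apply/andP; split.
  exact: cD.
by rewrite coboundary_linear df dg scaler0 addr0.
Qed.
HB.instance Definition _ p :=
  GRing.isSubmodClosed.Build k (seq A -> A) (cocycle p) (cocycle_closed p).

Definition is_coboundary (p : nat) (f : seq A -> A) : Prop :=
  if p is q.+1 then exists2 g, g \in cochain q & f = coboundary q g else f = 0.

Definition HH (p : nat) : lmodType k := subquot (cocycle p) (is_coboundary p).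

Definition chain (n : nat) : lmodType k := tpower A n.+1.

(* The elementary chain [a_0 (x) a_1 ... a_n] of the list [a_0; ...; a_n]. *)
Definition elem (n : nat) (s : seq A) : chain n := tens n.+1 s.

(* [f .i x] for [f] of arity [p], [x] in degree [n] and [m = n - p + 1]; since
   [a_0] has position 0, one formula covers [i = 0] and [i >= 1]. *)
Definition bullet (n m p : nat) (f : seq A -> A) (i : nat) :
    chain n -> chain m :=
  @tlift k A n.+1 (chain m) (fun s => elem m (insert p f i s)).

Definition rotate (n : nat) : chain n -> chain n :=
  @tlift k A n.+1 (chain n) (fun s => elem n (rotr 1 s)).

HB.instance Definition _ n m p f i := GRing.Linear.copy (@bullet n m p f i)
  (@tlift k A n.+1 (chain m) (fun s => elem m (insert p f i s))).
HB.instance Definition _ n := GRing.Linear.copy (@rotate n)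
  (@tlift k A n.+1 (chain n) (fun s => elem n (rotr 1 s))).

Lemma rotateE n s : size s = n.+1 -> rotate (elem n s) = elem n (rotr 1 s).
Proof.
apply: tliftE => s1 s2 a x y ss; case/lastP: s2 ss => [|s2 b] ss.
  by rewrite !cats1 !rotr1_rcons; apply: (@tens_multilinear k A n.+1 [::] s1); rewrite -ss addnC.
rewrite -!rcons_cons -!rcons_cat !rotr1_rcons.
by apply: (@tens_multilinear k A n.+1 (b :: s1)); rewrite /= -ss size_rcons addnS.
Qed.

Lemma twistV_linear : linear (@twistV k A).
Proof.
move=> a x y; apply: (can_inj (@twistK k A)).
by rewrite linearP /= !twistVK.
Qed.
Lemma twist_pred_linear p : linear (twist_pred p).
Proof.
case: p => [|p]; first exact: twistV_linear.
by move=> a x y; elim: p => //= p ->; rewrite linearP.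
Qed.

Lemma bulletE n m p f i s : f \in cochain p -> (i + p <= n.+1)%N ->
  (m + p = n.+1)%N -> size s = n.+1 ->
  bullet m p f i (elem n s) = elem m (insert p f i s).
Proof.
move=> /asboolP[_ fm _] ip mp; apply: tliftE => s1 s2 a x y ss.
have sz z : size (s1 ++ z :: s2) = n.+1 by rewrite size_cat /= addnS.
rewrite /insert /elem.
have [lt|ge] := ltnP (size s1) i.
  have E z : take i (s1 ++ z :: s2) = s1 ++ z :: take (i - size s1).-1 s2.
    rewrite take_cat ltnNge ltnW //=; case: (i - size s1)%N (subn_gt0 (size s1) i) => //.
    by rewrite lt.
  have D j z : (size s1 < j)%N -> drop j (s1 ++ z :: s2) = drop (j - size s1).-1 s2.
    move=> lt'; rewrite drop_cat ltnNge ltnW //=; case: (j - size s1)%N (subn_gt0 (size s1) j) => //.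
    by rewrite lt'.
  have lt2 : (size s1 < i + p)%N by rewrite (leq_trans lt) // leq_addr.
  rewrite !E !D // !map_cat -!catA /= twist_pred_linear.
  apply: tens_multilinear; rewrite size_map size_cat !size_map /= size_map size_take size_drop.
  have := ss; case: ltnP; lia.
have T z : take i (s1 ++ z :: s2) = take i s1.
  by rewrite take_cat ltn_neqAle ge andbT; case: eqP => //= ->; rewrite subnn take0 cats0 take_size.
have D z : drop i (s1 ++ z :: s2) = drop i s1 ++ z :: s2.
  rewrite drop_cat ltn_neqAle ge andbT; case: eqP => //= ->; rewrite subnn drop0 drop_size //.
have [lt|ge2] := ltnP (size s1) (i + p).
  have E z : take p (drop i s1 ++ z :: s2) = drop i s1 ++ z :: take (p - (size s1 - i)).-1 s2.
    rewrite take_cat size_drop ltnNge; have -> : (size s1 - i <= p)%N by lia.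
    have : (0 < p - (size s1 - i))%N by lia. by rewrite /=; case: (p - (size s1 - i))%N.
  have D2 z : drop (i + p) (s1 ++ z :: s2) = drop (i + p - size s1).-1 s2.
    rewrite drop_cat ltnNge ltnW //=; case: (i + p - size s1)%N (subn_gt0 (size s1) (i + p)) => //.
    by rewrite lt.
  rewrite !T !D !E !D2 fm; last first.
    rewrite size_drop size_take; have := ss; case: ltnP; lia.
  apply: tens_multilinear; rewrite !size_map size_take size_drop; have := ss; case: ltnP; lia.
have E z : take p (drop i s1 ++ z :: s2) = take p (drop i s1).
  rewrite take_cat size_drop; case: ltnP => // h; have -> : p = (size s1 - i)%N by lia.
  by rewrite subnn take0 cats0 -size_drop take_size.
have D2 z : drop (i + p) (s1 ++ z :: s2) = drop (i + p) s1 ++ z :: s2.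
  rewrite drop_cat ltn_neqAle ge2 andbT; case: eqP => //= ->; rewrite subnn drop0 drop_size //.
rewrite !T !D !E !D2 !map_cat /= twist_pred_linear -!cat_cons !catA.
apply: tens_multilinear; rewrite size_cat /= !size_map size_take size_drop; have := ss; case: ltnP; lia.
Qed.

(* In degree 0 this is the zero map, which stands for the map to
   [chain (-1) = 0]. *)
Definition boundary (n : nat) (x : chain n) : chain n.-1 :=
  if n == 0%N then 0 else
  \sum_(0 <= i < n) sg i%:Z *: bullet n.-1 2 mu i x
  + sg n%:Z *: bullet n.-1 2 mu 0 (rotate x).

Lemma boundary_linear n : linear (@boundary n).
Proof.
move=> a x y; rewrite /boundary; case: (n == 0%N).
  by rewrite scaler0 addr0.
rewrite !linearP; under eq_bigr do rewrite !linearP.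
by rewrite big_split -scaler_sumr /= addrACA -scalerDr.
Qed.
HB.instance Definition _ n := GRing.isLinear.Build k (chain n) (chain n.-1)
  *:%R (@boundary n) (@boundary_linear n).

Definition cycle (n : nat) : {pred chain n} := fun x => boundary x == 0.

Lemma cycle_closed n : submod_closed (@cycle n).
Proof.
split=> [|a x y /eqP dx /eqP dy]; first by apply/eqP; rewrite linear0.
by apply/eqP; rewrite linearP /= dx dy scaler0 addr0.
Qed.
HB.instance Definition _ n :=
  GRing.isSubmodClosed.Build k (chain n) (@cycle n) (@cycle_closed n).

Definition is_boundary (n : nat) (x : chain n) : Prop :=
  exists y : chain n.+1, x = boundary y.

Definition HHd (n : nat) : lmodType k := subquot (@cycle n) (@is_boundary n).

Definition degenerate (n : nat) (x : chain n) : Prop :=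
  exists s, [/\ size s = n.+1, one A \in behead s & x = elem n s].

Definition nchain (n : nat) : lmodType k := quotmod (@degenerate n).

Definition normalize (n : nat) : chain n -> nchain n := qproj (@degenerate n).

(* The normalized chain [normalize x] is a cycle, and its class is the image
   of [c] under the map induced in homology by [normalize]. *)
Definition nrepresents (n : nat) (c : HHd n) (x : chain n) : Prop :=
  normalize (boundary x) = 0 /\
  exists (z : chain n) (y : chain n.+1),
    represents c z /\ normalize x = normalize (z + boundary y).

(* The result has degree [m = n - p]. *)
Definition contract (n m p : nat) (f : seq A -> A) (x : chain n) : chain m :=
  if (p <= n)%N then bullet m p.+1 (circ p mu 2 f) 0 x else 0.

(* The result has degree [m = n - p + 1]. *)
Definition lie_der (n m p : nat) (f : seq A -> A) (x : chain n) : chain m :=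
  if (p < n.+1)%N then
    \sum_(1 <= i < (n - p).+2)
      sg ((p%:Z - 1) * (i%:Z - 1)) *: bullet m p f i x
    + \sum_(1 <= i < p.+1)
      sg (n%:Z * (i%:Z - 1) + p%:Z - 1) *: bullet m p f 0 (iter i.-1 (@rotate n) x)
  else if p == n.+1 then
    sg (p%:Z - 1) *: \sum_(0 <= i < n.+1)
      sg (i%:Z * n%:Z) *: bullet m p f 0 (iter i (@rotate n) x)
  else 0.

Definition connes (n : nat) (x : chain n) : chain n.+1 :=
  \sum_(0 <= i < n.+1) sg (i%:Z * n%:Z) *:
    (let y := rotate (bullet n.+1 0 (const_cochain (one A)) n.+1
                        (iter i (@rotate n) x)) in
     y - rotate y).

End HochschildCochains.

(* Extension of a family indexed by [nat] to a graded module indexed by [int]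
   which vanishes in negative degrees. *)
Definition extend0 (k : comNzRingType) (H : nat -> lmodType k) (z : int) :
    lmodType k :=
  if z is Posz n then H n else 'rV[k]_0.

Definition cohomology (k : comNzRingType) (A : regUnitalHomAss k) :
    int -> lmodType k := extend0 (HH A).
Definition homology (k : comNzRingType) (A : regUnitalHomAss k) :
    int -> lmodType k := extend0 (HHd A).

(* The homogeneous components of a graded operation take as an argument an
   equation giving the degree of the result. *)
Record gerstenhaber (k : comNzRingType) (A : int -> lmodType k) := Gerstenhaber {
  gcup : forall p q n : int, n = p + q -> A p -> A q -> A n;
  gbrk : forall p q n : int, n = p + q - 1 -> A p -> A q -> A n;
  gcup_bilinear : forall p q n e,
    bilinear_for *:%R *:%R (@gcup p q n e);
  gbrk_bilinear : forall p q n e,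
    bilinear_for *:%R *:%R (@gbrk p q n e);
  gcupC : forall p q n e e' f g,
    @gcup p q n e f g = sg (p * q) *: @gcup q p n e' g f;
  gcupA : forall p q r pq qr n e1 e2 e3 e4 f g h,
    @gcup pq r n e2 (@gcup p q pq e1 f g) h
    = @gcup p qr n e4 f (@gcup q r qr e3 g h);
  gbrkC : forall p q n e e' f g,
    @gbrk p q n e f g = - (sg ((p - 1) * (q - 1)) *: @gbrk q p n e' g f);
  gbrk_jacobi : forall p q r pq pr qr n e1 e2 e3 e4 e5 e6 f g h,
    @gbrk p qr n e2 f (@gbrk q r qr e1 g h)
    = @gbrk pq r n e4 (@gbrk p q pq e3 f g) h
      + sg ((p - 1) * (q - 1)) *: @gbrk q pr n e6 g (@gbrk p r pr e5 f h);
  gbrk_cup : forall p q r pq pr qr n e1 e2 e3 e4 e5 e6 f g h,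
    @gbrk p qr n e2 f (@gcup q r qr e1 g h)
    = @gcup pq r n e4 (@gbrk p q pq e3 f g) h
      + sg ((p - 1) * q) *: @gcup q pr n e6 g (@gbrk p r pr e5 f h)
}.

Record precalculus (k : comNzRingType) (A Om : int -> lmodType k) := Precalculus {
  gerst :> gerstenhaber A;
  cact : forall p n m : int, m = n - p -> A p -> Om n -> Om m;
  clie : forall p n m : int, m = n - p + 1 -> A p -> Om n -> Om m;
  cact_bilinear : forall p n m e, bilinear_for *:%R *:%R (@cact p n m e);
  clie_bilinear : forall p n m e, bilinear_for *:%R *:%R (@clie p n m e);
  cact_cup : forall p q pq n l m e1 e2 e3 e4 f g x,
    @cact pq n m e2 (@gcup _ _ gerst p q pq e1 f g) x
    = @cact p l m e4 f (@cact q n l e3 g x);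
  clie_brk : forall p q pq n l l' m e1 e2 e3 e4 e5 e6 f g x,
    @clie pq n m e2 (@gbrk _ _ gerst p q pq e1 f g) x
    = @clie p l m e4 f (@clie q n l e3 g x)
      - sg ((p - 1) * (q - 1)) *: @clie q l' m e6 g (@clie p n l' e5 f x);
  cact_brk : forall p q pq n l l' m e1 e2 e3 e4 e5 e6 f g x,
    @cact pq n m e2 (@gbrk _ _ gerst p q pq e1 f g) x
    = @cact p l m e4 f (@clie q n l e3 g x)
      - sg (p * (q + 1)) *: @clie q l' m e6 g (@cact p n l' e5 f x)
}.

Record calculus (k : comNzRingType) (A Om : int -> lmodType k) := Calculus {
  precalc :> precalculus A Om;
  cB : forall n m : int, m = n + 1 -> Om n -> Om m;
  cB_linear : forall n m e, linear (@cB n m e);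
  cB_square : forall n m l e e' x, @cB m l e' (@cB n m e x) = 0;
  cartan : forall p n l l' m e1 e2 e3 e4 e5 f x,
    @clie _ _ _ precalc p n m e1 f x
    = @cB l m e3 (@cact _ _ _ precalc p n l e2 f x)
      - sg p *: @cact _ _ _ precalc p l' m e5 f (@cB n l' e4 x)
}.

(* Main.v *)
(* Let [Y_i(f)] be the insertion of a cochain [f] at position [i] of a tensor
   of any length, with its Koszul sign, and [tau] the signed rotation.  In these
   terms all operations of the theorem are sums of composites: the cup product
   and [i_f] involve [D_0 Y_1(f)], where [D_i = Y_i(mu)], the boundary is
   [b = sum_i D_i + D_0 tau], and [L_f] is a sum of insertions after rotations.
   The twist by alpha disappears, since only the commutation rules between the
   [Y_i(f)] and [tau] matter.  Writing [rho_a(f) = sum_(i >= a) Y_i(f)], one has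
   [rho_a(f) rho_a(g) - eps rho_a(g) rho_a(f) = rho_a([f, g])], which gives the
   graded Lie algebra as [rho] is faithful; it and the other identities
   follow by downward induction on [a].  Commutativity of the cup product, the
   Leibniz rule, the formula for [i_[f, g]] and Cartan's formula hold up to
   explicit homotopies, the first two given by [f o g] and the brace [f{g, h}],
   the last two built from insertions summed over rotations.  On homology
   [L_f] is thus the commutator of [B] and [i_f], and [L_[f, g]] is computed
   formally from the formula for [i_[f, g]] and [B^2 = 0].  For [B] on normalized
   chains, the degenerate chains are filtered by the last position of a [1],
   and inserting one more [1] gives a homotopy that lowers the filtration; hence
   they form an acyclic subcomplex, and classes are determined by their
   normalized representatives. *)

(* An insertion whose block of arguments does not fit is zero. With this convention the rules for
   nested and for disjoint insertions ([Ycirc], [Yswap]) hold on tensors of every length, so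
   identities that involve insertions alone are proved without tracking lengths. Lengths enter with
   the rotation, where the insertion that ends at the last entry wraps around to the front. A second
   obstacle is degree -1. Arities are natural numbers, so the bracket of two 0-cochains gets the
   truncated arity 0, whose parity is wrong. Such cochains are empty sums, hence zero; the parity
   lemmas and the changes of arity rest on this. The homotopies for [i] and [L] are established for
   closed cochains on cycles, where the terms containing [b x] disappear. In [connes] the factor
   [id - t] contains the unsigned rotation. The operator on homology is therefore induced by
   [(1 - tau) s N], with the signed rotation [tau], the insertion [s] of 1 in front and the norm
   [N]. It anticommutes with [b] on all chains and differs from [connes] by degenerate chains. *)
Require Import Defs.
From mathcomp Require Import all_boot all_order all_algebra.
From HB Require Import structures.
From mathcomp Require Import boolp functions freeg zify.

Set Implicit Arguments.
Unset Strict Implicit.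
Unset Printing Implicit Defensive.

Import GRing.Theory.
Local Open Scope ring_scope.

(** * Deciding identities in abelian groups *)

Section ZmodReflection.
Variable V : zmodType.

Inductive zexp := ZAtom of nat | ZAdd of zexp & zexp | ZOpp of zexp | Zero.

Fixpoint zeval (env : seq V) t : V :=
  match t with
  | ZAtom i => nth 0 env i
  | ZAdd t u => zeval env t + zeval env u
  | ZOpp t => - zeval env t
  | Zero => 0
  end.

Fixpoint zatoms (b : bool) t : seq nat :=
  match t with
  | ZAtom i => if b then [:: i] else [::]
  | ZAdd t u => zatoms b t ++ zatoms b u
  | ZOpp t => zatoms (~~ b) t
  | Zero => [::]
  end.

Lemma zeval_atoms env t :
  zeval env t = \sum_(i <- zatoms true t) nth 0 env i
                - \sum_(i <- zatoms false t) nth 0 env i.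
Proof.
elim: t => [i|t IHt u IHu|t IHt|] /=; rewrite ?big_nil ?subr0 //.
- by rewrite big_seq1.
- by rewrite IHt IHu !big_cat opprD addrACA.
- by rewrite IHt opprB.
Qed.

(** Negative atoms cross to the other side, so cancellation needs no normal form: equality in the
    free abelian group is equality of two multisets of atoms. *)
Lemma zeval_eq env t u :
  perm_eq (zatoms true t ++ zatoms false u) (zatoms true u ++ zatoms false t) ->
  zeval env t = zeval env u.
Proof.
move=> E; have : \sum_(i <- zatoms true t ++ zatoms false u) nth 0 env i
  = \sum_(i <- zatoms true u ++ zatoms false t) nth 0 env i by exact: perm_big.
rewrite !big_cat /= !zeval_atoms => H; apply/eqP.
by rewrite subr_eq addrAC eq_sym subr_eq eq_sym H.
Qed.
End ZmodReflection.

Ltac zindex x env :=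
  lazymatch env with
  | x :: _ => constr:(O)
  | _ :: ?env' => let n := zindex x env' in constr:(S n)
  end.
Ltac zmember x env :=
  lazymatch env with
  | x :: _ => constr:(true)
  | _ :: ?env' => zmember x env'
  | _ => constr:(false)
  end.
Ltac zcollect t env :=
  lazymatch t with
  | (?u + ?v)%R => let env' := zcollect u env in zcollect v env'
  | (- ?u)%R => zcollect u env
  | 0%R => env
  | _ => lazymatch zmember t env with
         | true => env | false => constr:(t :: env) end
  end.
Ltac zreify t env :=
  lazymatch t with
  | (?u + ?v)%R => let u' := zreify u env in let v' := zreify v env in
                   constr:(ZAdd u' v')
  | (- ?u)%R => let u' := zreify u env in constr:(ZOpp u')
  | 0%R => constr:(Zero)
  | _ => let n := zindex t env in constr:(ZAtom n)
  end.
Ltac zmodule :=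
  lazymatch goal with
  | |- @eq ?V ?t ?u =>
    let env := zcollect t (@nil V) in
    let env := zcollect u env in
    let t' := zreify t env in
    let u' := zreify u env in
    refine (@zeval_eq _ env t' u' _); vm_compute; exact: erefl
  end.

(* All the signs of the Koszul calculus are kept in this form, so that an
   identity between signed terms is settled by case analysis on parities. *)
Definition sn (V : zmodType) (b : bool) (x : V) : V := if b then - x else x.

(** * Tensors of all lengths *)

Section TensorModule.
Variables (k : comNzRingType) (A : lmodType k).

Definition mlin (W : lmodType k) (F : seq A -> W) : Prop :=
  forall (s1 s2 : seq A) (a : k) (x y : A),
    F (s1 ++ (a *: x + y) :: s2) = a *: F (s1 ++ x :: s2) + F (s1 ++ y :: s2).

Definition word (s : seq A) : {freeg (seq A) / k} := << 1 *g s >>.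

Definition ttensor_rel (u : {freeg (seq A) / k}) : Prop :=
  exists (s1 s2 : seq A) (a : k) (x y : A),
    u = word (s1 ++ (a *: x + y) :: s2)
        - (a *: word (s1 ++ x :: s2) + word (s1 ++ y :: s2)).

(** The relations preserve the length of words, so this is the direct sum of all tensor powers.
    Operators that change the length can thus be composed and added inside one module. *)
Definition words_mod : lmodType k := quotmod ttensor_rel.

Definition qword (s : seq A) : words_mod := qproj ttensor_rel (word s).

Lemma qword_mlin : mlin qword.
Proof.
move=> s1 s2 a x y; rewrite /qword -linearP; apply/qprojP/spannedP.
by exists s1, s2, a, x, y.
Qed.

Definition qlift (W : lmodType k) (F : seq A -> W) (x : words_mod) : W :=
  if `[< mlin F >] then fglift F (qrepr x) else 0.

Lemma fglift_ttensor_rel (W : lmodType k) (F : seq A -> W) u :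
  mlin F -> u \in spanned ttensor_rel -> fglift F u = 0.
Proof.
move=> mF.
pose G := HB.pack_for {linear {freeg (seq A) / k} -> W} (fglift F : {freeg (seq A) / k} -> W)
  (GRing.isLinear.Build _ _ _ _ _ (@fglift_linear k (seq A) W F)).
have GE x : fglift F x = G x by [].
have GT s : G (word s) = F s by rewrite -GE liftU scale1r.
case/asboolP=> s [Ps ->]; rewrite GE linear_sum big_seq big1 // => c /Ps.
case=> s1 [s2 [a [x [y ->]]]].
by rewrite linearZ linearB linearP !GT mF subrr /= scaler0.
Qed.

Lemma qlift_linear (W : lmodType k) (F : seq A -> W) : linear (@qlift W F).
Proof.
move=> a x y; rewrite /qlift; case: asboolP => [mF|_]; last first.
  by rewrite scaler0 addr0.
rewrite -fglift_linear; apply/eqP; rewrite -subr_eq0; apply/eqP.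
rewrite fgliftB.
by apply: fglift_ttensor_rel => //; apply/qprojP; rewrite linearP /= !qreprK.
Qed.
Lemma qliftE (W : lmodType k) (F : seq A -> W) s :
  mlin F -> qlift F (qword s) = F s.
Proof.
move=> mF; rewrite /qlift asboolT //.
have <- : fglift F (word s) = F s by rewrite liftU scale1r.
apply/eqP; rewrite -subr_eq0; apply/eqP.
rewrite fgliftB; apply: fglift_ttensor_rel => //.
by apply/qprojP; rewrite qreprK.
Qed.

Lemma qword_ind (P : words_mod -> Prop) :
  P 0 -> (forall a x y, P x -> P y -> P (a *: x + y)) -> (forall s, P (qword s)) ->
  forall x, P x.
Proof.
move=> P0 PD Pt x; rewrite -[x]qreprK -[qrepr x]freeg_sumE.
rewrite linear_sum /=; elim: (dom _) => [|s r IH]; rewrite ?big_nil // big_cons.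
suff -> : qproj ttensor_rel << coeff s (qrepr x) *g s >> = coeff s (qrepr x) *: qword s by apply: PD.
rewrite /qword -linearZ /=; congr qproj.
apply/eqP/freeg_eqP => t; rewrite coeffU.
by rewrite coeff_fgscale coeffU mul1r.
Qed.

(* The module of tensors of all lengths. It is sealed, since unfolding the
   quotient makes unification explode. *)
Record tensor_module := TensorModule {
  tm_sort : lmodType k;
  tm_word : seq A -> tm_sort;
  tm_lift : forall W : lmodType k, (seq A -> W) -> tm_sort -> W;
  tm_mlin : mlin tm_word;
  tm_linear : forall W F, linear (@tm_lift W F);
  tm_liftE : forall (W : lmodType k) (F : seq A -> W) s, mlin F -> tm_lift F (tm_word s) = F s;
  tm_ind : forall P : tm_sort -> Prop, P 0 ->
    (forall a x y, P x -> P y -> P (a *: x + y)) -> (forall s, P (tm_word s)) ->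
    forall x, P x
}.

Lemma tensor_module_exists : tensor_module.
Proof. exact: TensorModule qword_mlin qlift_linear qliftE qword_ind. Qed.

Definition ttensor : lmodType k := tm_sort tensor_module_exists.
Definition tt : seq A -> ttensor := @tm_word tensor_module_exists.
Definition ttlift (W : lmodType k) (F : seq A -> W) : ttensor -> W :=
  @tm_lift tensor_module_exists W F.
Lemma tt_mlin : mlin tt. Proof. exact: tm_mlin. Qed.
Lemma ttlift_linear (W : lmodType k) (F : seq A -> W) : linear (@ttlift W F).
Proof. exact: tm_linear. Qed.
HB.instance Definition _ (W : lmodType k) (F : seq A -> W) :=
  GRing.isLinear.Build k ttensor W *:%R (@ttlift W F) (@ttlift_linear W F).
Lemma ttliftE (W : lmodType k) (F : seq A -> W) s :
  mlin F -> ttlift F (tt s) = F s.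
Proof. exact: tm_liftE. Qed.
Lemma tt_ind (P : ttensor -> Prop) :
  P 0 -> (forall a x y, P x -> P y -> P (a *: x + y)) -> (forall s, P (tt s)) ->
  forall x, P x.
Proof. exact: tm_ind. Qed.

Lemma tpower_ext n (W : lmodType k) (F G : {linear tpower A n -> W}) :
  (forall s, size s = n -> F (tens n s) = G (tens n s)) -> F =1 G.
Proof.
move=> FG x; rewrite -[x]qreprK -[qrepr x]freeg_sumE !linear_sum.
apply: eq_bigr => t _; rewrite /=.
suff -> : qproj (@tens_rel k A n) << coeff t (qrepr x) *g t >> = coeff t (qrepr x) *: tens n t.
  by rewrite !linearZ FG // size_tuple.
rewrite /tens -linearZ /=; congr qproj.
rewrite /free_tens valK.
apply/eqP/freeg_eqP => u; rewrite coeffU.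
by rewrite coeff_fgscale coeffU mul1r.
Qed.

(* The sum of all [Z i], [i >= a], provided that [Z i] kills the words of
   length less than [i] (see [locfin]). *)
Definition tail (Z : nat -> {linear ttensor -> ttensor}) (a : nat) : ttensor -> ttensor :=
  ttlift (fun s => \sum_(a <= i < (size s).+2) Z i (tt s)).
HB.instance Definition _ Z a := GRing.Linear.copy (tail Z a)
  (ttlift (fun s => \sum_(a <= i < (size s).+2) Z i (tt s))).

Lemma tailE Z a s : tail Z a (tt s) = \sum_(a <= i < (size s).+2) Z i (tt s).
Proof.
apply: ttliftE => s1 s2 b x y; rewrite !size_cat /=.
under eq_bigr do rewrite tt_mlin linearP.
by rewrite big_split -scaler_sumr.
Qed.

Lemma tail_large Z x : exists M, forall a, (M <= a)%N -> tail Z a x = 0.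
Proof.
elim/tt_ind: x => [|a x y [M Mx] [M' My]|s].
- by exists 0%N => a _; rewrite linear0.
- exists (maxn M M') => b; rewrite geq_max => /andP[/Mx Ex /My Ey].
  by rewrite linearP /= Ex Ey scaler0 addr0.
- by exists (size s).+2 => a le; rewrite tailE big_geq.
Qed.

Definition locfin (Z : nat -> {linear ttensor -> ttensor}) :=
  forall s i, (size s < i)%N -> Z i (tt s) = 0.

Lemma tailS Z a x : locfin Z -> tail Z a x = Z a x + tail Z a.+1 x.
Proof.
move=> fZ; elim/tt_ind: x => [|b x y Ex Ey|s].
- by rewrite !linear0 addr0.
- by rewrite !linearP /= Ex Ey scalerDr addrACA.
rewrite !tailE; have [lt|ge] := ltnP a (size s).+2.
  by rewrite big_ltn.
by rewrite !big_geq ?fZ ?addr0 //; lia.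
Qed.

(** The induction behind all identities between tails: both sides vanish for large [a], and [tailS]
    peels off a single insertion in passing from [a.+1] to [a]. *)
Lemma tail_down (P : nat -> Prop) :
  (exists M, forall a, (M <= a)%N -> P a) -> (forall a, P a.+1 -> P a) ->
  forall a, P a.
Proof.
move=> [M PM] PS a; have [|lt] := leqP M a; first exact: PM.
have -> : a = (M - (M - a))%N by lia.
elim: (M - a)%N (leq_subr a M) => [|d IH] le; first by apply: PM; rewrite subn0.
apply: PS; have -> : (M - d.+1).+1 = (M - d)%N by lia.
by apply: IH; lia.
Qed.
End TensorModule.

(** * Insertions and rotations *)

Section Signs.
Variables (k : comNzRingType) (V : lmodType k).
Lemma snZ b (x : V) : sn b x = ((-1) ^+ nat_of_bool b : k) *: x.
Proof. by case: b; rewrite /sn ?expr1 ?expr0 ?scaleN1r ?scale1r. Qed.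
Lemma sgZ (z : int) (x : V) : sg z *: x = sn (odd `|z|) x.
Proof. by rewrite snZ /sg signr_odd. Qed.
Lemma sn_linear b : linear (@sn V b).
Proof. by move=> a x y; rewrite !snZ scalerDr !scalerA [a * _]mulrC. Qed.
End Signs.

Lemma sn_mlin (k : comNzRingType) (A W : lmodType k) b (F : seq A -> W) :
  mlin F -> mlin (fun s => sn b (F s)).
Proof. by move=> mF s1 s2 a x y; rewrite mF sn_linear. Qed.

(* The parity of the degree [p - 1] of a cochain of arity [p]. *)
Definition par (p : nat) : bool := ~~ odd p.

Section Operators.
Variables (k : comNzRingType) (A : regUnitalHomAss k).
Local Notation TT := (@ttensor k A).
Local Notation tp := (@twist_pred k A).
Local Notation alpha := (twist A).

Lemma twist_predC p q x : tp p (tp q x) = tp q (tp p x).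
Proof.
case: p q => [|p] [|q] //=; last by rewrite -!iterD addnC.
  apply: (can_inj (@twistK k A)); rewrite twistVK -iterS iterSr.
  by rewrite twistVK.
apply/esym; apply: (can_inj (@twistK k A)); rewrite twistVK -iterS iterSr.
by rewrite twistVK.
Qed.

(** In exponents of [alpha] this is [p + (q - 1) = (p + q) - 1], also for [q = 0], where [alpha^-1]
    occurs. *)
Lemma twist_predD p q x : tp p.+1 (tp q x) = tp (p + q) x.
Proof.
case: q => [|q]; last by rewrite addnS /= -iterD.
by rewrite addn0; case: p => [|p] //=; rewrite -iterS iterSr twistVK.
Qed.

Lemma twist_predf p q f s : f \in @cochain k A q -> tp p (f s) = f (map (tp p) s).
Proof.
move=> /asboolP[_ _ fa]; case: p => [|p] /=.
  apply: (can_inj (@twistK k A)); rewrite twistVK fa -map_comp.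
  by rewrite (eq_map (g := id)) ?map_id // => x /=; rewrite twistVK.
elim: p s => [|p IH] s /=; first by rewrite map_id.
by rewrite IH fa -map_comp.
Qed.

Lemma insert_cat p f i (s1 s2 s3 : seq A) : size s1 = i -> size s2 = p ->
  insert p f i (s1 ++ s2 ++ s3) = map (tp p) s1 ++ f s2 :: map (tp p) s3.
Proof.
move=> <- <-; rewrite /insert take_size_cat // drop_size_cat // take_size_cat //.
by rewrite catA drop_size_cat // size_cat.
Qed.

Lemma size_insert p f i (s : seq A) : (i + p <= size s)%N ->
  size (insert p f i s) = ((size s).+1 - p)%N.
Proof.
by move=> le; rewrite /insert size_cat /= !size_map size_take size_drop; case: ltnP => h; lia.
Qed.

Lemma split3 i p (s : seq A) : (i + p <= size s)%N ->
  exists s1 s2 s3, [/\ s = s1 ++ s2 ++ s3, size s1 = i & size s2 = p].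
Proof.
move=> le; exists (take i s), (take p (drop i s)), (drop p (drop i s)).
rewrite !cat_take_drop; split=> //; rewrite size_takel ?size_drop //; lia.
Qed.

(** The twists [alpha^(q-1)] and [alpha^(p-1)] applied in turn to an outer entry compose to the
    twist for the arity [p + q - 1] of the composite. *)
Lemma insert_in p q l f g i (s : seq A) : (l < p)%N -> (i + (p + q).-1 <= size s)%N ->
  insert p f i (insert q g (i + l) s) = insert (p + q).-1 (circ q f l.+1 g) i s.
Proof.
case: p => // p; rewrite addSn /= => lp le.
have [s1 [s2 [s3 [-> ss1 ss2]]]] := split3 le.
have [|u [v [w [E su sv]]]] := @split3 l q s2; first by rewrite ss2; lia.
rewrite [RHS](insert_cat _ _ ss1 ss2) E.
have -> : s1 ++ (u ++ v ++ w) ++ s3 = (s1 ++ u) ++ v ++ (w ++ s3).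
  by rewrite -!catA.
rewrite (@insert_cat q) ?size_cat ?ss1 ?su // !map_cat.
have -> : (map (tp q) s1 ++ map (tp q) u) ++ g v :: map (tp q) w ++ map (tp q) s3 =
  map (tp q) s1 ++ (map (tp q) u ++ g v :: map (tp q) w) ++ map (tp q) s3.
  by rewrite -!catA.
rewrite insert_cat ?size_map //; last first.
  by move: ss2; rewrite E !size_cat /= !size_map sv su; lia.
rewrite -!map_comp; congr (_ ++ _ :: _).
- by apply: eq_map => x /=; rewrite -twist_predD.
- by rewrite /circ /= insert_cat.
- by apply: eq_map => x /=; rewrite -twist_predD.
Qed.

(** Each value passes through the twist applied by the other insertion because cochains commute with
    [alpha]. The block of [f] lies to the right of that of [g], hence the shift of its position by
    [q - 1]. *)
Lemma insert_out p q f g i j (s : seq A) : f \in @cochain k A p -> g \in @cochain k A q ->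
  (j < i)%N -> (i + q + p <= (size s).+1)%N ->
  insert p f i (insert q g j s) = insert q g j (insert p f (i + q).-1 s).
Proof.
move=> cf cg ji le.
have [|s1 [w [s3 [-> ss1 sw]]]] := @split3 (i + q).-1 p s; first lia.
have [|u [v [u' [E su sv]]]] := @split3 j q s1; first by rewrite ss1; lia.
rewrite (insert_cat f _ ss1 sw) E.
have -> : (u ++ v ++ u') ++ w ++ s3 = u ++ v ++ (u' ++ w ++ s3) by rewrite -!catA.
rewrite (insert_cat g _ su sv) !map_cat.
have -> : map (tp q) u ++ g v :: map (tp q) u' ++ map (tp q) w ++ map (tp q) s3 =
   (map (tp q) u ++ g v :: map (tp q) u') ++ map (tp q) w ++ map (tp q) s3.
  by rewrite -!catA.
rewrite insert_cat ?size_map //; last first.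
  by move: ss1; rewrite E !size_cat /= !size_map sv su; lia.
have -> : (map (tp p) u ++ map (tp p) v ++ map (tp p) u') ++ f w :: map (tp p) s3 =
  map (tp p) u ++ map (tp p) v ++ (map (tp p) u' ++ f w :: map (tp p) s3).
  by rewrite -!catA.
rewrite insert_cat ?size_map //.
have C r : map (tp p) (map (tp q) r) = map (tp q) (map (tp p) r).
  by rewrite -!map_comp; apply: eq_map => x /=; rewrite twist_predC.
rewrite !map_cat /= -catA /=.
by rewrite (twist_predf _ _ cf) (twist_predf _ _ cg) !C.
Qed.

Lemma rotr1_insert p f i (s : seq A) : (i + p < size s)%N ->
  rotr 1 (insert p f i s) = insert p f i.+1 (rotr 1 s).
Proof.
case/lastP: s => // s x; rewrite size_rcons ltnS => le.
have [s1 [s2 [s3 [-> ss1 ss2]]]] := split3 le.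
have -> : rcons (s1 ++ s2 ++ s3) x = s1 ++ s2 ++ rcons s3 x by rewrite !rcons_cat.
rewrite insert_cat // map_rcons -rcons_cons -!rcons_cat !rotr1_rcons.
by rewrite -!cat_cons (@insert_cat p f i.+1) //= ss1.
Qed.

(** The value of [f] is the last entry, so rotating it to the front amounts to rotating its [p]
    arguments to the front beforehand. *)
Lemma rotr1_insert_last p f i (s : seq A) : (i + p)%N = size s ->
  rotr 1 (insert p f i s) = insert p f 0 (iter p (rotr 1) s).
Proof.
move=> E; have [|s1 [s2 [s3 [Es ss1 ss2]]]] := @split3 i p s; first by rewrite E.
have s30 : s3 = [::] by apply/size0nil; move: E; rewrite Es !size_cat; lia.
have -> : iter p (rotr 1) s = s2 ++ s1.
  rewrite Es s30 cats0 -ss2; elim/last_ind: s2 s1 {ss1 ss2 Es E} => [|s2 x IH] s1.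
    by rewrite cats0.
  by rewrite size_rcons iterSr -rcons_cat rotr1_rcons -cat_cons IH cat_rcons.
rewrite Es s30 insert_cat // cats1 rotr1_rcons.
by rewrite (@insert_cat p f 0 [::]).
Qed.

Definition ttof n : chain A n -> TT := @tlift k A n.+1 _ (@tt k A).
HB.instance Definition _ n := GRing.Linear.copy (@ttof n)
  (@tlift k A n.+1 _ (@tt k A)).

Lemma ttofE n s : size s = n.+1 -> ttof (elem n s) = tt s.
Proof. by apply: tliftE => s1 s2 a x y _; apply: tt_mlin. Qed.

(* [insert] is multilinear because [bullet] is linear and computed by it. *)
Lemma insert_mlin p f i : f \in @cochain k A p ->
  mlin (fun s => if (i + p <= size s)%N then tt (insert p f i s) else 0).
Proof.
move=> cf s1 s2 a x y.
have sz z : size (s1 ++ z :: s2) = (size s1 + size s2).+1 by rewrite size_cat /= addnS.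
rewrite !sz; set n := (size s1 + size s2)%N; case: leqP => le; last by rewrite scaler0 addr0.
have mp : ((n.+1 - p) + p)%N = n.+1 by lia.
rewrite -!(@ttofE (n.+1 - p)) ?size_insert ?sz //; try lia.
rewrite -!(bulletE cf le mp) ?sz // -linearP -linearP.
by congr (ttof (bullet _ _ _ _ _)); apply: tens_multilinear.
Qed.

(* The insertion of [f] at position [i], counted from 0, carries the Koszul
   sign [(-1)^((p - 1) i)], and the rotation of [N] entries the sign
   [(-1)^(N - 1)]; with these, no further signs depending on positions occur. *)
Definition Y p f i : TT -> TT :=
  ttlift (fun s => sn (par p && odd i)
    (if (i + p <= size s)%N then tt (insert p f i s) else 0)).
HB.instance Definition _ p f i := GRing.Linear.copy (Y p f i)
  (ttlift (fun s => sn (par p && odd i)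
    (if (i + p <= size s)%N then tt (insert p f i s) else 0))).

Definition tau : TT -> TT := ttlift (fun s => sn (par (size s)) (tt (rotr 1 s))).
HB.instance Definition _ := GRing.Linear.copy tau
  (ttlift (fun s => sn (par (size s)) (tt (rotr 1 s)))).

Lemma YE p f i s : f \in @cochain k A p ->
  Y p f i (tt s) = sn (par p && odd i)
    (if (i + p <= size s)%N then tt (insert p f i s) else 0).
Proof. by move=> cf; apply: ttliftE; apply: sn_mlin; apply: insert_mlin. Qed.

Lemma tauE s : tau (tt s) = sn (par (size s)) (tt (rotr 1 s)).
Proof.
apply: ttliftE => s1 s2 a x y.
have sz z : size (s1 ++ z :: s2) = (size s1 + size s2).+1 by rewrite size_cat /= addnS.
rewrite !sz -sn_linear; congr sn.
rewrite -!(@ttofE (size s1 + size s2)) ?size_rotr ?sz // -!rotateE ?sz //.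
rewrite -linearP -linearP /=; congr (ttof (rotate _)); exact: (@tens_multilinear k A (size s1 + size s2).+1).
Qed.

Lemma YN p f i : {morph Y p f i : x / - x}. Proof. exact: raddfN. Qed.
Lemma Y0 p f i : Y p f i 0 = 0. Proof. exact: raddf0. Qed.
Lemma tauD : {morph tau : x y / x + y}. Proof. exact: raddfD. Qed.
Lemma tauN : {morph tau : x / - x}. Proof. exact: raddfN. Qed.
Lemma tau0 : tau 0 = 0. Proof. exact: raddf0. Qed.
Lemma Ysn p f i b x : Y p f i (sn b x) = sn b (Y p f i x).
Proof. by case: b; rewrite /sn ?YN. Qed.
Lemma tausn b x : tau (sn b x) = sn b (tau x).
Proof. by case: b; rewrite /sn ?tauN. Qed.

End Operators.

Lemma snsn (V : zmodType) b c (x : V) : sn b (sn c x) = sn (b (+) c) x.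
Proof. by case: b; case: c; rewrite /sn ?opprK. Qed.
Lemma sn0 (V : zmodType) b : sn b (0 : V) = 0.
Proof. by case: b; rewrite /sn ?oppr0. Qed.

Section Calculus.
Variables (k : comNzRingType) (A : regUnitalHomAss k).
Local Notation TT := (@ttensor k A).
Local Notation Y := (@Y k A).
Local Notation tau := (@tau k A).

HB.instance Definition _ p :=
  GRing.isSubmodClosed.Build k (seq A -> A) (@cochain k A p) (@cochain_closed k A p).

Lemma sn_cochain b p f : f \in @cochain k A p -> sn b f \in @cochain k A p.
Proof. by case: b => //; rewrite /sn rpredN. Qed.

Lemma cochain_mlin p f : f \in @cochain k A p -> mlin f.
Proof.
move=> /asboolP[f0 fm _] s1 s2 a x y.
have [E|E] := eqVneq (size s1 + size s2).+1 p; first exact: fm.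
by rewrite !f0 ?scaler0 ?addr0 // size_cat /= addnS; apply/eqP.
Qed.

Lemma mlin0 (W : lmodType k) (F : seq A -> W) s1 s2 : mlin F -> F (s1 ++ 0 :: s2) = 0.
Proof. by move=> mF; have := mF s1 s2 (-1) 0 0; rewrite scaler0 addr0 scaleN1r addNr. Qed.

Lemma circ_cochain p q l f g : (l < p)%N -> f \in @cochain k A p ->
  g \in @cochain k A q -> circ q f l.+1 g \in @cochain k A (p + q).-1.
Proof.
move=> lp cf cg; have /asboolP[f0 fm fa] := cf; have /asboolP[g0 gm ga] := cg.
have ci s : circ q f l.+1 g s = f (insert q g l s) by [].
have ml := cochain_mlin cf.
pose F s := ttlift f (if (l + q <= size s)%N then tt (insert q g l s) else 0).
have FE s : (l + q <= size s)%N -> circ q f l.+1 g s = F s.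
  by move=> le; rewrite /F le ttliftE.
apply/asboolP; split.
- move=> s /eqP ss; rewrite ci; have [le|gt] := leqP (l + q) (size s).
    by apply: f0; rewrite size_insert //; move/eqP: ss; lia.
  (* Beyond the end of the word a constant is still inserted, as last entry. The new length is at
     most [l], hence below [p], so [f] vanishes. *)
  have [q0|q0] := posnP q.
    apply: f0; rewrite q0 addn0 in gt *; rewrite /insert addn0 take0 (take_oversize (ltnW gt)) (drop_oversize (ltnW gt)).
    by rewrite size_cat size_map /=; lia.
  by rewrite /insert g0 ?mlin0 // size_take size_drop; case: ltnP; lia.
- move=> s1 s2 a x y ss.
  have sz z : size (s1 ++ z :: s2) = (p + q).-1 by rewrite size_cat /= addnS.
  have le : (l + q <= (p + q).-1)%N by lia.
  by rewrite !FE ?sz // /F (insert_mlin _ cg) linearP.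
- move=> s; rewrite !ci fa; congr f; rewrite /insert map_cat /= ga.
  rewrite -?map_drop -?map_take -!map_comp; congr (_ ++ _ :: _);
  by apply: eq_map => x /=; apply: (@twist_predC _ _ 2).
Qed.

Definition circs q f l g : seq A -> A := sn (par q && odd l) (circ q f l.+1 g).

Lemma circs_cochain p q l f g : (l < p)%N -> f \in @cochain k A p ->
  g \in @cochain k A q -> circs q f l g \in @cochain k A (p + q).-1.
Proof. by move=> *; apply: sn_cochain; apply: circ_cochain. Qed.

Lemma Y_linf p i x a f g : f \in @cochain k A p -> g \in @cochain k A p ->
  Y p (a *: f + g) i x = a *: Y p f i x + Y p g i x.
Proof.
move=> cf cg; have cfg : a *: f + g \in @cochain k A p by rewrite rpredD ?rpredZ.
elim/tt_ind: x => [|b x y Ex Ey|s].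
- by rewrite !Y0 scaler0 addr0.
- by rewrite !linearP /= Ex Ey !scalerDr addrACA.
rewrite !YE // -sn_linear; congr sn.
case: ifP => _; last by rewrite scaler0 addr0.
exact: tt_mlin.
Qed.
Lemma YDf p i x f g : f \in @cochain k A p -> g \in @cochain k A p ->
  Y p (f + g) i x = Y p f i x + Y p g i x.
Proof. by move=> cf cg; have := Y_linf i x 1 cf cg; rewrite !scale1r. Qed.
Lemma Y0f p i x : Y p 0 i x = 0.
Proof. by have := Y_linf i x (-1) (rpred0 _) (rpred0 (@cochain k A p)); rewrite scaler0 addr0 scaleN1r addNr. Qed.
Lemma Ysnf p i x b f : f \in @cochain k A p ->
  Y p (sn b f) i x = sn b (Y p f i x).
Proof.
move=> cf; case: b; rewrite /sn //; have := Y_linf i x (-1) cf (rpred0 _).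
by rewrite !scaleN1r addr0 Y0f addr0.
Qed.
Lemma Ysumf p i x (r : seq nat) (F : nat -> seq A -> A) :
  (forall j, j \in r -> F j \in @cochain k A p) ->
  Y p (\sum_(j <- r) F j) i x = \sum_(j <- r) Y p (F j) i x.
Proof.
elim: r => [|j r IH] cF; rewrite ?big_nil ?Y0f // !big_cons YDf ?IH //.
- by move=> l lr; apply: cF; rewrite inE lr orbT.
- by apply: cF; rewrite inE eqxx.
- by rewrite big_seq; apply: rpred_sum => l lr; apply: cF; rewrite inE lr orbT.
Qed.

Lemma Yzero p f i s : f \in @cochain k A p -> (size s < i + p)%N -> Y p f i (tt s) = 0.
Proof. by move=> cf lt; rewrite YE // leqNgt lt /= sn0. Qed.

(** Degrees add under composition, so the signs of the two insertions combine to the sign of the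
    composite at [i] times the sign kept in [circs]. When the composite does not fit, both sides are
    zero. *)
Lemma Ycirc p q f g l i x : f \in @cochain k A p -> g \in @cochain k A q -> (l < p)%N ->
  Y p f i (Y q g (i + l) x) = Y (p + q).-1 (circs q f l g) i x.
Proof.
move=> cf cg lp; have cc := circ_cochain lp cf cg.
rewrite Ysnf //.
elim/tt_ind: x => [|b x y Ex Ey|s].
- by rewrite !Y0 sn0.
- by rewrite !linearP /= Ex Ey sn_linear.
rewrite (YE _ _ cg) (YE _ _ cc) Ysn; case: (leqP (i + l + q)) => le; last first.
  have -> : (i + (p + q).-1 <= size s)%N = false by lia.
  by rewrite Y0 !sn0.
rewrite YE // size_insert //.
have -> : (i + p <= (size s).+1 - q)%N = (i + (p + q).-1 <= size s)%N by lia.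
case: ifP => le2; rewrite ?sn0 // insert_in //.
rewrite !snsn; congr sn; case: p lp {cf cc le2} => // p _.
by rewrite addSn /= /par /= !oddD; do 4![case: odd].
Qed.

(** Moving [f] from [i] to [i + q - 1] changes its positional sign exactly when both degrees are
    odd; this is the whole Koszul sign. *)
Lemma Yswap p q f g i j x : f \in @cochain k A p -> g \in @cochain k A q -> (j < i)%N ->
  Y p f i (Y q g j x) = sn (par p && par q) (Y q g j (Y p f (i + q).-1 x)).
Proof.
move=> cf cg; case: i => // i ji; rewrite addSn /=.
elim/tt_ind: x => [|b x y Ex Ey|s].
- by rewrite !Y0 sn0.
- by rewrite !linearP /= Ex Ey sn_linear.
rewrite !YE // !Ysn; case: (leqP (j + q)) => le; last first.
  by rewrite Y0 (_ : (i + q + p <= size s)%N = false) ?Y0 ?sn0 //; lia.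
rewrite YE // size_insert //.
have -> : (i.+1 + p <= (size s).+1 - q)%N = (i + q + p <= size s)%N by lia.
case: ifP => le2; rewrite ?Y0 ?sn0 //.
rewrite YE // size_insert //.
have -> : (j + q <= (size s).+1 - p)%N by lia.
rewrite (@insert_out _ _ p q) // addSn /=. 
rewrite !snsn; congr sn.
by rewrite /par !oddD /=; do 4![case: odd].
Qed.
End Calculus.

(** * Cochains bundled with their arity, acting by tails of insertions *)

Section Bundled.
Variables (k : comNzRingType) (A : regUnitalHomAss k).
Local Notation TT := (@ttensor k A).

Record coch := Coch { ar : nat; fn :> seq A -> A; cochP : fn \in @cochain k A ar }.

Implicit Types (F G H : coch) (x y : TT).

(* The parity of [|F|], resp. of [|F| |G|], where [|F| = ar F - 1]. *)
Definition pa F : bool := par (ar F).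
Definition pe F G : bool := pa F && pa G.

Definition op F i : TT -> TT := Y (ar F) F i.
HB.instance Definition _ F i := GRing.Linear.copy (op F i) (Y (ar F) F i).

Definition rho F a : TT -> TT := tail (op F) a.
HB.instance Definition _ F a := GRing.Linear.copy (rho F a) (tail (op F) a).

Lemma opD F i : {morph op F i : x y / x + y}. Proof. exact: raddfD. Qed.
Lemma opN F i : {morph op F i : x / - x}. Proof. exact: raddfN. Qed.
Lemma op0 F i : op F i 0 = 0. Proof. exact: raddf0. Qed.
Lemma opsn F i b x : op F i (sn b x) = sn b (op F i x).
Proof. by case: b; rewrite /sn ?opN. Qed.
Lemma rhoD F i : {morph rho F i : x y / x + y}. Proof. exact: raddfD. Qed.
Lemma rhoN F i : {morph rho F i : x / - x}. Proof. exact: raddfN. Qed.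
Lemma rho0 F i : rho F i 0 = 0. Proof. exact: raddf0. Qed.
Lemma rhosn F i b x : rho F i (sn b x) = sn b (rho F i x).
Proof. by case: b; rewrite /sn ?rhoN. Qed.

Lemma op_locfin F : locfin (op F).
Proof. by move=> s i lt; apply: Yzero; [exact: cochP | apply: ltn_addr]. Qed.

Lemma rhoS F a x : rho F a x = op F a x + rho F a.+1 x.
Proof. exact/tailS/op_locfin. Qed.

Lemma rho_large F x : exists M, forall a, (M <= a)%N -> rho F a x = 0.
Proof. exact: tail_large. Qed.

(** The new position [i + ar G - 1] is given by an equation on its successor, which avoids truncated
    subtraction at each use. *)
Lemma op_swap F G i j l x : (j < i)%N -> l.+1 = (i + ar G)%N ->
  op F i (op G j x) = sn (pe F G) (op G j (op F l x)).
Proof. by move=> ji E; rewrite /op (Yswap _ (cochP F) (cochP G) ji) -E. Qed.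

Lemma rho_op F G j k0 l x : (k0 < j)%N -> l.+1 = (j + ar G)%N ->
  rho F j (op G k0 x) = sn (pe F G) (op G k0 (rho F l x)).
Proof.
have [M HM] := rho_large F x; have [M' HM'] := rho_large F (op G k0 x).
pose P j := forall l, (k0 < j)%N -> l.+1 = (j + ar G)%N ->
  rho F j (op G k0 x) = sn (pe F G) (op G k0 (rho F l x)).
suff : forall j, P j by move=> /(_ j); apply.
apply: tail_down; first exists (maxn M M').+1 => i; rewrite ?gtn_max.
  by case/andP=> h h' i' _ E; rewrite HM ?HM' ?op0 ?sn0 //; lia.
move=> i IH i' lt E; rewrite rhoS [in RHS]rhoS opD.
rewrite (op_swap _ _ lt E) (IH i'.+1) ?addSn ?E //; last by rewrite ltnW.
by rewrite /sn; case: pe; zmodule.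
Qed.

Lemma op_linf F G H b i x : ar G = ar F -> ar H = ar F ->
  fn H = fn F + sn b (fn G) -> op H i x = op F i x + sn b (op G i x).
Proof.
move=> EG EH E; have cF := cochP F; have cG : fn G \in @cochain k A (ar F) by rewrite -EG cochP.
by rewrite /op E EH EG YDf ?Ysnf //; exact: sn_cochain.
Qed.

Lemma rho_linf F G H a b : ar G = ar F -> ar H = ar F ->
  fn H = fn F + sn b (fn G) -> forall x, rho H a x = rho F a x + sn b (rho G a x).
Proof.
move=> EG EH E x.
have EO i y := op_linf i y EG EH E.
have [M HM] := rho_large F x; have [M' HM'] := rho_large G x.
have [M2 HM2] := rho_large H x; move: a.
apply: tail_down => [|a IH]; last first.
  by rewrite rhoS IH EO [rho F a x]rhoS [rho G a x]rhoS /sn; case: b {E EO IH}; zmodule.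
exists (maxn M2 (maxn M M')) => i; rewrite !geq_max => /and3P[h2 h h'].
by rewrite HM ?HM' ?HM2 ?sn0 ?addr0.
Qed.

Definition circsum p q (f g : seq A -> A) : seq A -> A :=
  \sum_(l <- iota 0 p) circs q f l g.

Lemma circsum_cochain F G : circsum (ar F) (ar G) F G \in @cochain k A (ar F + ar G).-1.
Proof.
rewrite /circsum big_seq; apply: rpred_sum => l; rewrite mem_iota => /andP[_ lt].
by apply: circs_cochain => //; exact: cochP.
Qed.
Definition pc F G : coch := Coch (circsum_cochain F G).

(** Insertions into a finite window become a difference of tails, so that the rules for tails cover
    them. *)
Lemma rho_sum F a p x : \sum_(l <- iota a p) op F l x = rho F a x - rho F (a + p) x.
Proof.
elim: p a => [|p IH] a; first by rewrite big_nil addn0 subrr.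
by rewrite /= big_cons IH [rho F a x]rhoS addSnnS; zmodule.
Qed.

(** Inserting [F o G] at [i] means inserting [G] into the window of the [ar F] arguments of [F] and
    then [F]. By [rho_sum] the window is [rho G i - rho G (i + ar F)], and the subtracted tail
    commutes out of [op F i] by [rho_op]. *)
Lemma op_pc F G i x :
  op (pc F G) i x = op F i (rho G i x) - sn (pe F G) (rho G i.+1 (op F i x)).
Proof.
have -> : op (pc F G) i x = op F i (\sum_(l <- iota i (ar F)) op G l x).
  rewrite /op /= Ysumf.
    have -> : iota i (ar F) = map (addn i) (iota 0 (ar F)) by rewrite -iotaDl addn0.
    rewrite raddf_sum big_map big_seq [RHS]big_seq; apply: eq_bigr => l.
    by rewrite mem_iota => /andP[_ lt] /=; rewrite -Ycirc ?add0n //; exact: cochP.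
  move=> l; rewrite mem_iota => /andP[_ lt]; apply: circs_cochain => //; exact: cochP.
rewrite rho_sum opD opN (@rho_op G F i.+1 i (i + ar F)) //.
by rewrite /pe andbC; rewrite /sn; case: (_ && _); zmodule.
Qed.

Lemma brk_cochain F G : fn (pc F G) - sn (pe F G) (fn (pc G F)) \in @cochain k A (ar F + ar G).-1.
Proof.
apply: rpredB; first exact: cochP.
by apply: sn_cochain; rewrite addnC; exact: cochP.
Qed.
Definition br F G : coch := Coch (brk_cochain F G).

Lemma br_fn F G : fn (br F G) = fn (pc F G) + sn (~~ pe F G) (fn (pc G F)).
Proof. by rewrite /= /sn; case: pe; rewrite ?opprK. Qed.

Lemma op_br F G i x :
  op (br F G) i x = op (pc F G) i x - sn (pe F G) (op (pc G F) i x).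
Proof.
rewrite (op_linf _ _ _ _ (br_fn F G)) //=; last by rewrite addnC.
by rewrite /sn; case: pe; rewrite ?opprK.
Qed.

Lemma large4 (Z1 Z2 Z3 Z4 : nat -> TT) :
  (exists M, forall a, (M <= a)%N -> Z1 a = 0) ->
  (exists M, forall a, (M <= a)%N -> Z2 a = 0) ->
  (exists M, forall a, (M <= a)%N -> Z3 a = 0) ->
  (exists M, forall a, (M <= a)%N -> Z4 a = 0) ->
  exists M, forall a, (M <= a)%N -> [/\ Z1 a = 0, Z2 a = 0, Z3 a = 0 & Z4 a = 0].
Proof.
move=> [M1 H1] [M2 H2] [M3 H3] [M4 H4]; exists (maxn (maxn M1 M2) (maxn M3 M4)) => a.
by rewrite !geq_max => /andP[/andP[h1 h2] /andP[h3 h4]]; rewrite H1 ?H2 ?H3 ?H4.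
Qed.

End Bundled.

Definition addE := (opD, opN, op0, rhoD, rhoN, rho0).

Definition muc (k : comNzRingType) (A : regUnitalHomAss k) : coch A :=
  Coch (mu_cochain A).
Lemma pa_mu (k : comNzRingType) (A : regUnitalHomAss k) : pa (muc A) = true.
Proof. by []. Qed.

Ltac koszul :=
  rewrite /pe ?pa_mu /sn; repeat match goal with |- context [pa ?F] => case: (pa F) end;
  rewrite /= ?addE; zmodule.

(** * Brackets, differentials and products of cochains *)

Section CochainCalculus.
Variables (k : comNzRingType) (A : regUnitalHomAss k).
Local Notation TT := (@ttensor k A).
Local Notation coch := (@coch k A).
Local Notation muc := (muc A).
Implicit Types (F G H : coch) (x y : TT).

(** In the step from [a.+1] to [a], the terms that meet position [a] are exactly the four terms of
    [op_pc] for [F o G] and [G o F]. *)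
Lemma rho_comm F G a x :
  rho F a (rho G a x) - sn (pe F G) (rho G a (rho F a x)) = rho (br F G) a x.
Proof.
have [] := large4 (rho_large F x) (rho_large G x) (rho_large (br F G) x) (rho_large F 0).
move=> M HM; move: a; apply: tail_down => [|a].
  by exists M => a /HM[-> -> -> _]; rewrite !addE sn0 subr0.
move=> IH; rewrite (rhoS (br F G)) -IH op_br !op_pc.
rewrite (rhoS F a (rho G a x)) (rhoS G a (rho F a x)) (rhoS F a x) (rhoS G a x).
by rewrite /pe [pa G && _]andbC /sn; case: (_ && _); rewrite !addE; zmodule.
Qed.

Lemma op_inj_tt F G : ar F = ar G ->
  (forall s, size s = ar F -> op F 0 (tt s) = op G 0 (tt s)) -> fn F = fn G.
Proof.
move=> EA E; apply/funext => s; have /asboolP[F0 _ _] := cochP F; have /asboolP[G0 _ _] := cochP G.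
have [es|/eqP ns] := eqVneq (size s) (ar F); last by rewrite F0 // G0 // -EA.
(* Insertion at 0 into a word of length [ar F] leaves the one-letter word of the value of [F], and
   this functional reads off its letter. *)
have ev a : ttlift (fun s : seq A => if s is [:: a] then a else 0) (tt [:: a]) = a.
  rewrite ttliftE // => -[|b [|c s1]] s2 r y z /=; try by rewrite ?scaler0 ?addr0.
  by case: s2 => [|c s2] //; rewrite scaler0 addr0.
have ins f : insert (size s) f 0 s = [:: f s].
  by rewrite /insert take0 drop0 take_size add0n drop_size.
have := E s es; rewrite /op !YE ?cochP // -EA -es !add0n leqnn andbF /= !ins => /(congr1 (ttlift (fun s : seq A => if s is [:: a] then a else 0))).
by rewrite !ev.
Qed.

Lemma op_inj F G : ar F = ar G -> (forall x, op F 0 x = op G 0 x) -> fn F = fn G.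
Proof. by move=> EA E; apply: op_inj_tt. Qed.

Lemma rho_out F a s : (size s < a + ar F)%N -> rho F a (tt s) = 0.
Proof.
move: a; apply: (tail_down (P := fun b => (size s < b + ar F)%N -> rho F b (tt s) = 0)).
  by have [M HM] := rho_large F (tt s); exists M => b /HM.
by move=> b IH h; rewrite rhoS IH /op ?Yzero ?addr0 ?cochP //; apply: leq_trans h _; rewrite leq_add2r.
Qed.

Definition dl F : coch := br muc F.
Definition dclosed F := fn (dl F) = 0.

Lemma op_dclosed F i x : dclosed F -> op (dl F) i x = 0.
Proof. by rewrite /op => ->; rewrite Y0f. Qed.

Lemma op_fn0 F i x : fn F = 0 -> op F i x = 0.
Proof. by rewrite /op => ->; rewrite Y0f. Qed.

Lemma rho_fn0 F i x : fn F = 0 -> rho F i x = 0.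
Proof.
move=> F0; move: i; apply: tail_down; first exact: rho_large.
by move=> i IH; rewrite rhoS IH addr0 op_fn0.
Qed.

(** Insertions of [F] at [i + 2] and beyond commute with [op muc i] and cancel. What remains is the
    product of the value of [F] with its left neighbour, the term [op F i.+1], and the commutator
    with [rho muc i]. *)
Lemma op_dl F i x : op (dl F) i x =
  rho muc i (op F i x) + op muc i (op F i.+1 x) - sn (pa F) (op F i (rho muc i x)).
Proof.
rewrite op_br !op_pc (rhoS F i x) (rhoS F i.+1 x) (rhoS muc i (op F i x)).
rewrite (@rho_op _ _ F muc i.+1 i i.+2 x) //; last by rewrite addn2.
by koszul.
Qed.

(** Hom-associativity: the twist on the third factor is the one that inserting [mu] applies to the
    other entries. The sign comes from moving [mu], of odd degree, by one position. *)
Lemma mu_assoc i x : op muc i (op muc i.+1 x) = - op muc i (op muc i x).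
Proof.
have C := @mu_cochain k A.
have E : circ 2 (@mu k A) 1 (@mu k A) = circ 2 (@mu k A) 2 (@mu k A).
  apply/funext => -[|a [|b [|c [|d s]]]]; rewrite /circ /insert /= ?linear0 ?linear0l ?take0 ?hmulA //.
have := @Ycirc k A 2 2 _ _ 0 i x C C isT; have := @Ycirc k A 2 2 _ _ 1 i x C C isT.
rewrite addn0 addn1 /op /= /circs E !Ysnf; last 2 first.
- exact: (circ_cochain (p := 2) (q := 2)).
- exact: (circ_cochain (p := 2) (q := 2)).
by move=> -> ->.
Qed.

Lemma rho_mu2 a x : rho muc a (rho muc a x) = 0.
Proof.
move: a; apply: tail_down => [|a IH].
  by have [M HM] := rho_large muc x; exists M => a /HM ->; rewrite rho0.
rewrite (rhoS _ _ (rho _ a x)) (rhoS _ _ x) !addE IH (rhoS _ a.+1 x) !addE.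
rewrite (@rho_op _ _ muc muc a.+1 a a.+2 x) //; last by rewrite addn2.
by rewrite mu_assoc /sn /=; zmodule.
Qed.

Lemma rho_dl F a x : rho (dl F) a x = rho muc a (rho F a x) - sn (pa F) (rho F a (rho muc a x)).
Proof. by rewrite -rho_comm. Qed.

Lemma pa_dl F : pa (dl F) = ~~ pa F.
Proof. by rewrite /pa /par -[ar (dl F)]/((ar F).+1). Qed.

(** On a word of length [ar F] only the insertion at position 0 contributes to [rho F 0]. *)
Lemma rho_inj F G : ar F = ar G -> (forall x, rho F 0 x = rho G 0 x) -> fn F = fn G.
Proof.
move=> EA E; apply: op_inj_tt => // s es.
by have := E (tt s); rewrite !(rhoS _ 0) !(@rho_out _ 1) ?es -?EA ?addr0.
Qed.

Lemma dl_dl F : dclosed (dl F).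
Proof.
rewrite /dclosed; have -> : fn (dl (dl F)) = fn (Coch (rpred0 (@cochain k A (ar (dl (dl F)))))); last by [].
apply: rho_inj => // x; rewrite [RHS]rho_fn0 // !rho_dl pa_dl !addE ?rhosn !rho_mu2.
by koszul.
Qed.

(* [(-1)^|F| i_F], where [i_F] is the cap product. *)
Definition cap F x : TT := op muc 0 (op F 1 x).
Lemma capD F : {morph cap F : x y / x + y}. Proof. by move=> x y; rewrite /cap !addE. Qed.
Lemma capN F : {morph cap F : x / - x}. Proof. by move=> x; rewrite /cap !addE. Qed.
Lemma cap0 F : cap F 0 = 0. Proof. by rewrite /cap !addE. Qed.
Lemma capsn F b x : cap F (sn b x) = sn b (cap F x).
Proof. by case: b; rewrite /sn ?capN. Qed.

Lemma mu_op0 F x : rho muc 0 (op F 0 x) = op (dl F) 0 x - cap F x + sn (pa F) (op F 0 (rho muc 0 x)).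
Proof. by rewrite op_dl /cap; zmodule. Qed.

(** [mu_op0] writes [cap F] as [op (dl F) 0] minus the graded commutator of [rho muc 0] with
    [op F 0]. Commuting once more with [rho muc 0], of square zero, kills that commutator; the rest
    is [mu_op0] for [dl F], where [dl (dl F)] vanishes. *)
Lemma mu_cap F x : rho muc 0 (cap F x) = - cap (dl F) x - sn (pa F) (cap F (rho muc 0 x)).
Proof.
have E y : cap F y = op (dl F) 0 y + sn (pa F) (op F 0 (rho muc 0 y)) - rho muc 0 (op F 0 y).
  by rewrite mu_op0; zmodule.
rewrite [in LHS]E [in RHS]E !addE rho_mu2 mu_op0 rhosn mu_op0 pa_dl rho_mu2 (op_dclosed _ _ (@dl_dl F)).
by koszul.
Qed.

Lemma mu_rho1 F x : rho muc 0 (rho F 1 x) =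
  sn (pa F) (rho F 1 (rho muc 0 x)) + rho (dl F) 1 x + cap F x.
Proof.
have := rho_dl F 1 x; rewrite (rhoS muc 0) (rhoS muc 0 x) => ->.
rewrite (rhoS F 1 x) !addE (@rho_op _ _ F muc 1 0 2) // -/(cap F x) /pe /=.
by koszul.
Qed.

(* [cap F] inserts [F] after the entry in position 0; when it acts further to
   the right, it commutes with [cap F]. *)
Lemma cap_rho F G j x : cap F (rho G (j + (ar F).+1) x) = sn (pe F G (+) pa G) (rho G j.+1 (cap F x)).
Proof.
rewrite /cap (@rho_op _ _ G muc j.+1 0 j.+2) ?addn2 // (@rho_op _ _ G F j.+2 1 (j + (ar F).+1)) //; last first.
  by rewrite addnS addSn.
by koszul.
Qed.

(** The arity of [pc F G] is a truncated predecessor, with the wrong parity when both arities are 0;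
    but for [ar F = 0] the cochain is an empty sum. *)
Lemma sn_pc F G i x : sn (pa (pc F G)) (op (pc F G) i x) = sn (pa F (+) pa G) (op (pc F G) i x).
Proof.
rewrite /pa /par /=; case E: (ar F) => [|p]; last by rewrite addSn /= oddD /=; do 2!case: odd.
by rewrite !op_fn0 ?sn0 //= /circsum E /= big_nil.
Qed.

Lemma cap_pc F G x :
  cap (pc F G) x = cap F (rho G 1 x) - sn (pe F G (+) pa G) (rho G 1 (cap F x)).
Proof.
rewrite /cap op_pc !addE (@rho_op _ _ G muc 1 0 2) // /pe /=.
by koszul.
Qed.

Lemma cup_cochain F G : cup (ar F) (ar G) F G \in @cochain k A (ar F + ar G).
Proof.
apply: (@circ_cochain _ _ (ar F).+1 _ 0) (cochP G) => //.
by apply: (@circ_cochain _ _ 2 _ 1) (cochP F) => //; exact: mu_cochain.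
Qed.
Definition cupc F G : coch := Coch (cup_cochain F G).

(** In [(mu o_2 f) o_1 g] the value of [g] is the left factor, so [F] sits one place further right,
    which accounts for the sign. *)
Lemma op_cup F G i x : op (cupc F G) i x = sn (pa F) (op muc i (op F i.+1 (op G i x))).
Proof.
have CF := cochP F; have CG := cochP G; have C := @mu_cochain k A.
have Ch : circ (ar F) (@mu k A) 2 F \in @cochain k A (ar F).+1 by apply: (@circ_cochain _ _ 2 _ 1).
have := @Ycirc k A _ _ _ _ 0 i x Ch CG isT; rewrite /circs andbF addn0 /= => E.
rewrite /op /= -[Y _ (cup _ _ _ _) _ _]E.
have := @Ycirc k A _ _ _ _ 1 i (Y (ar G) G i x) C CF isT; rewrite addn1 => ->.
rewrite Ysnf ?andbT; last exact: (@circ_cochain _ _ 2 _ 1).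
by rewrite -/(pa F); case: (pa F); rewrite /sn ?opprK.
Qed.

Lemma pa_cup F G : pa (cupc F G) = ~~ (pa F (+) pa G).
Proof. by rewrite /pa /par /= oddD; do 2!case: odd. Qed.

(** A consequence of [mu_assoc]. Since [cap F] is [i_F] up to the sign of [|F|], the minus sign
    makes [i] strictly multiplicative. *)
Lemma cap_cup F G x : cap (cupc F G) x = - cap F (cap G x).
Proof.
rewrite /cap op_cup !opsn mu_assoc (@op_swap _ _ F muc 1 0 2) // /pe /= andbT.
by koszul.
Qed.

Lemma cap_op0 F G x : cap F (op G 0 x) = sn (pa F) (op (cupc F G) 0 x).
Proof. by rewrite op_cup; case: (pa F); rewrite /sn ?opprK. Qed.

End CochainCalculus.

(** * The unit and the faithfulness of the cap product *)

Section Unit.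
Variables (k : comNzRingType) (A : regUnitalHomAss k).
Local Notation coch := (@coch k A).
Local Notation muc := (muc A).
Implicit Types (F G H : coch) (x y : @ttensor k A).

Lemma one_cochain : const_cochain (Defs.one A) \in @cochain k A 0.
Proof.
apply/asboolP; split=> [[|a s] //|s1 s2 a x y //|[|a s] /=].
- exact: twist1.
- by rewrite linear0.
Qed.
Definition onec : coch := Coch one_cochain.
Lemma pa_one : pa onec = true. Proof. by []. Qed.

(** Inserting 1 applies [alpha^-1] to all entries. The insertion of [mu] undoes this on the entries
    outside the product, and [1 . alpha^-1(a) = a] on the remaining one. *)
Lemma mu_one_l i s : (i < size s)%N -> op muc i (op onec i (tt s)) = tt s.
Proof.
move=> lt; have [|s1 [[|a [|b s2]] [s3 [-> s1i //]]]] := @split3 k A i 1 s; first lia.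
move=> _; rewrite /op (YE _ _ (cochP onec)) /= addn0 Ysn.
have -> : (i <= size (s1 ++ a :: s3))%N by rewrite size_cat s1i leq_addr.
rewrite (@insert_cat k A 0 _ i s1 [::] (a :: s3)) // (YE _ _ (cochP muc)) /= size_cat /= !size_map s1i.
have -> : (i + 2 <= i + (size s3).+2)%N by rewrite leq_add2l.
rewrite (@insert_cat k A 2 _ i _ [:: Defs.one A; twistV a]) ?size_map // /= hmul1l twistVK.
rewrite !mapK //; do 2?exact: twistVK.
by rewrite /par /=; case: odd; rewrite /sn /= ?opprK.
Qed.

Lemma mu_one_r i s : (i < size s)%N -> op muc i (op onec i.+1 (tt s)) = - tt s.
Proof.
move=> lt; have [|s1 [[|a [|b s2]] [s3 [-> s1i //]]]] := @split3 k A i 1 s; first lia.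
move=> _; rewrite /op (YE _ _ (cochP onec)) /= addn0 Ysn.
have -> : (i < size (s1 ++ a :: s3))%N by rewrite size_cat s1i /= addnS ltnS leq_addr.
rewrite -cat_rcons (@insert_cat k A 0 _ i.+1 (rcons s1 a) [::] s3) ?size_rcons ?s1i //.
rewrite map_rcons cat_rcons (YE _ _ (cochP muc)) /= size_cat /= !size_map s1i.
have -> : (i + 2 <= i + (size s3).+2)%N by rewrite leq_add2l.
rewrite (@insert_cat k A 2 _ i _ [:: twistV a; Defs.one A]) ?size_map // /= hmul1 twistVK.
rewrite !mapK ?cat_rcons //; do 2?exact: twistVK.
by rewrite /par /=; case: odd; rewrite /sn /= ?opprK.
Qed.

(** With 1 as leading entry the product in [cap F] has no effect, so [cap] determines the cochain.
    Identities between cup products can therefore be checked on caps. *)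
Lemma op_cap1 F x : op F 0 x = sn (pa F) (cap F (op onec 0 x)).
Proof.
rewrite /cap (@op_swap _ _ F onec 1 0 0) //.
have -> : op muc 0 (sn (pe F onec) (op onec 0 (op F 0 x))) = sn (pa F) (op F 0 x).
  rewrite opsn /pe pa_one andbT; congr sn.
  elim/tt_ind: x => [|a x y Ex Ey|s]; first by rewrite !op0.
    by rewrite !linearP /= Ex Ey.
  rewrite [op F 0 _](YE _ _ (cochP F)) !opsn; congr sn.
  by case: ifP => le; rewrite ?op0 // mu_one_l // size_insert //; lia.
by case: (pa F); rewrite /sn ?opprK.
Qed.

Lemma cap_inj F G : ar F = ar G -> (forall x, cap F x = cap G x) -> fn F = fn G.
Proof.
by move=> E H; apply: op_inj => // x; rewrite (op_cap1 F) (op_cap1 G) H /pa E.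
Qed.

Lemma cup_assoc F G H : fn (cupc (cupc F G) H) = fn (cupc F (cupc G H)).
Proof.
apply: cap_inj => [|x]; first by rewrite /= addnA.
by rewrite !cap_cup /cap !addE; zmodule.
Qed.

(** By [mu_cap], [cap (dl F)] is minus the graded commutator of [rho muc 0] with [cap F], and a
    commutator acts as a derivation on the composite in [cap_cup]. *)
Lemma cap_dl_cup F G x : cap (dl (cupc F G)) x =
  cap (cupc (dl F) G) x - sn (pa F) (cap (cupc F (dl G)) x).
Proof.
have E H y : cap (dl H) y = - rho muc 0 (cap H y) - sn (pa H) (cap H (rho muc 0 y)).
  by rewrite mu_cap; zmodule.
rewrite E !cap_cup E E pa_cup rhoN mu_cap E.
by rewrite /sn; case: (pa F); case: (pa G); rewrite /= ?(addE, capD, capN); zmodule.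
Qed.

End Unit.

(** * Homotopy for commutativity, and consecutive insertions of two cocycles *)

Section Homotopies.
Variables (k : comNzRingType) (A : regUnitalHomAss k).
Local Notation coch := (@coch k A).
Local Notation TT := (@ttensor k A).
Local Notation muc := (muc A).
Implicit Types (F G H : coch) (x y : TT).

Lemma mu_rhoc F a x : dclosed F -> rho muc a (rho F a x) = sn (pa F) (rho F a (rho muc a x)).
Proof. by move=> cF; have := rho_dl F a x; rewrite rho_fn0 // => /esym/eqP; rewrite subr_eq0 => /eqP. Qed.

Lemma mu_op0c F x : dclosed F ->
  rho muc 0 (op F 0 x) = sn (pa F) (op F 0 (rho muc 0 x)) - cap F x.
Proof. by move=> cF; rewrite mu_op0 op_dclosed //; koszul. Qed.

Lemma mu_rho1c F x : dclosed F ->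
  rho muc 0 (rho F 1 x) = sn (pa F) (rho F 1 (rho muc 0 x)) + cap F x.
Proof. by move=> cF; rewrite mu_rho1 [rho (dl F) 1 x]rho_fn0 // addr0. Qed.

(** For cocycles, [op F 0] and [rho G 1] fail to commute with [rho muc 0] only by [cap F] and
    [cap G]. In [op_dl] for [F o G] these two defects are, up to sign, the two cup products
    ([cap_op0]). *)
Lemma op_dl_pc F G x : dclosed F -> dclosed G ->
  op (dl (pc F G)) 0 x = - cap F (op G 0 x) - sn (pe F G) (cap G (op F 0 x)).
Proof.
move=> cF cG; rewrite op_dl -/(cap _ _) cap_pc sn_pc !op_pc !addE !rhosn.
rewrite (mu_op0c _ cF) (mu_rhoc _ _ cG) (mu_rho1c _ cG) (mu_op0c _ cF) (rhoS G 0 x).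
rewrite (capD F); koszul.
Qed.

(* [F{H, G}] is the part of [F o H o G] in which [G] acts to the right of [H]. *)
Definition wop H G i : TT -> TT := op H i \o rho G (i + ar H).
HB.instance Definition _ H G i := GRing.Linear.copy (wop H G i) (op H i \o rho G (i + ar H)).
Definition W H G a : TT -> TT := tail (wop H G) a.
HB.instance Definition _ H G a := GRing.Linear.copy (W H G a) (tail (wop H G) a).

Lemma WD H G i : {morph W H G i : x y / x + y}. Proof. exact: raddfD. Qed.
Lemma WN H G i : {morph W H G i : x / - x}. Proof. exact: raddfN. Qed.
Lemma W0 H G i : W H G i 0 = 0. Proof. exact: raddf0. Qed.

Lemma WS H G a x : W H G a x = op H a (rho G (a + ar H) x) + W H G a.+1 x.
Proof.
apply: tailS => s i lt; rewrite -[LHS]/(op H i (rho G (i + ar H) (tt s))) rho_out ?op0 //.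
by rewrite -addnA; apply: ltn_addr.
Qed.
Lemma W_large H G x : exists M, forall a, (M <= a)%N -> W H G a x = 0.
Proof. exact: tail_large. Qed.

Lemma W_op H G K a j l x : (j < a)%N -> l.+1 = (a + ar K)%N ->
  W H G a (op K j x) = sn (pe H K (+) pe G K) (op K j (W H G l x)).
Proof.
have [] := large4 (W_large H G x) (W_large H G (op K j x)) (W_large H G 0) (W_large H G 0).
move=> M HM; move: a l.
apply: (tail_down (P := fun a => forall l, (j < a)%N -> l.+1 = (a + ar K)%N ->
  W H G a (op K j x) = sn (pe H K (+) pe G K) (op K j (W H G l x)))).
  exists M.+1 => a le l lt E; have [|_ -> _ _] := HM a _; first exact: ltnW.
  by have [|-> _ _ _] := HM l; [lia | rewrite op0 sn0].
move=> a IH l lt E; rewrite WS (WS _ _ l) opD (IH l.+1) ?addSn ?E //; last by rewrite ltnW.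
rewrite (@rho_op _ _ G K (a + ar H) j (l + ar H)); last 2 first.
- exact: ltn_addr.
- by rewrite -addSn E addnAC.
rewrite opsn (op_swap _ _ lt E).
by rewrite /sn; case: (pe H K); case: (pe G K); rewrite /= ?addE; zmodule.
Qed.

Lemma rho_seg F G b a p l x : (a + p <= b)%N -> l.+1 = (b + ar G)%N ->
  rho F b (rho G a x - rho G (a + p) x) =
  sn (pe F G) (rho G a (rho F l x) - rho G (a + p) (rho F l x)).
Proof.
move=> le E; rewrite -!rho_sum raddf_sum /=.
have -> (r : seq nat) (K : nat -> TT) b0 : sn b0 (\sum_(j <- r) K j) = \sum_(j <- r) sn b0 (K j).
  by case: b0; rewrite /sn ?sumrN.
rewrite big_seq [RHS]big_seq; apply: eq_bigr => j; rewrite mem_iota => /andP[_ lt].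
by rewrite (rho_op _ _ _ E) //; apply: leq_trans lt le.
Qed.

(** The Hochschild cocycle equation: products taken inside the block fed to [H] equal, up to sign,
    the products of the value of [H] with its right and left neighbours. *)
Lemma op_seg H a y : dclosed H ->
  op H a (rho muc a y - rho muc (a + ar H) y) =
  sn (pa H) (op muc a (op H a y) + op muc a (op H a.+1 y)).
Proof.
move=> cH; have := op_dl H a y; rewrite op_dclosed // (rhoS muc a (op H a y)).
rewrite (@rho_op _ _ muc H a.+1 a (a + ar H)) ?addSn // /pe pa_mu opD opN.
set u := op H a (rho _ a _); set v := op H a (rho _ _ _).
set w := op muc a (op H a y); set t := op muc a _.
move=> E; have -> : u = v + sn (pa H) (w + t); last by zmodule.
apply/eqP; rewrite -subr_eq0; apply/eqP; move: E; case: (pa H); rewrite /sn /=.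
  by move=> /esym <-; zmodule.
by move=> /esym /(congr1 -%R); rewrite oppr0 => <-; zmodule.
Qed.

(** By [op_seg], products inside the block of [H] become products with its neighbours. These cancel
    against the outer products, except when the right neighbour is the value of [G]; the adjacent
    pairs form [cupc G H]. *)
Lemma mu_W H G a x : dclosed H -> dclosed G ->
  rho muc a (W H G a x) = sn (pa H (+) pa G) (W H G a (rho muc a x))
    + sn (pe G H (+) pa G) (rho (cupc G H) a x).
Proof.
move=> cH cG; have [] := large4 (W_large H G x) (rho_large (cupc G H) x) (rho_large muc x) (W_large H G 0).
move=> M HM; move: a; apply: tail_down => [|a IH].
  by exists M => a /HM[-> -> -> _]; rewrite rho0 W0 !sn0 addr0.
pose r := ar H; pose y := rho G (a + r).+1 x.
have E1 : rho muc a.+1 (op H a (rho G (a + r) x)) =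
    sn (pa H (+) pa G) (op H a (rho G (a + r) (rho muc (a + r) x))).
  rewrite (@rho_op _ _ muc H a.+1 a (a + r)) ?addSn // mu_rhoc // opsn /pe pa_mu.
  by case: (pa H); case: (pa G); rewrite /sn /= ?opprK.
have E2 : op muc a (W H G a.+2 x) = sn (pa H (+) pa G) (W H G a.+1 (op muc a x)).
  rewrite (@W_op _ _ muc a.+1 a a.+2) ?addn2 // /pe pa_mu !andbT.
  by case: (pa H); case: (pa G); rewrite /sn /= ?opprK.
have E3 : op H a (rho G (a + r) (rho muc a x)) =
    op H a (rho G (a + r) (rho muc (a + r) x))
    + sn (pa H (+) pa G) (op muc a (op H a y) + op muc a (op H a.+1 y)).
  have := @rho_seg G muc (a + r) a r (a + r).+1 x; rewrite addn2 => /(_ (leqnn _) erefl) /(congr1 (op H a)).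
  rewrite opsn op_seg // rhoD rhoN opD opN /pe pa_mu andbT => /eqP; rewrite subr_eq => /eqP ->.
  by rewrite -/y; case: (pa H); case: (pa G); rewrite /sn /= ?opprK; zmodule.
have E4 : op G a.+1 (op H a x) = sn (pe G H) (op H a (op G (a + r) x)).
  by rewrite (@op_swap _ _ G H a.+1 a (a + r)).
rewrite (rhoS (cupc G H)) op_cup E4 [W H G a (rho muc a x)]WS E3 [W H G a x]WS.
rewrite (rhoS muc a (_ + _)) !opD !rhoD E1 (WS H G a.+1 x) !opD E2 -(WS H G a.+1 x) IH.
rewrite addSn -/r (rhoS G (a + r) x) -/y (rhoS muc a x) WD.
by koszul.
Qed.
End Homotopies.

(** * The brace [F{H, G}] and the Leibniz rule *)

Section Leibniz.
Variables (k : comNzRingType) (A : regUnitalHomAss k).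
Local Notation coch := (@coch k A).
Local Notation TT := (@ttensor k A).
Local Notation muc := (muc A).
Implicit Types (F G H : coch) (x y : TT).

(** After [H] has filled argument [i] of [F], its block ends at [i + ar H], and [ar F - i.+1]
    arguments of [F] remain to its right; this is the range of [j]. *)
Definition brace F H G : seq A -> A :=
  \sum_(i <- iota 0 (ar F)) \sum_(j <- iota (i + ar H) (ar F - i.+1))
     circs (ar G) (circs (ar H) F i H) j G.

Lemma brace_term F H G i j : i \in iota 0 (ar F) ->
  j \in iota (i + ar H) (ar F - i.+1) ->
  circs (ar G) (circs (ar H) F i H) j G \in @cochain k A ((ar F + ar H).-1 + ar G).-1.
Proof.
rewrite !mem_iota => /andP[_ li] /andP[_ lj].
by apply: circs_cochain; rewrite ?circs_cochain ?cochP //; lia.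
Qed.

Lemma brace_cochain F H G :
  brace F H G \in @cochain k A ((ar F + ar H).-1 + ar G).-1.
Proof.
rewrite /brace big_seq; apply: rpred_sum => i mi; rewrite big_seq; apply: rpred_sum => j mj.
exact: brace_term.
Qed.
Definition bracec F H G : coch := Coch (brace_cochain F H G).

Lemma W_sum H G a p x : \sum_(l <- iota a p) op H l (rho G (l + ar H) x)
  = W H G a x - W H G (a + p) x.
Proof.
elim: p a => [|p IH] a; first by rewrite big_nil addn0 subrr.
by rewrite /= big_cons IH [W H G a x]WS addSnnS; zmodule.
Qed.

Lemma op_pc_seg F H i y :
  op F i (rho H i y - rho H (i + ar F) y) = op (pc F H) i y.
Proof.
rewrite op_pc !addE (@rho_op _ _ H F i.+1 i (i + ar F)) // /pe [pa H && _]andbC.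
by rewrite /sn; case: (_ && _); rewrite ?opprK.
Qed.

Lemma op_brace F H G i x : op (bracec F H G) i x =
  op F i (W H G i x) - sn (pe G (pc F H)) (rho G i.+1 (op (pc F H) i x))
  - sn (pe H F (+) pe G F) (W H G i.+1 (op F i x)).
Proof.
(* [m] is the end of the block of arguments of [F o H] placed at [i]; insertions of [G] from [m] on
   lie outside it and are subtracted. *)
pose m := (i + (ar F + ar H).-1)%N.
have EG l : l \in iota 0 (ar F) ->
    \sum_(j <- iota (l + ar H) (ar F - l.+1)) op G (i + j) x
    = rho G (i + l + ar H) x - rho G m x.
  rewrite mem_iota add0n => /andP[_ lt].
  have -> : m = (i + l + ar H + (ar F - l.+1))%N by rewrite /m; lia.
  by rewrite -rho_sum -addnA [in RHS]iotaDl big_map.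
have -> : op (bracec F H G) i x =
    op F i (\sum_(l <- iota 0 (ar F)) op H (i + l) (rho G (i + l + ar H) x - rho G m x)).
  rewrite /op /= Ysumf; last first.
    by move=> l ml; rewrite big_seq; apply: rpred_sum => j mj; exact: brace_term.
  rewrite raddf_sum big_seq [RHS]big_seq; apply: eq_bigr => l ml.
  rewrite Ysumf; last by move=> j mj; exact: brace_term.
  rewrite -EG // !raddf_sum big_seq [RHS]big_seq; apply: eq_bigr => j mj.
  move: (ml) (mj); rewrite !mem_iota => /andP[_ li] /andP[_ lj].
  rewrite -Ycirc ?circs_cochain ?cochP //; last lia.
  by rewrite -Ycirc ?cochP.
have -> : \sum_(l <- iota 0 (ar F)) op H (i + l) (rho G (i + l + ar H) x - rho G m x)
  = \sum_(l <- iota i (ar F)) (op H l (rho G (l + ar H) x) - op H l (rho G m x)).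
  rewrite -[in RHS](addn0 i) iotaDl big_map; apply: eq_bigr => l _.
  by rewrite opD opN.
rewrite big_split sumrN W_sum rho_sum opD opN op_pc_seg.
rewrite (@rho_op _ _ G (pc F H) i.+1 i m) //.
rewrite (@W_op _ _ H G F i.+1 i (i + ar F)) //.
by rewrite opD opN /sn; case: (pe H F); case: (pe G F); case: (pe _ _); rewrite /= ?addE; zmodule.
Qed.

Lemma mu_W1 H G x : dclosed H -> dclosed G ->
  rho muc 0 (W H G 1 x) = sn (pa H (+) pa G) (W H G 1 (rho muc 0 x))
    + sn (pe G H (+) pa G) (rho (cupc G H) 1 x) + cap H (rho G (ar H).+1 x).
Proof.
move=> cH cG; rewrite rhoS mu_W // (WS _ _ 1) opD -[op muc 0 (op H 1 _)]/(cap _ _) add1n.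
have -> : op muc 0 (W H G 2 x) = sn (pa H (+) pa G) (W H G 1 (op muc 0 x)).
  rewrite (@W_op _ _ _ _ muc 1 0 2) // /pe pa_mu !andbT.
  by case: (pa H); case: (pa G); rewrite /sn /= ?opprK.
rewrite (rhoS muc 0 x) WD.
by koszul.
Qed.

Lemma sn_pc_and b F G i x : sn (b && pa (pc F G)) (op (pc F G) i x)
  = sn (b && (pa F (+) pa G)) (op (pc F G) i x).
Proof. by case: b => //=; exact: sn_pc. Qed.

(** The twice truncated arity can have the wrong parity only if [ar F = 0], or if [ar F = 1] and
    [H], [G] are constants; then the brace is an empty sum. *)
Lemma sn_brace F H G i x : sn (pa (bracec F H G)) (op (bracec F H G) i x)
  = sn (pa F (+) pa G (+) pa H) (op (bracec F H G) i x).
Proof.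
rewrite /pa /par /=; case EF: (ar F) => [|p].
  by rewrite !op_fn0 ?sn0 //= /brace EF big_nil.
case EG: (ar H + ar G + p)%N => [|m].
  have [H0 p0] : ar H = 0%N /\ p = 0%N by split; lia.
  by rewrite !op_fn0 ?sn0 //= /brace EF p0 H0 /= !big_seq1 big_nil.
by rewrite (_ : (p.+1 + ar H).-1 + ar G = m.+1)%N /=; [congr sn|]; lia.
Qed.

Lemma op_brace_sn F H G i x : op (bracec F H G) i x =
  op F i (W H G i x)
  - sn (pa G && (pa F (+) pa H)) (rho G i.+1 (op (pc F H) i x))
  - sn (pe H F (+) pe G F) (W H G i.+1 (op F i x)).
Proof. by rewrite op_brace -rhosn sn_pc_and rhosn. Qed.

Lemma cap_brace F H G x : cap (bracec F H G) x =
  cap F (W H G 1 x) - sn (pa G && (pa F (+) pa H) (+) pa G) (rho G 1 (cap (pc F H) x))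
  - sn (pe H F (+) pe G F (+) pa H (+) pa G) (W H G 1 (cap F x)).
Proof.
rewrite /cap op_brace_sn.
rewrite !opD !opN !opsn (@rho_op _ _ G muc 1 0 2) // (@W_op _ _ H G muc 1 0 2) //.
by koszul.
Qed.

(** Three defects survive: adjacent [H] and [G] inside [F] give [F o (G cup H)] by [mu_W], the outer
    [rho G 1] gives the product of [G] with [F o H], and the rest assembles to the product of
    [F o G] with [H]. *)
Lemma op_dl_brace F H G x : dclosed F -> dclosed G -> dclosed H ->
  op (dl (bracec F H G)) 0 x =
  sn (pe G H (+) pa F (+) pa G) (op (pc F (cupc G H)) 0 x)
  - sn (pe G H) (cap (pc F G) (op H 0 x))
  - sn (pe G F (+) pe G H) (cap G (op (pc F H) 0 x)).
Proof.
move=> cF cG cH; rewrite op_dl -/(cap _ _) sn_brace cap_brace !op_brace_sn.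
rewrite !rhoD !rhoN !rhosn (mu_op0c _ cF) (mu_rho1c _ cG) mu_op0 op_dl_pc // sn_pc.
rewrite (mu_W1 _ cH cG) (mu_op0c _ cF) mu_W //.
have E1 y : cap H (rho G (ar H).+1 y) = sn (pe H G (+) pa G) (rho G 1 (cap H y)).
  exact: (cap_rho H G 0).
have E2 : cap F (op H 0 (rho G (ar H) x)) =
   sn (pe G H) (cap (pc F G) (op H 0 x)
                + sn (pe F G (+) pa G) (rho G 1 (cap F (op H 0 x)))).
  have -> : op H 0 (rho G (ar H) x) = sn (pe G H) (rho G 1 (op H 0 x)).
    by rewrite (@rho_op _ _ G H 1 0 (ar H)) // snsn addbb.
  by rewrite cap_pc capsn; congr sn; zmodule.
rewrite E1 (WS H G 0 x) add0n capD E2 (op_pc F (cupc G H)).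
by rewrite /pe pa_cup /sn; case: (pa F); case: (pa G); case: (pa H); rewrite /= ?(addE, WD, WN, capD, capN); zmodule.
Qed.
End Leibniz.

(** * The Gerstenhaber algebra up to homotopy *)

Section CochainStatements.
Variables (k : comNzRingType) (A : regUnitalHomAss k).
Local Notation coch := (@coch k A).
Local Notation TT := (@ttensor k A).
Local Notation muc := (muc A).
Implicit Types (F G H : coch) (x y : TT) (f g h u v : seq A -> A).

Lemma fun_inj n u v : u \in @cochain k A n -> v \in @cochain k A n ->
  (forall x, Y n u 0 x = Y n v 0 x) -> u = v.
Proof. by move=> cu cv E; apply: (@op_inj _ _ (Coch cu) (Coch cv)). Qed.

Lemma sn_br F G i x :
  sn (pa (br F G)) (rho (br F G) i x) = sn (pa F (+) pa G) (rho (br F G) i x).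
Proof.
rewrite /pa /par /=; case E: (ar F + ar G)%N => [|p]; last first.
  by have := oddD (ar F) (ar G); rewrite E /=; do 3!case: odd.
have [F0 G0] : ar F = 0%N /\ ar G = 0%N by split; lia.
by rewrite !rho_fn0 ?sn0 //= /circsum F0 G0 /= !big_nil sn0 subr0.
Qed.

Lemma int_par (p : nat) : odd `|p%:Z - 1| = par p.
Proof. by rewrite /par; lia. Qed.

Lemma odd_mulz (a b : int) : odd `|a * b| = odd `|a| && odd `|b|.
Proof. by rewrite abszM oddM. Qed.

Lemma circsumE p q f g : circsum p q f g =
  \sum_(1 <= i < p.+1) sg ((q%:Z - 1) * (i%:Z - 1)) *: circ q f i g.
Proof.
rewrite big_add1 /= /circsum /index_iota subn0; apply: eq_bigr => i _.
rewrite sgZ odd_mulz int_par /circs; congr (sn (_ && _) _).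
lia.
Qed.

Lemma bracketE p q f g :
  bracket p q f g = circsum p q f g - sn (par p && par q) (circsum q p g f).
Proof. by rewrite /bracket -!circsumE sgZ odd_mulz !int_par. Qed.

Lemma fn_br F G : fn (br F G) = bracket (ar F) (ar G) F G.
Proof. by rewrite bracketE. Qed.

Lemma fn_dl F : fn (dl F) = coboundary (ar F) F.
Proof. by rewrite /coboundary -(fn_br muc F). Qed.

Lemma cocycleP p f : f \in @cocycle k A p -> exists F, [/\ ar F = p, fn F = f & dclosed F].
Proof.
by case/andP=> cf /eqP df; exists (Coch cf); split; rewrite // /dclosed fn_dl.
Qed.

Lemma dclosed_cocycle F : dclosed F -> fn F \in @cocycle k A (ar F).
Proof. by move=> cF; apply/andP; rewrite cochP -fn_dl cF eqxx. Qed.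

Lemma circ_linl q f g h i a : circ q (a *: f + g) i h = a *: circ q f i h + circ q g i h.
Proof. by []. Qed.

Lemma circ_linr q f g h i a : mlin f ->
  circ q f i (a *: g + h) = a *: circ q f i g + circ q f i h.
Proof. by move=> mf; apply/funext => s; apply: mf. Qed.

Lemma circsum_linl p q f g h a : circsum p q (a *: f + g) h = a *: circsum p q f h + circsum p q g h.
Proof.
rewrite /circsum scaler_sumr -big_split; apply: eq_bigr => i _ /=.
by rewrite /circs circ_linl sn_linear.
Qed.
Lemma circsum_linr p q f g h a : mlin f -> circsum p q f (a *: g + h) = a *: circsum p q f g + circsum p q f h.
Proof.
move=> mf; rewrite /circsum scaler_sumr -big_split; apply: eq_bigr => i _ /=.
by rewrite /circs circ_linr // sn_linear.
Qed.

Lemma bracketC p q f g :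
  bracket p q f g = - sn (par p && par q) (bracket q p g f).
Proof.
rewrite !bracketE [par q && _]andbC; case: (_ && _); rewrite /sn /=; zmodule.
Qed.

Lemma bracket_linl p q f g h a : mlin h ->
  bracket p q (a *: f + g) h = a *: bracket p q f h + bracket p q g h.
Proof.
move=> mh; rewrite !bracketE circsum_linl circsum_linr // sn_linear opprD scalerBr.
by rewrite addrACA.
Qed.

Lemma bracket_linr p q f g h a : mlin f ->
  bracket p q f (a *: g + h) = a *: bracket p q f g + bracket p q f h.
Proof.
move=> mf; rewrite !bracketE circsum_linl circsum_linr // sn_linear opprD scalerBr.
by rewrite addrACA.
Qed.

Lemma mu_mlin : mlin (@mu k A).
Proof. by move=> s1 s2 a x y; rewrite mu_linear. Qed.

Lemma cup_linl p q f g h a : cup p q (a *: f + g) h = a *: cup p q f h + cup p q g h.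
Proof. by rewrite /cup (circ_linr _ _ _ _ _ mu_mlin) circ_linl. Qed.

Lemma cup_linr p q f g h a : f \in @cochain k A p ->
  cup p q f (a *: g + h) = a *: cup p q f g + cup p q f h.
Proof.
move=> cf; rewrite /cup circ_linr //.
by apply: cochain_mlin; apply: (@circ_cochain _ _ 2 _ 1) cf => //; exact: mu_cochain.
Qed.

Lemma is_coboundary0 n : @is_coboundary k A n 0.
Proof.
case: n => [|n] //=; exists 0; first exact: rpred0.
by have := @coboundary_linear k A n (-1) 0 0; rewrite scaler0 addr0 scaleN1r addNr.
Qed.

Lemma is_coboundaryD n a u v : @is_coboundary k A n u -> @is_coboundary k A n v ->
  @is_coboundary k A n (a *: u + v).
Proof.
case: n => [|n] /=; first by move=> -> ->; rewrite scaler0 addr0.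
move=> [g cg ->] [h ch ->]; exists (a *: g + h); first by rewrite rpredD ?rpredZ.
by rewrite coboundary_linear.
Qed.

(** The alternative [fn H = 0] covers the homotopies whose arity is truncated, so that it is not
    [n - 1]. *)
Lemma is_coboundary_dl n u b H : u \in @cochain k A n ->
  (forall x, Y n u 0 x = sn b (op (dl H) 0 x)) -> n = (ar H).+1 \/ fn H = 0 ->
  @is_coboundary k A n u.
Proof.
have sq q f : sn b f \in @cochain k A q -> coboundary q (sn b f) = sn b (coboundary q f).
  move=> _; rewrite !snZ; have := @coboundary_linear k A q ((-1) ^+ nat_of_bool b) f 0.
  have := @coboundary_linear k A q (-1) 0 0; rewrite scaler0 addr0 scaleN1r addNr => ->.
  by rewrite !addr0.
move=> cu E [En|H0].
  move: cu E; rewrite En => cu E /=.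
  exists (sn b (fn H)); first by apply: sn_cochain; exact: cochP.
  rewrite sq; last by apply: sn_cochain; exact: cochP.
  rewrite -fn_dl; apply: (fun_inj cu); first by apply: sn_cochain; exact: (cochP (dl H)).
  by move=> x; rewrite E Ysnf //; exact: (cochP (dl H)).
have -> : u = 0.
  apply: (fun_inj cu) => [|x]; rewrite ?rpred0 // E op_dl Y0f !(op_fn0 _ _ H0) ?rho0 ?op0.
  by rewrite addr0 ?sn0 subr0 ?sn0.
exact: is_coboundary0.
Qed.

Lemma coboundary_coch p f : f \in @cocycle k A p -> @is_coboundary k A p f ->
  (exists H, p = (ar H).+1 /\ f = fn (dl H)) \/ f = 0.
Proof.
move=> _; case: p => [|p] /=; first by right.
move=> [g cg ->]; left; exists (Coch cg); split; [by []|exact: esym (fn_dl (Coch cg))].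
Qed.

Lemma dclosed_br F G : dclosed F -> dclosed G -> dclosed (br F G).
Proof.
move=> cF cG; rewrite /dclosed.
have -> : fn (dl (br F G)) = fn (Coch (rpred0 (@cochain k A (ar (dl (br F G)))))); last by [].
apply: rho_inj => // x; rewrite [RHS]rho_fn0 // rho_dl.
have S : sn (pa (br F G)) (rho (br F G) 0 (rho muc 0 x)) =
         sn (pa F (+) pa G) (rho (br F G) 0 (rho muc 0 x)).
  exact: sn_br.
rewrite S -!rho_comm !rhoD !rhoN !rhosn.
rewrite !(mu_rhoc _ _ cF) !(mu_rhoc _ _ cG) !rhosn.
rewrite ?(mu_rhoc _ _ cF) ?(mu_rhoc _ _ cG) ?rhosn.
by koszul.
Qed.
End CochainStatements.

Section Gerstenhaber.
Variables (k : comNzRingType) (A : regUnitalHomAss k).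
Local Notation coch := (@coch k A).
Local Notation TT := (@ttensor k A).
Local Notation muc := (muc A).
Local Notation cocycle := (@cocycle k A).
Local Notation is_coboundary := (@is_coboundary k A).
Implicit Types (F G H : coch) (x y : TT) (f g h u v : seq A -> A).

(** A zero cochain may be given any arity. This makes the terms of an identity comparable when the
    arity of an inner bracket is truncated. *)
Lemma recastc n F : ar F = n \/ fn F = 0 -> exists F', [/\ ar F' = n, fn F' = fn F,
  forall x, op F' 0 x = op F 0 x & forall x, rho F' 0 x = rho F 0 x].
Proof.
case=> [E|F0]; first by exists F.
exists (Coch (rpred0 (@cochain k A n))); split=> // x.
  by rewrite !op_fn0.
by rewrite !rho_fn0.
Qed.

Lemma rho_eq0 F : (forall x, rho F 0 x = 0) -> fn F = 0.
Proof.
move=> E; rewrite -[RHS]/(fn (Coch (rpred0 (@cochain k A (ar F))))).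
by apply: rho_inj => // x; rewrite E rho_fn0.
Qed.

Lemma br_fn0r F G : fn G = 0 -> fn (br F G) = 0.
Proof. by move=> G0; apply: rho_eq0 => x; rewrite -rho_comm !(rho_fn0 _ _ G0) rho0 sn0 subr0. Qed.
Lemma br_fn0l F G : fn F = 0 -> fn (br F G) = 0.
Proof. by move=> G0; apply: rho_eq0 => x; rewrite -rho_comm !(rho_fn0 _ _ G0) rho0 sn0 subr0. Qed.

Lemma op_eq0 F : (forall x, op F 0 x = 0) -> fn F = 0.
Proof.
move=> E; rewrite -[RHS]/(fn (Coch (rpred0 (@cochain k A (ar F))))).
by apply: op_inj => // x; rewrite E op_fn0.
Qed.
Lemma cup_fn0l F G : fn F = 0 -> fn (cupc F G) = 0.
Proof. by move=> F0; apply: op_eq0 => x; rewrite op_cup (op_fn0 _ _ F0) op0 sn0. Qed.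
Lemma cup_fn0r F G : fn G = 0 -> fn (cupc F G) = 0.
Proof. by move=> F0; apply: op_eq0 => x; rewrite op_cup (op_fn0 _ _ F0) !op0 sn0. Qed.

Lemma br00 F G : (ar F + ar G)%N = 0%N -> fn (br F G) = 0.
Proof.
move=> E; have [F0 G0] : ar F = 0%N /\ ar G = 0%N by split; lia.
by rewrite fn_br bracketE /circsum F0 G0 /= !big_nil /sn /= opprK addr0.
Qed.

Lemma sn_br_and b F G i x : sn (b && pa (br F G)) (rho (br F G) i x)
  = sn (b && (pa F (+) pa G)) (rho (br F G) i x).
Proof. by case: b => //=; exact: sn_br. Qed.

Lemma sn_br_and' b F G H i j x : sn (b && pa (br F G)) (rho H j (rho (br F G) i x))
  = sn (b && (pa F (+) pa G)) (rho H j (rho (br F G) i x)).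
Proof. by rewrite -rhosn sn_br_and rhosn. Qed.

(** [rho_comm] turns brackets into graded commutators of operators, for which the identity is
    formal; [sn_br_and] corrects the parity of inner brackets. *)
Lemma rho_jacobi F G H x : rho (br F (br G H)) 0 x =
  rho (br (br F G) H) 0 x + sn (pe F G) (rho (br G (br F H)) 0 x).
Proof.
rewrite -[in LHS]rho_comm -[rho (br (br F G) H) _ _]rho_comm -[rho (br G (br F H)) _ _]rho_comm.
rewrite /pe [pa (br F G) && _]andbC !sn_br_and !sn_br_and'.
rewrite -!rho_comm !rhoD !rhoN !rhosn.
by koszul.
Qed.

Lemma bracket_jacobi p q r f g h : f \in @cochain k A p -> g \in @cochain k A q ->
  h \in @cochain k A r ->
  bracket p (q + r).-1 f (bracket q r g h) = bracket (p + q).-1 r (bracket p q f g) h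
    + sn (par p && par q) (bracket q (p + r).-1 g (bracket p r f h)).
Proof.
move=> cf cg ch; pose F := Coch cf; pose G := Coch cg; pose H := Coch ch.
rewrite -[bracket q r g h]/(bracket (ar G) (ar H) G H).
rewrite -[bracket p q f g]/(bracket (ar F) (ar G) F G).
rewrite -[bracket p r f h]/(bracket (ar F) (ar H) F H) -!fn_br.
rewrite -[bracket p _ f _](fn_br F (br G H)) -[bracket _ r _ h](fn_br (br F G) H).
rewrite -[bracket q _ g _](fn_br G (br F H)).
pose n := (p + q + r).-2.
have [|U1 [a1 <- _ r1]] := @recastc n (br F (br G H)).
  case: (posnP (q + r)) => h0; first by right; apply: br_fn0r; exact: br00.
  by left; rewrite /= /n; lia.
have [|U2 [a2 <- _ r2]] := @recastc n (br (br F G) H).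
  case: (posnP (p + q)) => h0; first by right; apply: br_fn0l; exact: br00.
  by left; rewrite /= /n; lia.
have [|U3 [a3 <- _ r3]] := @recastc n (br G (br F H)).
  case: (posnP (p + r)) => h0; first by right; apply: br_fn0r; exact: br00.
  by left; rewrite /= /n; lia.
have cU : fn U2 + sn (pe F G) (fn U3) \in @cochain k A n.
  by apply: rpredD; [rewrite -a2 cochP | apply: sn_cochain; rewrite -a3 cochP].
rewrite -[RHS]/(fn (Coch cU)); apply: rho_inj; first by rewrite a1.
move=> x; rewrite (@rho_linf _ _ U2 U3 (Coch cU) 0 (pe F G)) //= ?a2 ?a3 //.
by rewrite r1 r2 r3 rho_jacobi.
Qed.

Lemma bracket_cocycle p q f g : f \in cocycle p -> g \in cocycle q ->
  bracket p q f g \in cocycle (p + q).-1.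
Proof.
move=> /cocycleP[F [<- <- cF]] /cocycleP[G [<- <- cG]].
by rewrite -fn_br; apply: dclosed_cocycle; apply: dclosed_br.
Qed.

(** For closed [G] one has [[dl H, G] = dl [H, G]], since under [rho] the differential is the
    commutator with [rho muc 0]. *)
Lemma bracket_exactl p q f g : f \in cocycle p -> is_coboundary p f -> g \in cocycle q ->
  is_coboundary (p + q).-1 (bracket p q f g).
Proof.
move=> cf bf /cocycleP[G [<- <- cG]].
have [[H [-> ->]]|->] := coboundary_coch cf bf; last first.
  have -> : bracket p (ar G) 0 G = 0 by have := @br_fn0l (Coch (rpred0 (@cochain k A p))) G erefl; rewrite fn_br.
  exact: is_coboundary0.
rewrite -[(ar H).+1]/(ar (dl H)) -fn_br.
have E x : rho (br (dl H) G) 0 x = rho (dl (br H G)) 0 x.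
  rewrite rho_dl sn_br -!(rho_comm _ G) (rho_dl H) !rhoD !rhoN !rhosn !(mu_rhoc _ _ cG).
  by rewrite (rho_dl H 0 x) /pe pa_dl !rhoD !rhoN !rhosn; koszul.
have [h0|h0] := posnP (ar H + ar G).
  rewrite (_ : fn (br (dl H) G) = 0); first exact: is_coboundary0.
  apply: rho_eq0 => x; rewrite E; apply: rho_fn0; apply: br_fn0r; exact: br00.
have -> : (ar (dl H) + ar G).-1 = (ar (br H G)).+1.
  by rewrite -[ar (dl H)]/((ar H).+1) /=; lia.
exists (br H G); first exact: cochP.
rewrite -fn_dl; apply: rho_inj => //.
rewrite -[ar (br _ _)]/((ar H).+1 + ar G).-1 -[ar (dl _)]/((ar (br H G)).+1) /=; lia.
Qed.

Lemma cup_cocycle p q f g : f \in cocycle p -> g \in cocycle q ->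
  cup p q f g \in cocycle (p + q).
Proof.
move=> /cocycleP[F [<- <- cF]] /cocycleP[G [<- <- cG]].
apply: (dclosed_cocycle (F := cupc F G)); rewrite /dclosed; apply: op_eq0 => x.
rewrite op_cap1 cap_dl_cup /cap (@op_fn0 _ _ (cupc (dl F) G)) ?cup_fn0l //.
by rewrite (@op_fn0 _ _ (cupc F (dl G))) ?cup_fn0r // op0 sn0 subr0 sn0.
Qed.

Lemma cup_exactl p q f g : f \in cocycle p -> is_coboundary p f -> g \in cocycle q ->
  is_coboundary (p + q) (cup p q f g).
Proof.
move=> cf bf /cocycleP[G [<- <- cG]].
have [[H [-> ->]]|->] := coboundary_coch cf bf; last first.
  rewrite -[cup _ _ _ _]/(fn (cupc (Coch (rpred0 (@cochain k A p))) G)) cup_fn0l //.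
  exact: is_coboundary0.
apply: (@is_coboundary_dl _ _ _ _ false (cupc H G)); last by left.
  exact: (cochP (cupc (dl H) G)).
move=> x; rewrite -[LHS]/(op (cupc (dl H) G) 0 x) /sn (op_cap1 (cupc (dl H) G)) (op_cap1 (dl (cupc H G))) cap_dl_cup.
rewrite [cap (cupc H (dl G)) _]/cap (@op_fn0 _ _ (cupc H (dl G))) ?cup_fn0r //.
by rewrite op0 sn0 subr0 pa_dl !pa_cup pa_dl; congr sn; case: (pa H); case: (pa G).
Qed.

Lemma cup_exactr p q f g : f \in cocycle p -> g \in cocycle q -> is_coboundary q g ->
  is_coboundary (p + q) (cup p q f g).
Proof.
move=> /cocycleP[F [<- <- cF]] cg bg.
have [[H [-> ->]]|->] := coboundary_coch cg bg; last first.
  rewrite -[cup _ _ _ _]/(fn (cupc F (Coch (rpred0 (@cochain k A q))))) cup_fn0r //.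
  exact: is_coboundary0.
apply: (@is_coboundary_dl _ _ _ _ (~~ pa F) (cupc F H)); last by left; rewrite addnS.
  exact: (cochP (cupc F (dl H))).
move=> x; rewrite -[LHS]/(op (cupc F (dl H)) 0 x) (op_cap1 (cupc F (dl H))) (op_cap1 (dl (cupc F H))) cap_dl_cup.
rewrite [cap (cupc (dl F) H) _]/cap (@op_fn0 _ _ (cupc (dl F) H)) ?cup_fn0l //.
rewrite op0 sub0r !pa_cup pa_dl pa_dl pa_cup.
by case: (pa F); case: (pa H); rewrite /sn /= ?opprK.
Qed.

Lemma cupC p q f g : f \in cocycle p -> g \in cocycle q ->
  is_coboundary (p + q) (cup p q f g - sn (odd p && odd q) (cup q p g f)).
Proof.
move=> /cocycleP[F [<- <- cF]] /cocycleP[G [<- <- cG]].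
have c1 := cochP (cupc F G); have c2 := cochP (cupc G F).
rewrite /= in c1 c2; rewrite addnC in c2.
have -> : cup (ar F) (ar G) F G - sn (odd (ar F) && odd (ar G)) (cup (ar G) (ar F) G F)
  = cup (ar F) (ar G) F G + sn (~~ (odd (ar F) && odd (ar G))) (cup (ar G) (ar F) G F).
  by case: (_ && _); rewrite /sn ?opprK.
apply: (@is_coboundary_dl _ _ _ _ (~~ pa F) (pc F G)).
- by apply: rpredD => //; apply: sn_cochain.
- move=> x; rewrite YDf ?Ysnf ?sn_cochain // -[Y _ _ 0 x]/(op (cupc F G) 0 x).
  rewrite addnC -[Y _ (cup (ar G) _ _ _) 0 x]/(op (cupc G F) 0 x) op_dl_pc // !cap_op0.
  have -> : odd (ar F) = ~~ pa F by rewrite /pa /par negbK.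
  have -> : odd (ar G) = ~~ pa G by rewrite /pa /par negbK.
  by koszul.
- case: (posnP (ar F + ar G)) => h0; last by left; rewrite /=; lia.
  by right; rewrite /= /circsum (_ : ar F = 0)%N /= ?big_nil //; lia.
Qed.

Lemma fn_bracec0 F H G : ar F = 0%N \/ (ar F + ar G + ar H)%N = 1%N ->
  fn (bracec F H G) = 0.
Proof.
rewrite /= /brace; case: (posnP (ar F)) => [->|F0] [] E; rewrite ?big_nil //; first lia.
have [-> ->] : ar H = 0%N /\ ar F = 1%N by split; lia.
by rewrite /= big_seq1 big_nil.
Qed.

Lemma sn_br_op F G i x :
  sn (pa (br F G)) (op (br F G) i x) = sn (pa F (+) pa G) (op (br F G) i x).
Proof.
case: (posnP (ar F + ar G)) => [/br00 E|lt]; first by rewrite !op_fn0 ?sn0.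
congr sn; move: lt; rewrite /pa /par /=; case E: (ar F + ar G)%N => [|p] // _.
by have := oddD (ar F) (ar G); rewrite E /=; do 3!case: odd.
Qed.

Lemma op_cup_br F G H x : op (cupc (br F G) H) 0 x = sn (pa F (+) pa G)
  (cap (pc F G) (op H 0 x) - sn (pe F G) (cap (pc G F) (op H 0 x))).
Proof. by rewrite op_cup -opsn sn_br_op op_br opsn opD opN opsn. Qed.

(** Composition into a cup product is a derivation without homotopy: [F] enters either [H] or [G].
    Hence the brace only has to correct [F o (G cup H)]. *)
Lemma op_pc_cup G H F x : op (pc (cupc G H) F) 0 x = sn (pa G)
  (cap G (op (pc H F) 0 x) + sn (pe H F) (cap (pc G F) (op H 0 x))).
Proof.
rewrite op_pc !op_cup -!/(cap _ _) rhosn.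
have -> : op H 0 (rho F 0 x) = op (pc H F) 0 x + sn (pe H F) (rho F 1 (op H 0 x)).
  by rewrite op_pc; zmodule.
rewrite capD capsn.
have -> : cap G (rho F 1 (op H 0 x)) = cap (pc G F) (op H 0 x)
   + sn (pe G F (+) pa F) (rho F 1 (cap G (op H 0 x))).
  by rewrite cap_pc; zmodule.
by rewrite /pe pa_cup; koszul.
Qed.

Lemma bracket_cup p q r f g h : f \in cocycle p -> g \in cocycle q -> h \in cocycle r ->
  is_coboundary (p + (q + r)).-1
    (bracket p (q + r) f (cup q r g h) - (cup (p + q).-1 r (bracket p q f g) h
      + sn (par p && odd q) (cup q (p + r).-1 g (bracket p r f h)))).
Proof.
move=> /cocycleP[F [<- <- cF]] /cocycleP[G [<- <- cG]] /cocycleP[H [<- <- cH]].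
pose n := (ar F + (ar G + ar H)).-1.
have [|U1 [a1 e1 r1 _]] := @recastc n (br F (cupc G H)); first by left.
have [|U2 [a2 e2 r2 _]] := @recastc n (cupc (br F G) H).
  case: (posnP (ar F + ar G)) => h0; last by left; rewrite /= /n; lia.
  by right; apply: cup_fn0l; exact: br00.
have [|U3 [a3 e3 r3 _]] := @recastc n (cupc G (br F H)).
  case: (posnP (ar F + ar H)) => h0; last by left; rewrite /= /n; lia.
  by right; apply: cup_fn0r; exact: br00.
have -> : bracket (ar F) (ar G + ar H) F (cup (ar G) (ar H) G H) = fn U1.
  by rewrite e1 fn_br.
have -> : cup (ar F + ar G).-1 (ar H) (bracket (ar F) (ar G) F G) H = fn U2.
  by rewrite e2 -fn_br.
have -> : cup (ar G) (ar F + ar H).-1 G (bracket (ar F) (ar H) F H) = fn U3.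
  by rewrite e3 -fn_br.
have c1 := cochP U1; have c2 := cochP U2; have c3 := cochP U3; rewrite a1 a2 a3 in c1 c2 c3.
set b := par _ && _.
have c23 : fn U2 + sn b (fn U3) \in @cochain k A n by apply: rpredD => //; apply: sn_cochain.
have -> : fn U1 - (fn U2 + sn b (fn U3)) = fn U1 + sn true (fn U2 + sn b (fn U3)) by [].
(* [H] precedes [G] in the brace because the value of [H] is the left factor of [cupc G H]. The sign
   is the one [F o (G cup H)] has in [op_dl_brace]. *)
apply: (@is_coboundary_dl _ _ _ _ (pe G H (+) pa F (+) pa G) (bracec F H G)).
- by apply: rpredD => //; apply: sn_cochain.
- move=> x; rewrite (YDf _ _ c1 (sn_cochain _ c23)) Ysnf // (YDf _ _ c2 (sn_cochain _ c3)) Ysnf //.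
  rewrite -{1}a1 -{1}a2 -{1}a3 -[Y _ U1 0 x]/(op U1 0 x) -[Y _ U2 0 x]/(op U2 0 x) -[Y _ U3 0 x]/(op U3 0 x).
  rewrite r1 r2 r3 op_br op_cup_br op_pc_cup [op (cupc G _) 0 x]op_cup op_br op_dl_brace //.
  rewrite /b /pe pa_cup -/(pa F).
  have -> : odd (ar G) = ~~ pa G by rewrite /pa /par negbK.
  rewrite -/(cap G _) capD capN capsn.
  by koszul.
- case: (posnP (ar F)) => h0; first by right; apply: fn_bracec0; left.
  case: (posnP ((ar F).-1 + ar G + ar H)) => h1; last by left; rewrite /= /n; lia.
  by right; apply: fn_bracec0; right; lia.
Qed.
End Gerstenhaber.

(** * The cyclic structure and the Connes operator *)

Section Cyclic.
Variables (k : comNzRingType) (A : regUnitalHomAss k).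
Local Notation coch := (@coch k A).
Local Notation TT := (@ttensor k A).
Local Notation muc := (muc A).
Local Notation onec := (onec A).
Local Notation tau := (@tau k A).
Implicit Types (F G H : coch) (x y : TT).

Definition len n x := exists c : chain A n, x = ttof c.

Lemma len_ind n (P : TT -> Prop) : P 0 ->
  (forall a x y, P x -> P y -> P (a *: x + y)) ->
  (forall s, size s = n.+1 -> P (tt s)) -> forall x, len n x -> P x.
Proof.
move=> P0 PD Ps x [c ->]; rewrite -[c]qreprK -[qrepr c]freeg_sumE !linear_sum.
elim: (dom _) => [|s r IH]; rewrite ?big_nil // big_cons /=.
set u := ttof _; suff -> : u = coeff s (qrepr c) *: tt s.
  by apply: PD => //; apply: Ps; exact: size_tuple.
rewrite /u -(ttofE (size_tuple s)) -linearZ; congr ttof.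
rewrite /elem /tens -linearZ /=; congr qproj; rewrite /free_tens valK.
by apply/eqP/freeg_eqP => v; rewrite coeffU coeff_fgscale coeffU mul1r.
Qed.

Lemma len_linear n a x y : len n x -> len n y -> len n (a *: x + y).
Proof. by move=> [c ->] [d ->]; exists (a *: c + d); rewrite linearP. Qed.
Lemma len0 n : len n 0. Proof. by exists 0; rewrite linear0. Qed.
Lemma lenD n x y : len n x -> len n y -> len n (x + y).
Proof. by move=> h /(len_linear 1 h); rewrite scale1r. Qed.
Lemma lenN n x : len n x -> len n (- x).
Proof. by move=> h; have := len_linear (-1) h (len0 n); rewrite scaleN1r addr0. Qed.
Lemma lenB n x y : len n x -> len n y -> len n (x - y).
Proof. by move=> h h'; apply: lenD => //; apply: lenN. Qed.
Lemma len_sn n b x : len n x -> len n (sn b x).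
Proof. by case: b => //; apply: lenN. Qed.
Lemma len_tt n s : size s = n.+1 -> len n (tt s).
Proof. by move=> ss; exists (elem n s); rewrite ttofE. Qed.

Lemma len_ext n (F G : {linear TT -> TT}) x : len n x ->
  (forall s, size s = n.+1 -> F (tt s) = G (tt s)) -> F x = G x.
Proof.
move=> lx FG; move: x lx; apply: len_ind => // [|a x y Ex Ey].
  by rewrite !linear0.
by rewrite !linearP Ex Ey.
Qed.

Lemma op_out n F i x : len n x -> (n.+1 < i + ar F)%N -> op F i x = 0.
Proof.
move=> lx lt; rewrite (len_ext (F := op F i) (G := \0) lx) // => s ss.
by rewrite /= /op Yzero ?cochP // ss.
Qed.

Lemma rho_lout n F a x : len n x -> (n.+1 < a + ar F)%N -> rho F a x = 0.
Proof.
move=> lx lt; rewrite (len_ext (F := rho F a) (G := \0) lx) // => s ss.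
by rewrite /= rho_out // ss.
Qed.

Lemma len_op n m F i x : len n x -> (m + ar F)%N = n.+1 -> len m (op F i x).
Proof.
move=> lx E; move: x lx; apply: len_ind => [|a x y lx ly|s ss].
- by rewrite op0; exact: len0.
- by rewrite linearP; exact: len_linear.
rewrite /op YE ?cochP //; apply: len_sn; case: ifP => le; last exact: len0.
by apply: len_tt; rewrite size_insert // ss; lia.
Qed.

Lemma len_rho n m F a x : len n x -> (m + ar F)%N = n.+1 -> len m (rho F a x).
Proof.
move=> lx E; move: a; apply: tail_down => [|a IH].
  by have [M HM] := rho_large F x; exists M => a /HM ->; exact: len0.
by rewrite rhoS; apply: lenD => //; apply: len_op lx E.
Qed.

Lemma iter_tauE r s : iter r tau (tt s) = sn (odd r && par (size s)) (tt (iter r (rotr 1) s)).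
Proof.
elim: r => [|r IH] //=; rewrite IH tausn tauE snsn.
have -> : size (iter r (rotr 1) s) = size s by elim: r {IH} => //= r; rewrite size_rotr.
by congr sn; case: odd; case: par.
Qed.

Lemma len_tau n x : len n x -> len n (tau x).
Proof.
move: x; apply: len_ind => [|a x y lx ly|s ss]; first by rewrite tau0; exact: len0.
  by rewrite linearP; exact: len_linear.
by rewrite tauE; apply: len_sn; apply: len_tt; rewrite size_rotr.
Qed.

Lemma iter_tau_linear r : linear (iter r tau).
Proof. by elim: r => [|r IH] a x y //; rewrite !iterS (IH a x y) linearP. Qed.
HB.instance Definition _ r := GRing.isLinear.Build k TT TT *:%R (iter r tau) (iter_tau_linear r).
Lemma itauD r : {morph iter r tau : x y / x + y}. Proof. exact: raddfD. Qed.
Lemma itauN r : {morph iter r tau : x / - x}. Proof. exact: raddfN. Qed.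
Lemma itau0 r : iter r tau 0 = 0. Proof. exact: raddf0. Qed.

Lemma len_itau r n x : len n x -> len n (iter r tau x).
Proof. by move=> lx; elim: r => //= r; exact: len_tau. Qed.

Lemma iter_rotr1_cat (s1 s2 : seq A) : iter (size s2) (rotr 1) (s1 ++ s2) = s2 ++ s1.
Proof.
elim/last_ind: s2 s1 => [|s2 x IH] s1; first by rewrite cats0.
by rewrite size_rcons iterSr -rcons_cat rotr1_rcons -cat_cons IH cat_rcons.
Qed.

(** The accumulated sign [(-1)^(n (n + 1))] is trivial. *)
Lemma tau_order n x : len n x -> iter n.+1 tau x = x.
Proof.
move=> lx; rewrite (len_ext (F := iter n.+1 tau) (G := idfun) lx) // => s ss.
have H := iter_rotr1_cat [::] s; rewrite cats0 /= in H.
rewrite /= -iterS iter_tauE -ss H ss.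
by rewrite /par /=; case: odd.
Qed.

Lemma tau_op n F i x : len n x -> (i + ar F <= n)%N -> tau (op F i x) = op F i.+1 (tau x).
Proof.
move=> lx le; rewrite -[LHS]/((tau \o op F i) x) -[RHS]/((op F i.+1 \o tau) x).
apply: (len_ext lx) => s ss /=.
rewrite tauE opsn /op !YE ?cochP // !size_rotr ss ltnS le leqW // tausn tauE.
rewrite rotr1_insert ?ss // size_insert ?ss ?leqW // !snsn; congr sn.
rewrite /par /= oddB /=; last lia.
by do 3!case: odd.
Qed.

Lemma tau_op_last n F i x : len n x -> (i + ar F)%N = n.+1 ->
  tau (op F i x) = op F 0 (iter (ar F) tau x).
Proof.
move=> lx le; rewrite -[LHS]/((tau \o op F i) x) -[RHS]/((op F 0 \o iter (ar F) tau) x).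
apply: (len_ext lx) => s ss /=.
rewrite iter_tauE opsn /op !YE ?cochP // ss le leqnn tausn tauE.
have -> : size (iter (ar F) (rotr 1) s) = n.+1.
  by rewrite -ss; elim: (ar F) => //= r; rewrite size_rotr.
have -> : (0 + ar F <= n.+1)%N by rewrite -le leq_addl.
rewrite rotr1_insert_last ?ss // size_insert ?ss ?le // andbF !snsn; congr sn.
have -> : (n.+2 - ar F)%N = i.+1 by lia.
have -> : par n.+1 = par (i + ar F) by rewrite le.
by rewrite /par /= oddD; do 2!case: odd.
Qed.

(** Every insertion moves one place to the right, except the one ending at the last entry, which
    wraps around to position 0. *)
Lemma tau_rho n F a x : len n x -> (a + ar F <= n.+1)%N ->
  tau (rho F a x) = rho F a.+1 (tau x) + op F 0 (iter (ar F) tau x).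
Proof.
move=> lx; move Ed: (n.+1 - (a + ar F))%N => d; elim: d a Ed => [|d IH] a Ed le.
  rewrite rhoS (@rho_lout n F a.+1 x) // ?(@rho_lout n F a.+1) ?addr0 ?add0r //; try lia.
    by apply: tau_op_last lx _; lia.
  exact: len_tau.
rewrite rhoS tauD (IH a.+1); try lia.
by rewrite (tau_op lx) ?[rho F a.+1 (tau x)]rhoS ?addrA //; lia.
Qed.
End Cyclic.

(** * The Hochschild boundary, the norm and the Connes operator *)

Section Homology.
Variables (k : comNzRingType) (A : regUnitalHomAss k).
Local Notation coch := (@coch k A).
Local Notation TT := (@ttensor k A).
Local Notation muc := (muc A).
Local Notation onec := (onec A).
Local Notation tau := (@tau k A).
Implicit Types (F G H : coch) (x y : TT).

Definition bd x : TT := rho muc 0 x + op muc 0 (tau x).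
Lemma bdD : {morph bd : x y / x + y}.
Proof. by move=> x y; rewrite /bd tauD opD rhoD addrACA. Qed.
Lemma bdN : {morph bd : x / - x}.
Proof. by move=> x; rewrite /bd tauN opN rhoN opprD. Qed.
Lemma bd0 : bd 0 = 0.
Proof. by rewrite /bd tau0 op0 rho0 addr0. Qed.
Lemma bdsn b x : bd (sn b x) = sn b (bd x).
Proof. by case: b; rewrite /sn ?bdN. Qed.

Fixpoint cycsum q x : TT := if q is r.+1 then cycsum r x + iter r tau x else 0.
Lemma cycsumD q : {morph cycsum q : x y / x + y}.
Proof. by elim: q => [|q IH] x y /=; rewrite ?addr0 // IH itauD addrACA. Qed.
Lemma cycsumN q : {morph cycsum q : x / - x}.
Proof. by elim: q => [|q IH] x /=; rewrite ?oppr0 // IH itauN opprD. Qed.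
Lemma cycsum0 q : cycsum q 0 = 0.
Proof. by elim: q => [|q IH] //=; rewrite IH itau0 addr0. Qed.

(* [cycsum n.+1] is the norm of the cyclic group on chains of degree [n], and
   [kap F n.+1] the sum over all rotations of the insertions of [F] to the right
   of the original entry [a_0], which is in position [r] of [iter r tau x]. *)
Fixpoint kap F q x : TT := if q is r.+1 then kap F r x + rho F r.+1 (iter r tau x) else 0.
Lemma kap0 F q : kap F q 0 = 0.
Proof. by elim: q => [|q IH] //=; rewrite IH itau0 rho0 addr0. Qed.

(** As long as the blocks fit, the summand of index [r] is [iter r tau (cap F x)] ([tau_mu_iter]),
    so this is a partial norm of [cap F x]. *)
Fixpoint capsum F q x : TT :=
  if q is r.+1 then capsum F r x + op muc r (op F r.+1 (iter r tau x)) else 0.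

Lemma len_cycsum q n x : len n x -> len n (cycsum q x).
Proof.
by move=> lx; elim: q => [|q IH] /=; [exact: len0 | apply: lenD => //; exact: len_itau].
Qed.

Lemma len_kap q n m F x : len n x -> (m + ar F)%N = n.+1 -> len m (kap F q x).
Proof.
move=> lx E; elim: q => [|q IH] /=; first exact: len0.
by apply: lenD => //; apply: (len_rho (n := n)) => //; exact: len_itau.
Qed.

Lemma len_bd n x : len n.+1 x -> len n (bd x).
Proof.
move=> lx; apply: lenD; first by apply: (len_rho (n := n.+1)) => //=; rewrite addn2.
by apply: (len_op (n := n.+1)); rewrite /= ?addn2 //; exact: len_tau.
Qed.

Lemma rho_mu_len0 a x : len 0 x -> rho muc a x = 0.
Proof. by move=> lx; apply: (rho_lout lx); rewrite /= addn2. Qed.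

Lemma bd_len0 x : len 0 x -> bd x = 0.
Proof.
move=> lx; rewrite /bd rho_mu_len0 // (@op_out _ _ 0 muc 0) ?addr0 //.
exact: len_tau.
Qed.

(** For [r = 0] this is the definition of [bd], as [rho muc 0 - rho muc 1] is [op muc 0]. Each
    rotation moves all products one place to the right and brings one more around to the front. *)
Lemma taub n r x : len n x -> (r < n)%N ->
  rho muc r (iter r tau x) + rho muc 0 (iter r.+1 tau x) - rho muc r.+1 (iter r.+1 tau x)
  = iter r tau (bd x).
Proof.
move=> lx; elim: r => [|r IH] lt.
  by rewrite /= (rhoS muc 0 (tau x)) /bd; zmodule.
rewrite [RHS]iterS -IH 1?ltnW // !tauD tauN.
have ly := len_itau r lx; have lz := len_itau r.+1 lx.
rewrite !(tau_rho (F := muc) ly) ?(tau_rho (F := muc) lz) /= ?addn2 //; try lia.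
rewrite (rhoS muc 0 (tau (tau _))); zmodule.
Qed.

Lemma norm_bd n q x : len n x -> (q <= n)%N ->
  rho muc 0 (cycsum q x) + rho muc 0 (iter q tau x) - rho muc q (iter q tau x)
  = cycsum q (bd x).
Proof.
move=> lx; elim: q => [|q IH] le /=; first by rewrite rho0; zmodule.
rewrite -(taub lx le) -IH 1?ltnW // rhoD /=; zmodule.
Qed.

(** The classical [b' N = N b], with [b'] the bar differential [rho muc 0]: at [q = n] in [norm_bd]
    no product fits from position [n] on. *)
Lemma norm_full n x : len n x -> rho muc 0 (cycsum n.+1 x) = cycsum n (bd x).
Proof.
move=> lx; rewrite -(norm_bd lx (leqnn n)) /= rhoD.
by rewrite (@rho_lout _ _ n muc n) ?subr0 //= ?addn2 //; exact: len_itau.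
Qed.

Lemma cycsum_tau q x : cycsum q x - tau (cycsum q x) = x - iter q tau x.
Proof.
elim: q => [|q IH] /=; first by rewrite tau0; zmodule.
by rewrite tauD opprD addrACA IH; zmodule.
Qed.

Lemma tau_norm n x : len n x -> tau (cycsum n.+1 x) = cycsum n.+1 x.
Proof.
move=> lx; have := cycsum_tau n.+1 x; rewrite (tau_order lx) subrr => /eqP.
by rewrite subr_eq0 => /eqP <-.
Qed.

Lemma cycsum_itau q r x : cycsum q (iter r tau x) = iter r tau (cycsum q x).
Proof. by elim: q => [|q IH] /=; rewrite ?itau0 // IH itauD -!iterD addnC. Qed.

Lemma norm_tau n x : len n x -> cycsum n.+1 (tau x) = cycsum n.+1 x.
Proof. by move=> lx; rewrite (cycsum_itau _ 1) /= -/(cycsum n.+1 x) tau_norm. Qed.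

Lemma cycsum_add q r x : cycsum (q + r) x = cycsum q x + cycsum r (iter q tau x).
Proof. by elim: r => [|r IH]; rewrite ?addn0 ?addr0 // addnS /= IH -iterD addnC addrA. Qed.

Lemma mu_one n x : len n x -> op muc 0 (op onec 0 x) = x.
Proof.
move=> lx; rewrite -[LHS]/((op muc 0 \o op onec 0) x) (len_ext (G := idfun) lx) // => s ss.
by rewrite /= mu_one_l // ss.
Qed.

(** Inserting 1 in front contracts the bar differential: the leading product restores the chain, and
    the other products anticommute with the insertion. *)
Lemma rho_one n x : len n x -> rho muc 0 (op onec 0 x) = x - op onec 0 (rho muc 0 x).
Proof.
by move=> lx; rewrite rhoS (mu_one lx) (@rho_op _ _ muc onec 1 0 0).
Qed.

(** The classical [b (1 - tau) = (1 - tau) b'], from the wraparound term in [tau_rho]. *)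
Lemma bd_tau n x : len n x -> bd (x - tau x) = rho muc 0 x - tau (rho muc 0 x).
Proof.
case: n => [|n] lx.
  by rewrite rho_mu_len0 // tau0 bd_len0 ?subrr //; apply: lenB => //; exact: len_tau.
rewrite (tau_rho lx) /= ?addn2 // /bd tauD tauN (rhoD _ _ x) opD !opN rhoN (rhoS _ 0 (tau x)).
zmodule.
Qed.

Lemma bd_bd n x : len n x -> bd (bd x) = 0.
Proof.
case: n => [|[|n]] lx; first by rewrite (bd_len0 lx) bd0.
  by rewrite bd_len0 //; exact: len_bd.
rewrite {1}/bd rhoD rho_mu2 add0r tauD (tau_rho lx) /= ?addn2 //.
rewrite (tau_op (n := n.+2)) /= ?addn2 //; last exact: len_tau.
rewrite !opD mu_assoc (rhoS muc 0 (op _ _ _)) (rhoS muc 1 (tau x)) opD mu_assoc.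
by rewrite (@rho_op _ _ muc muc 1 0 2) // /sn /=; zmodule.
Qed.

(** The Connes operator [(1 - tau) s N] with signed rotations throughout. It differs from [connes]
    at most in the sign of the rotated term, and anticommutes with [bd] before normalization. *)
Definition connesq n x : TT :=
  op onec 0 (cycsum n.+1 x) - tau (op onec 0 (cycsum n.+1 x)).

Lemma len_one n x : len n x -> len n.+1 (op onec 0 x).
Proof. by move=> lx; apply: (@len_op _ _ n n.+1 onec 0 x lx); rewrite addn0. Qed.

(** Combine [b (1 - tau) = (1 - tau) b'], the contraction [b' s + s b' = 1], [b' N = N b] and
    [(1 - tau) N = 0]. *)
Lemma bd_connesq n x : len n x -> bd (connesq n x) = - connesq n.-1 (bd x).
Proof.
move=> lx; have lN := len_cycsum n.+1 lx.
rewrite (bd_tau (len_one lN)) (rho_one lN) (norm_full lx) tauD tauN (tau_norm lx).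
case: n lx {lN} => [|n] lx; last by rewrite /connesq /=; zmodule.
rewrite bd_len0 // /connesq !cycsum0 !op0 tau0; zmodule.
Qed.

Lemma connesq2 n x : len n x -> connesq n.+1 (connesq n x) = 0.
Proof.
move=> lx; rewrite /connesq cycsumD cycsumN (@norm_tau n.+1); last first.
  by apply: len_one; exact: len_cycsum.
by rewrite subrr op0 tau0 subrr.
Qed.

Lemma len_connesq n x : len n x -> len n.+1 (connesq n x).
Proof.
move=> lx; have l1 := len_one (len_cycsum n.+1 lx).
by apply: lenB => //; exact: len_tau.
Qed.
End Homology.

(** * Homotopies for the action on cycles *)

Section Cartan.
Variables (k : comNzRingType) (A : regUnitalHomAss k).
Local Notation coch := (@coch k A).
Local Notation TT := (@ttensor k A).
Local Notation muc := (muc A).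
Local Notation onec := (onec A).
Local Notation tau := (@tau k A).
Implicit Types (F G H : coch) (x y : TT).

Lemma len_cap n m F x : len n x -> (m + ar F)%N = n -> len m (cap F x).
Proof.
move=> lx E; apply: (@len_op _ _ m.+1 m muc); rewrite /= ?addn2 //.
by apply: (len_op _ lx); rewrite addSn E.
Qed.

Lemma cap_out n F x : len n x -> (n < ar F)%N -> cap F x = 0.
Proof. by move=> lx lt; rewrite /cap (op_out lx) ?op0. Qed.

Lemma len_zero_op n F x : len n x -> (n < ar F)%N -> op muc 0 (tau (op F 0 x)) = 0.
Proof.
move=> lx; rewrite leq_eqVlt => /orP[/eqP E|lt].
  by apply: (@op_out _ _ 0 muc 0) => //; apply: len_tau; apply: (len_op _ lx); rewrite add0n E.
by rewrite (op_out lx) ?tau0 ?op0.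
Qed.

Lemma bd_op0 n F x : len n x -> dclosed F ->
  bd (op F 0 x) = sn (pa F) (op F 0 (rho muc 0 x)) - cap F (x - tau x).
Proof.
move=> lx cF; rewrite /bd mu_op0c // capD capN.
have -> : op muc 0 (tau (op F 0 x)) = cap F (tau x); last by zmodule.
have [le|lt] := leqP (ar F) n; first by rewrite (tau_op lx).
by rewrite (len_zero_op lx lt) (cap_out (len_tau lx)).
Qed.

Lemma mu_rho_shift F q y : dclosed F ->
  rho muc q (rho F q.+1 y) = sn (pa F) (rho F q.+1 (rho muc q y)) + op muc q (op F q.+1 y).
Proof.
move=> cF; rewrite (rhoS muc q (rho F q.+1 y)) (mu_rhoc _ _ cF) (rhoS F q.+1 y) opD.
rewrite (rhoS muc q y) rhoD (@rho_op _ _ F muc q.+1 q q.+2) ?addn2 //.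
by koszul.
Qed.

(** In the summand of index [q], products to the left of position [q] pass to [rho F q] ([rho_seg]),
    and the others yield a cap term ([mu_rho_shift]). By [taub] the products reassemble to [bd x],
    up to a term that telescopes in [q]. *)
Lemma mu_kap n F q x : len n x -> dclosed F ->
  rho muc 0 (kap F q x) =
  sn (pa F) (kap F q (bd x) - rho F q (rho muc 0 (iter q tau x) - rho muc q (iter q tau x)))
  + capsum F q x.
Proof.
move=> lx cF; elim: q => [|q IH]; first by rewrite /= rho0 subrr rho0 subrr sn0 addr0.
rewrite [kap F q.+1 x]/= rhoD IH [kap F q.+1 _]/= [capsum F q.+1 x]/=.
set y := iter q tau x; set z := iter q.+1 tau x.
have E1 : rho muc 0 (rho F q.+1 y) = sn (pa F) (rho F q (rho muc 0 y - rho muc q y))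
    + sn (pa F) (rho F q.+1 (rho muc q y)) + op muc q (op F q.+1 y).
  have := @rho_seg _ _ F muc q 0 q q.+1 y; rewrite addn2 => /(_ (leqnn _) erefl).
  rewrite add0n => ->; rewrite snsn /pe pa_mu andbT addbb -addrA -mu_rho_shift //.
  by rewrite /sn; zmodule.
have E2 : rho F q.+1 (iter q tau (bd x)) = rho F q.+1 (rho muc q y + rho muc 0 z - rho muc q.+1 z).
  have [lt|ge] := ltnP q n; first by rewrite (taub lx lt).
  case: n lx ge => [|n] lx ge.
    by rewrite !rho_mu_len0 ?(bd_len0 lx) ?itau0 ?addr0 ?subr0 ?rho0 //; apply: len_itau.
  have l1 := len_itau q (len_bd lx).
  have l2 r a : len n (rho muc a (iter r tau x)).
    by apply: (@len_rho _ _ n.+1 n muc); rewrite /= ?addn2 //; exact: len_itau.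
  rewrite (rho_lout l1) ?(@rho_lout _ _ n F) //; try lia.
  by apply: lenB; [apply: lenD|]; exact: l2.
rewrite E1 E2 !rhoD !rhoN.
by koszul.
Qed.

(** By [tau_rho] each rotated summand cancels the next one. The wraparound terms apply [F] to blocks
    that do not contain [a_0]; adding [op F 0] of the full norm leaves the blocks containing [a_0],
    as in [lie]. *)
Lemma kap_tau n m F q x : len n x -> (m + ar F)%N = n.+1 -> (q <= m)%N ->
  kap F q x - tau (kap F q x) = rho F 1 x - rho F q.+1 (iter q tau x)
    - op F 0 (cycsum q (iter (ar F) tau x)).
Proof.
move=> lx E; elim: q => [|q IH] le /=; first by rewrite tau0 op0 subrr; zmodule.
rewrite tauD opprD addrACA IH 1?ltnW // (tau_rho (len_itau q lx)); last by rewrite -E leq_add2r.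
rewrite opD -!iterD [(_ + q)%N]addnC; zmodule.
Qed.

Lemma tau_mu_iter n F r x : len n x -> (r + ar F <= n)%N ->
  op muc r (op F r.+1 (iter r tau x)) = iter r tau (cap F x).
Proof.
move=> lx; elim: r => [|r IH] le //; rewrite [RHS]iterS -IH; last exact: ltnW.
have lw : len (n.+1 - ar F) (op F r.+1 (iter r tau x)).
  by apply: (@len_op _ _ n) => //; [exact: len_itau | lia].
rewrite (tau_op (F := muc) lw) /=; last lia.
by rewrite (tau_op (len_itau r lx)) //; lia.
Qed.

Lemma capsumE n F q x : len n x -> (q + ar F <= n.+1)%N -> capsum F q x = cycsum q (cap F x).
Proof.
move=> lx; elim: q => [|q IH] //= le.
by rewrite IH 1?ltnW // (tau_mu_iter lx).
Qed.

Lemma capsum_out n F q r x : len n x -> (n < q + ar F)%N -> capsum F (q + r) x = capsum F q x.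
Proof.
move=> lx le; elim: r => [|r IH]; rewrite ?addn0 // addnS /= IH.
by rewrite (op_out (len_itau _ lx)) ?op0 ?addr0 //; lia.
Qed.

Lemma kap_out n F q r x : len n x -> (n < q + ar F)%N -> kap F (q + r) x = kap F q x.
Proof.
move=> lx le; elim: r => [|r IH]; rewrite ?addn0 // addnS /= IH.
by rewrite (rho_lout (len_itau _ lx)) ?addr0 //; lia.
Qed.

(* [(-1)^|F| L_F]. *)
Definition lie F x : TT := rho F 1 x + op F 0 (cycsum (ar F) x).

(** The first line is [connesq] with [kap] in place of the norm. The second accounts for [op F 0] of
    the norm, by which [lie F x] differs from [kap] minus its rotation. *)
Definition cartan_homotopy n F x : TT :=
  op onec 0 (kap F n.+1 x) - tau (op onec 0 (kap F n.+1 x))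
  + sn (pa F) (op F 0 (op onec 0 (cycsum n.+1 x))).

(** The boundary of [(1 - tau) s kap] is [(1 - tau)] of [kap - s b' kap], and on a cycle [b' kap] is
    the norm of [cap F x]; this produces the term [B i_F]. The term [i_F B] arises from [bd_op0],
    applied to [s N x]. *)
Lemma cartan_cycle n F x : len n x -> dclosed F -> bd x = 0 ->
  lie F x = (if (ar F <= n)%N then connesq (n - ar F) (cap F x) else 0)
    + sn (pa F) (cap F (connesq n x)) + bd (cartan_homotopy n F x).
Proof.
move=> lx cF dx; have lN := len_cycsum n.+1 lx; have ls := len_one lN.
have EN : op F 0 (cycsum n.+1 x) = sn (pa F) (cap F (connesq n x))
   + sn (pa F) (bd (op F 0 (op onec 0 (cycsum n.+1 x)))).
  rewrite (bd_op0 ls) // (rho_one lN) (norm_full lx) dx cycsum0 op0 subr0.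
  rewrite -/(connesq n x); by koszul.
have [lt|le] := ltnP n.+1 (ar F).
  have K0 : kap F n.+1 x = 0.
    elim: n.+1 => //= q ->; rewrite (rho_lout (len_itau _ lx)) ?addr0 //; lia.
  rewrite /lie /cartan_homotopy K0 op0 tau0 subrr add0r bdsn.
  rewrite (rho_lout lx) ?(@op_out _ _ n F 0 _ (len_cycsum _ lx)) ?add0n ?addr0 //; last lia.
  have -> : (ar F <= n)%N = false by lia.
  by rewrite add0r -EN (op_out lN).
(* [m] is the degree of [lie F x]; the summands of [kap] from index [m] on leave no room for [F]. *)
pose m := (n.+1 - ar F)%N; have Em : (m + ar F)%N = n.+1 by rewrite /m; lia.
have lK := len_kap n.+1 lx Em.
have EK : kap F n.+1 x = kap F m x.
  by have := @kap_out n F m (ar F) x lx; rewrite Em; apply; lia.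
have EL : lie F x = kap F n.+1 x - tau (kap F n.+1 x) + op F 0 (cycsum n.+1 x).
  rewrite EK (kap_tau lx Em) // (rho_lout (len_itau _ lx)) ?addSn ?Em // /lie.
  by rewrite -[in cycsum n.+1 x]Em [(m + _)%N]addnC cycsum_add opD; zmodule.
have EM : rho muc 0 (kap F n.+1 x) = if (ar F <= n)%N then cycsum (n - ar F).+1 (cap F x) else 0.
  rewrite (mu_kap _ lx cF) dx kap0 (tau_order lx) -[X in rho _ _ (_ - X)]subr0.
  have -> : rho F n.+1 (rho muc 0 x - (rho muc n.+1 x - 0)) = 0.
    rewrite subr0 (@rho_lout _ _ n muc n.+1 x lx) ?subr0 /= ?addn2 //.
    case: n lx {m lN ls EN le Em lK EK EL dx} => [|n] lx; first by rewrite rho_mu_len0 // rho0.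
    by apply: (@rho_lout _ _ n); [apply: (@len_rho _ _ n.+1 n muc); rewrite /= ?addn2 | lia].
  rewrite subrr sn0 add0r; case: ifP => h.
    rewrite -(capsumE lx (q := (n - ar F).+1)); last lia.
    have -> : n.+1 = ((n - ar F).+1 + ar F)%N by lia.
    by rewrite (capsum_out _ lx) //; lia.
  have := @capsum_out n F 0 n.+1 x lx; rewrite add0n => -> //; lia.
have Eb : rho muc 0 (op onec 0 (kap F n.+1 x)) = kap F n.+1 x - op onec 0 (rho muc 0 (kap F n.+1 x)).
  exact: rho_one lK.
rewrite EL EN /cartan_homotopy bdD (bd_tau (len_one lK)) bdsn Eb EM.
case: ifP => h; last by rewrite op0 subr0; zmodule.
by rewrite tauD tauN /connesq; zmodule.
Qed.
End Cartan.

(** * The homotopy for [i_[f, g]] *)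

Section CapBracket.
Variables (k : comNzRingType) (A : regUnitalHomAss k).
Local Notation coch := (@coch k A).
Local Notation TT := (@ttensor k A).
Local Notation muc := (muc A).
Local Notation tau := (@tau k A).
Implicit Types (F G H : coch) (x y : TT).

Lemma mu_op_out n F x : len n x -> (n < ar F)%N -> op muc 0 (op F 0 x) = 0.
Proof.
move=> lx; rewrite leq_eqVlt => /orP[/eqP E|lt].
  by apply: (@op_out _ _ 0 muc 0) => //; apply: (len_op _ lx); rewrite add0n E.
by rewrite (op_out lx) ?op0.
Qed.

Lemma op_mu_out n G i a x : len n x -> (n < i + ar G)%N -> op G i (rho muc a x) = 0.
Proof.
case: n => [|n] lx lt; first by rewrite rho_mu_len0 // op0.
by apply: (@op_out _ _ n) => //; apply: (@len_rho _ _ n.+1 n muc); rewrite /= ?addn2.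
Qed.

Lemma rho_mu_out n G i a x : len n x -> (n < i + ar G)%N -> rho G i (rho muc a x) = 0.
Proof.
case: n => [|n] lx lt; first by rewrite rho_mu_len0 // rho0.
by apply: (@rho_lout _ _ n) => //; apply: (@len_rho _ _ n.+1 n muc); rewrite /= ?addn2.
Qed.

(** [mu_rho1c] covers all products but the cyclic one. Rotating [rho F 1] for the latter makes one
    insertion wrap around, which is the last term. *)
Lemma bd_rho1 n F z : len n z -> dclosed F ->
  bd (rho F 1 z) = sn (pa F) (rho F 1 (bd z)) + cap F z
    + op muc 0 (op F 0 (iter (ar F) tau z)).
Proof.
move=> lz cF; rewrite /bd mu_rho1c // (rhoD F).
have -> : op muc 0 (tau (rho F 1 z)) = sn (pa F) (rho F 1 (op muc 0 (tau z)))
    + op muc 0 (op F 0 (iter (ar F) tau z)); last by koszul.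
have [le|lt] := leqP (ar F) n.
  rewrite (tau_rho lz) ?add1n // opD (@rho_op _ _ F muc 1 0 2) //.
  by koszul.
rewrite (rho_lout lz) ?add1n // tau0 op0 (mu_op_out (len_itau _ lz)) //.
have lt' := len_tau lz.
case: n lz lt lt' => [|n] lz lt lt'.
  by rewrite (@op_out _ _ 0 muc) // rho0 sn0 addr0.
rewrite (@rho_lout _ _ n F) ?sn0 ?addr0 //; last by rewrite add1n ltnS ltnW.
by apply: (@len_op _ _ n.+1 n muc) => //=; rewrite addn2.
Qed.

Lemma itau_op n G r y : len n y -> (r + ar G <= n.+1)%N ->
  iter r tau (op G 0 y) = op G r (iter r tau y).
Proof.
move=> ly; elim: r => //= r IH le.
by rewrite IH; [rewrite (tau_op (len_itau r ly)) | exact: ltnW].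
Qed.

(** In each rotation [G] takes the leading block, which contains [a_0], and [F] acts to the right of
    [a_0]. The subtracted term removes the [F] outside [G], so what is left has [F] inside [G] and
    after [a_0]. *)
Definition cap_homotopy F G x : TT :=
  op G 0 (kap F (ar G) x) - sn (pe F G) (rho F 1 (op G 0 (cycsum (ar G) x))).

(** When the rotated blocks no longer fit and [capsumE] does not apply, too few entries remain for
    [G], and both sides are zero. *)
Lemma op_capsum n F G q x : len n x -> ar G = q ->
  op G 0 (capsum F q x) = op G 0 (cycsum q (cap F x)).
Proof.
move=> lx Eq; have [le|lt] := leqP (q + ar F) n.+1; first by rewrite (capsumE lx).
have Z r y : len n y -> op G 0 (op muc r (op F r.+1 y)) = 0.
  move=> ly; have [le|gt] := leqP (ar F) n; last first.
    by rewrite (op_out ly) ?op0 //; lia.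
  apply: (@op_out _ _ (n - ar F)); last by rewrite Eq; lia.
  apply: (@len_op _ _ (n - ar F).+1 _ muc); rewrite /= ?addn2 //.
  by apply: (len_op _ ly); lia.
have -> : op G 0 (capsum F q x) = 0.
  elim: {Eq lt} q => [|q IH] /=; first exact: op0.
  by rewrite opD IH Z ?addr0 //; exact: len_itau.
have [le|gt] := leqP (ar F) n; last by rewrite (cap_out lx) // cycsum0 op0.
rewrite (@op_out _ _ (n - ar F)) //; last by rewrite Eq; lia.
by apply: len_cycsum; apply: (len_cap lx); lia.
Qed.

(** On a cycle the telescoping in [mu_kap] and in [norm_bd] leaves the same term [seg], and [opG0]
    makes its two occurrences cancel. The remaining cap terms are regrouped by [cap_pc]. *)
Lemma cap_br_cycle n F G x : len n x -> dclosed F -> dclosed G -> bd x = 0 ->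
  bd (cap_homotopy F G x) = sn (pa G) (lie G (cap F x)) - sn (pe F G) (cap F (lie G x))
    + sn (pe F G) (cap (br F G) x).
Proof.
move=> lx cF cG dx; set p := ar F; set q := ar G; set eps := pe F G.
have lN := len_cycsum q lx.
pose seg := rho muc 0 (iter q tau x) - rho muc q (iter q tau x).
have opG0 y : op G 0 (rho F q y) = sn eps (rho F 1 (op G 0 y)).
  by rewrite (@rho_op _ _ F G 1 0 q) // snsn addbb.
have capG y : cap G (rho F q.+1 y) = sn (eps (+) pa F) (rho F 1 (cap G y)).
  by have := cap_rho G F 0 y; rewrite add0n => ->; rewrite /eps /pe andbC.
have E1 : bd (op G 0 (kap F q x)) =
    sn (pa G) (op G 0 (- sn (pa F) (rho F q seg) + cycsum q (cap F x)))
    - cap G (rho F 1 x - rho F q.+1 (iter q tau x) - op F 0 (cycsum q (iter p tau x))).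
  have lt := len_itau q lx; have lp := len_cycsum q (len_itau p lx).
  have [lt'|le] := ltnP n.+1 p.
    have r0 a y : len n y -> rho F a y = 0 by move=> ly; rewrite (rho_lout ly) // -/p; lia.
    have K0 r : kap F r x = 0.
      by elim: r => //= r ->; rewrite r0 ?addr0 //; exact: len_itau.
    have -> : rho F q seg = 0.
      by rewrite /seg rhoD rhoN !(@rho_mu_out n) ?subrr //; rewrite -/p; lia.
    rewrite K0 op0 bd0 (r0 _ _ lx) (r0 _ _ lt) (@op_out _ _ n F 0 _ lp) //.
    rewrite (cap_out lx) 1?ltnW // cycsum0.
    by rewrite ?(sn0, subrr, cap0, oppr0, addr0, op0, sub0r).
  pose m := (n.+1 - p)%N; have Em : (m + p)%N = n.+1 by rewrite /m; lia.
  have lK := len_kap q lx Em.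
  rewrite (bd_op0 lK) // (mu_kap _ lx) // dx kap0 -/seg sub0r !opD (op_capsum F lx) //.
  congr (sn _ (_ + _) - _); first by case: (pa F).
  have [qm|mq] := leqP q m; first by rewrite (kap_tau lx Em).
  rewrite !(@cap_out _ _ m) //; last by apply: lenB => //; exact: len_tau.
  by do 2?[apply: lenB]; [exact: (len_rho _ lx) | exact: (len_rho _ lt) | exact: (len_op _ lp)].
have E2 : op G 0 (rho muc 0 (cycsum q x)) = - op G 0 seg.
  have [le|lt] := leqP q n.
    have := norm_bd lx le; rewrite dx cycsum0 -addrA -/seg => /eqP.
    by rewrite addr_eq0 => /eqP ->; rewrite opN.
  rewrite /seg opD opN !(@op_mu_out n) ?subrr ?oppr0 //; exact: len_itau.
have E3 : bd (rho F 1 (op G 0 (cycsum q x))) =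
    sn (pa F) (rho F 1 (- sn (pa G) (op G 0 seg) - cap G (x - iter q tau x)))
    + cap F (op G 0 (cycsum q x))
    + sn eps (cap G (op F 0 (cycsum q (iter p tau x)))).
  have Ez : bd (op G 0 (cycsum q x)) = - sn (pa G) (op G 0 seg) - cap G (x - iter q tau x).
    by rewrite (bd_op0 lN) // E2 cycsum_tau; case: (pa G).
  have li := len_itau p lN.
  have [lt|le] := ltnP n.+1 q.
    rewrite -Ez (op_out lN) // cap0 bd0 !rho0 sn0 bd0 cycsum_itau.
    rewrite (@cap_out _ _ (n.+1 - p)) ?sn0 ?addr0 //; last by rewrite -/q; lia.
    have [pn|np] := leqP p n.+1; last by rewrite (op_out li) //; exact: len0.
    by apply: (len_op _ li); rewrite -/p; lia.
  have lz : len (n.+1 - q) (op G 0 (cycsum q x)) by apply: (len_op _ lN); rewrite -/q; lia.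
  rewrite (bd_rho1 lz) // Ez; congr (_ + _).
  rewrite cycsum_itau -/p; have [pq|qp] := leqP (p + q) n.+1.
    rewrite (itau_op lN) // /cap (@op_swap _ _ G F 1 0 p) ?add1n // opsn snsn.
    by rewrite /eps /pe andbC addbb.
  rewrite (mu_op_out (len_itau _ lz)) -/p; last lia.
  have [pn|np] := leqP p n.+1; last by rewrite (op_out li) // cap0 sn0.
  rewrite (@cap_out _ _ (n.+1 - p)) ?sn0 // -/q; last lia.
  by apply: (len_op _ li); rewrite -/p; lia.
have Ebr : cap (br F G) x = cap (pc F G) x - sn eps (cap (pc G F) x).
  by rewrite /cap op_br opD opN opsn.
rewrite /cap_homotopy bdD bdN bdsn -/q -/eps E1 E3 Ebr !cap_pc /lie -/q !capD !capN capG.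
rewrite !opD !opN !opsn opG0 !rhoD !rhoN !rhosn ?capD ?capN /eps /pe [pa G && _]andbC.
by koszul.
Qed.
End CapBracket.

(** * Normalized chains *)

Section Normalization.
Variables (k : comNzRingType) (A : regUnitalHomAss k).
Local Notation coch := (@coch k A).
Local Notation TT := (@ttensor k A).
Local Notation muc := (muc A).
Local Notation tau := (@tau k A).
Implicit Types (F G H : coch) (x y z w : TT).

Local Notation E := (op (onec A)).

(* The part of the bar differential merging the first [j + 1] entries. *)
Definition pb j x : TT := rho muc 0 x - rho muc j x.

Lemma pb0 x : pb 0 x = 0. Proof. exact: subrr. Qed.
Lemma pbS j x : pb j.+1 x = pb j x + op muc j x.
Proof. by rewrite /pb (rhoS muc j); zmodule. Qed.

(* Spanned by the chains of degree [n + 1] with a [1] in a position [1..l]. *)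
Fixpoint degs n l x : Prop :=
  if l is i.+1 then exists y z, [/\ len n y, degs n i z & x = z + E i.+1 y]
  else x = 0.

Lemma degsD n l x y : degs n l x -> degs n l y -> degs n l (x + y).
Proof.
elim: l x y => [|l IH] x y /=; first by move=> -> ->; rewrite addr0.
move=> [u [v [lu dv ->]]] [u' [v' [lu' dv' ->]]]; exists (u + u'), (v + v').
by split; [exact: lenD | exact: IH | rewrite opD addrACA].
Qed.

Lemma degs0 n l : degs n l 0.
Proof.
elim: l => [|l IH] //=; exists 0, 0; split=> //; first exact: len0.
by rewrite op0 addr0.
Qed.

Lemma degsN n l x : degs n l x -> degs n l (- x).
Proof.
elim: l x => [|l IH] x /=; first by move=> ->; rewrite oppr0.
move=> [u [v [lu dv ->]]]; exists (- u), (- v).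
by split; [exact: lenN | exact: IH | rewrite opN opprD].
Qed.

Lemma degsE n l i y : (0 < i <= l)%N -> len n y -> degs n l (E i y).
Proof.
elim: l => [|l IH] /andP[i0]; first by rewrite leqNgt i0.
rewrite leq_eqVlt => /orP[/eqP ->|lt] ly.
  by exists y, 0; split=> //; [exact: degs0 | rewrite add0r].
exists 0, (E i y); split; [exact: len0 | by apply: IH; rewrite // i0 | by rewrite op0 addr0].
Qed.

Lemma degs_ind n (P : TT -> Prop) : P 0 -> (forall x y, P x -> P y -> P (x + y)) ->
  forall l, (forall i y, (0 < i <= l)%N -> len n y -> P (E i y)) ->
  forall x, degs n l x -> P x.
Proof.
move=> P0 PD; elim=> [|l IH] PE x /=; first by move=> ->.
move=> [y [z [ly dz ->]]]; apply: PD; last by apply: PE; rewrite ?leqnn.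
by apply: IH dz => i w /andP[i0 il]; apply: PE; rewrite i0 ltnW.
Qed.

Lemma EE i j y : (i < j.+1)%N -> E j.+1 (E i y) = - E i (E j y).
Proof. by move=> lt; rewrite (@op_swap _ _ _ _ j.+1 i j) ?addn0. Qed.

Lemma op_pb F j i x : (i <= j)%N -> op F j (pb i x) = sn (pa F) (pb i (op F j.+1 x)).
Proof.
move=> le; elim: i le => [|i IH] le; first by rewrite !pb0 op0 sn0.
rewrite !pbS opD IH 1?ltnW // (@op_swap _ _ F muc j i j.+1) ?addn2 // /pe pa_mu.
by case: (pa F); rewrite /sn /= ?opprD.
Qed.

Lemma E_pb i y : pb i (E i.+1 y) = - E i (pb i y).
Proof. by rewrite op_pb // opprK. Qed.

Lemma rho_E i j y : (i <= j)%N -> rho muc j.+1 (E i y) = - E i (rho muc j y).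
Proof. by move=> le; rewrite (@rho_op _ _ muc (onec A) j.+1 i j) ?addn0. Qed.

Lemma mu_E_r n i y : len n y -> (i <= n)%N -> op muc i (E i.+1 y) = - y.
Proof.
move=> ly le; rewrite -[LHS]/((op muc i \o E i.+1) y) (len_ext (G := -%R \o idfun) ly) //= => s ss.
by rewrite mu_one_r // ss.
Qed.

Lemma mu_E_l n i y : len n y -> (i <= n)%N -> op muc i (E i y) = y.
Proof.
move=> ly le; rewrite -[LHS]/((op muc i \o E i) y) (len_ext (G := idfun) ly) //= => s ss.
by rewrite mu_one_l // ss.
Qed.

(** The products of the inserted 1 with its left and its right neighbour are [- y] and [y], and
    cancel. *)
Lemma mu_E n i y : len n y -> (i < n)%N ->
  rho muc 0 (E i.+1 y) = - E i (pb i y) - E i.+1 (rho muc i.+1 y).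
Proof.
move=> ly lt; have -> : rho muc 0 (E i.+1 y) = pb i (E i.+1 y) + rho muc i (E i.+1 y).
  by rewrite /pb; zmodule.
rewrite E_pb (rhoS muc i) (rhoS muc i.+1) (mu_E_r ly) 1?ltnW // (mu_E_l ly) // rho_E //.
zmodule.
Qed.

Lemma bd_E n i y : len n y -> (i < n)%N ->
  bd (E i.+1 y) = - E i.+1 (bd y) + E i.+1 (pb i.+1 y) - E i (pb i y).
Proof.
move=> ly lt; rewrite /bd (mu_E ly lt) (tau_op ly) ?addn0 //.
have -> : op muc 0 (E i.+2 (tau y)) = - E i.+1 (op muc 0 (tau y)).
  by rewrite (@op_swap _ _ (onec A) muc i.+1 0 i.+2) ?addn2 // opprK.
rewrite /pb !opD !opN; zmodule.
Qed.

(** Here the right neighbour of the 1 is [a_0], across the cyclic product of [bd]; the cancellation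
    of [mu_E] takes place through the rotation. *)
Lemma bd_E_last n y : len n y -> bd (E n.+1 y) = - E n (pb n y).
Proof.
move=> ly; have -> : bd (E n.+1 y) = pb n (E n.+1 y) + rho muc n (E n.+1 y) + op muc 0 (tau (E n.+1 y)).
  by rewrite /bd /pb; zmodule.
have lE : len n.+1 (E n.+1 y) by apply: (@len_op _ _ n n.+1 (onec A) n.+1 y ly); rewrite addn0.
rewrite E_pb (rhoS muc n) (mu_E_r ly) // (rho_lout lE) ?(tau_op_last ly) ?addn0 //=.
  by rewrite (mu_E_l ly) //; zmodule.
by rewrite addn2.
Qed.

Lemma len_pb n i y : len n.+1 y -> len n (pb i y).
Proof.
by move=> ly; apply: lenB; apply: (@len_rho _ _ n.+1 n muc) => //=; rewrite addn2.
Qed.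

Lemma len_E n i y : len n y -> len n.+1 (E i y).
Proof. by move=> ly; apply: (@len_op _ _ n n.+1 (onec A) i y ly); rewrite addn0. Qed.

Lemma bd_degs n x : degs n.+1 n.+2 x -> degs n n.+1 (bd x).
Proof.
move: x; apply: degs_ind => [|x y dx dy|[|i] y /andP[//] _ le ly].
- by rewrite bd0; exact: degs0.
- by rewrite bdD; exact: degsD.
have EP j : (j <= n.+1)%N -> degs n n.+1 (E j (pb j y)).
  case: j => [|j] lj; first by rewrite pb0 op0; exact: degs0.
  by apply: degsE; rewrite ?lj //; exact: len_pb.
move: le; rewrite ltnS leq_eqVlt => /orP[/eqP ->|lt].
  by rewrite bd_E_last //; apply: degsN; exact: EP.
rewrite (bd_E ly) //; apply: degsD; last by apply: degsN; apply: EP; exact: ltnW.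
apply: degsD; last exact: EP.
by apply: degsN; apply: degsE; [exact: lt | exact: len_bd].
Qed.

Lemma bd_degs0 x : degs 0 1 x -> bd x = 0.
Proof.
move: x; apply: degs_ind => [|x y dx dy|[|[|i]] y // _ ly].
- exact: bd0.
- by rewrite bdD dx dy addr0.
by rewrite bd_E_last // pb0 op0 oppr0.
Qed.

Fixpoint hsum j w : TT := if j is i.+1 then hsum i w + E i.+1 w else 0.

Lemma hsum0 j : hsum j 0 = 0.
Proof. by elim: j => //= j ->; rewrite op0 addr0. Qed.

Lemma len_hsum n j w : len n w -> len n.+1 (hsum j w).
Proof. by move=> lw; elim: j => [|j IH] /=; [exact: len0 | apply: lenD => //; exact: len_E]. Qed.

Lemma bd_hsum n j w : len n w -> (j <= n)%N ->
  bd (hsum j w) = - hsum j (bd w) + E j (pb j w).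
Proof.
move=> lw; elim: j => [|j IH] le /=; first by rewrite bd0 pb0 op0 oppr0 addr0.
by rewrite bdD IH 1?ltnW // (bd_E lw le); zmodule.
Qed.

(* [1 + bd h + h bd], for [h] the insertion of [1] at the positions [1..j],
   is homotopic to the identity and lowers the last position of a [1]. *)
Lemma degs_lower n j x : (j <= n)%N -> degs n j.+1 x -> degs n j (x + E j.+1 (pb j.+1 x)).
Proof.
have pbD i y z : pb i (y + z) = pb i y + pb i z by rewrite /pb !rhoD; zmodule.
move=> le /= [y [z [ly dz ->]]].
rewrite pbD opD addrACA; apply: degsD.
  apply: degsD => //; move: z dz; apply: degs_ind.
  - by rewrite /pb !rho0 subrr op0; exact: degs0.
  - by move=> u v du dv; rewrite pbD opD; exact: degsD.
  move=> [|i] w // /andP[_ il] lw.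
  have -> : pb j.+1 (E i.+1 w) = - E i (pb i w) - E i.+1 (rho muc i.+1 w) + E i.+1 (rho muc j w).
    by rewrite /pb (mu_E lw) ?(rho_E w il) /pb; [zmodule | lia].
  case: n le lw {ly} => [|n] le lw; first lia.
  have lr a : len n (rho muc a w) by apply: (@len_rho _ _ n.+1 n muc); rewrite /= ?addn2.
  rewrite (opD _ _ (_ - _)) (opD _ _ (- _)) !opN (@EE i j) 1?ltnW // !(@EE i.+1 j) //.
  rewrite !opprK.
  apply: degsD; last by apply: degsN; apply: degsE => //; exact: len_E.
  apply: degsD; last by apply: degsE => //; exact: len_E.
  case: i il => [|i] il; first by rewrite pb0 !op0; exact: degs0.
  apply: degsE; first exact: ltnW.
  by apply: len_E; exact: len_pb.
have -> : pb j.+1 (E j.+1 y) = - E j (pb j y) - y by rewrite pbS E_pb (mu_E_r ly).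
rewrite opD !opN EE // opprK.
case: j le {dz} => [|j] le; first by rewrite pb0 !op0 add0r subrr.
rewrite addrC addrNK.
case: n le ly => [|n] le ly //.
apply: degsE; rewrite ?leqnn //; apply: len_E; exact: len_pb.
Qed.

(** For a cycle, adding [bd (hsum l.+1 x)] lowers the filtration by one ([bd_hsum], [degs_lower]);
    in filtration 0 nothing is left. *)
Lemma degs_acyclic n l x : (l <= n.+1)%N -> len n.+1 x -> degs n l x -> bd x = 0 ->
  exists2 v, len n.+2 v & x = bd v.
Proof.
elim: l x => [|l IH] x le lx dx cx; first by exists 0; [exact: len0 | rewrite bd0].
have Eh := bd_hsum lx le; rewrite cx hsum0 oppr0 add0r in Eh.
have lh := len_hsum l.+1 lx.
have [||||v lv Ev] := IH (x + bd (hsum l.+1 x)).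
- exact: ltnW.
- by apply: lenD => //; exact: len_bd.
- by rewrite Eh; apply: degs_lower.
- by rewrite bdD cx (bd_bd lh) addr0.
exists (v - hsum l.+1 x); first exact: lenB.
by rewrite bdD bdN -Ev addrK.
Qed.

Lemma E0_degs n y : degs n n.+1 y -> degs n.+1 n.+2 (E 0 y).
Proof.
move: y; apply: degs_ind => [|x y dx dy|i y /andP[i0 le] ly].
- by rewrite op0; exact: degs0.
- by rewrite opD; exact: degsD.
have -> : E 0 (E i y) = - E i.+1 (E 0 y) by rewrite EE // opprK.
by apply: degsN; apply: degsE => //; exact: len_E.
Qed.

Lemma E0_tau_degs n r x : degs n n.+1 x -> degs n.+1 n.+2 (E 0 (iter r tau x)).
Proof.
pose Q w := exists y z, [/\ len n y, degs n n.+1 z & w = E 0 y + z].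
have QD w y : Q w -> Q y -> Q (w + y).
  move=> [u [v [lu dv ->]]] [u' [v' [lu' dv' ->]]]; exists (u + u'), (v + v').
  by split; [exact: lenD | exact: degsD | rewrite opD addrACA].
have Qd y : degs n n.+1 y -> Q y.
  by move=> dy; exists 0, y; split=> //; [exact: len0 | rewrite op0 add0r].
have QE i y : (i <= n.+1)%N -> len n y -> Q (E i y).
  case: i => [|i] le ly; last by apply: Qd; exact: degsE.
  by exists y, 0; split=> //; [exact: degs0 | rewrite addr0].
have Qt y : Q y -> Q (tau y).
  move=> [u [v [lu dv ->]]]; rewrite tauD; apply: (QD).
    by rewrite (tau_op lu) //; apply: QE => //; exact: len_tau.
  move: v dv; apply: degs_ind => [|y1 y2 q1 q2|i w /andP[_ le] lw].
  - by rewrite tau0; apply: Qd; exact: degs0.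
  - by rewrite tauD; exact: QD.
  move: le; rewrite leq_eqVlt => /orP[/eqP ->|lt].
    by rewrite (tau_op_last lw) ?addn0 //; exact: QE.
  by rewrite (tau_op lw) ?addn0 //; apply: QE => //; exact: len_tau.
move=> /Qd; have: Q x -> Q (iter r tau x) by elim: r => //= r IH /IH; exact: Qt.
move=> H /H [u [v [lu dv ->]]]; rewrite opD; apply: degsD; last exact: E0_degs.
have -> : E 0 (E 0 u) = - E 1 (E 0 u) by rewrite EE // opprK.
by apply: degsN; apply: degsE => //; exact: len_E.
Qed.

Lemma E0_cycsum_degs n q x : degs n n.+1 x -> degs n.+1 n.+2 (E 0 (cycsum q x)).
Proof.
move=> dx; elim: q => [|q IH]; rewrite [cycsum _ _]/=; first by rewrite op0; exact: degs0.
by rewrite opD; apply: degsD => //; exact: E0_tau_degs.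
Qed.

Lemma tau_E0_degs n y : len n y -> degs n n.+1 (tau (E 0 y)).
Proof. by move=> ly; rewrite (tau_op ly) //; apply: degsE => //; exact: len_tau. Qed.
End Normalization.

(** * Comparison of the given chain operations with the signed operators *)

Section Bridge.
Variables (k : comNzRingType) (A : regUnitalHomAss k).
Local Notation coch := (@coch k A).
Local Notation TT := (@ttensor k A).
Local Notation muc := (muc A).
Local Notation tau := (@tau k A).
Implicit Types (F G H : coch) (X : TT).

Definition tolen n : TT -> chain A n := ttlift (@elem k A n).
HB.instance Definition _ n := GRing.Linear.copy (tolen n) (ttlift (@elem k A n)).

Lemma elem_mlin n : mlin (@elem k A n).
Proof.
move=> s1 s2 a x y; have [E|E] := eqVneq (size s1 + size s2).+1 n.+1.
  exact: tens_multilinear.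
have Z z : elem n (s1 ++ z :: s2) = 0.
  rewrite /elem /tens /free_tens insubN ?linear0 // size_cat /= addnS.
  exact: E.
by rewrite !Z scaler0 addr0.
Qed.

Lemma ttofK n : cancel (@ttof k A n) (tolen n).
Proof.
move=> c; rewrite -[RHS]/(idfun c) -[LHS]/((tolen n \o @ttof k A n) c).
apply: tpower_ext => s ss /=; rewrite -/(elem n s) ttofE // /tolen ttliftE //.
exact: elem_mlin.
Qed.

Lemma tolenK n X : len n X -> ttof (tolen n X) = X.
Proof. by move=> [c ->]; rewrite ttofK. Qed.

Lemma len_ttof n (c : chain A n) : len n (ttof c). Proof. by exists c. Qed.

Lemma ttof_bullet n m F i (c : chain A n) : (i + ar F <= n.+1)%N -> (m + ar F)%N = n.+1 ->
  ttof (bullet m (ar F) F i c) = sn (pa F && odd i) (op F i (ttof c)).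
Proof.
move=> le E; rewrite -opsn; set b := _ && _.
have L : linear (fun c : chain A n => op F i (sn b (ttof c))).
  by move=> a x y; rewrite linearP sn_linear linearP.
pose G : {linear chain A n -> TT} := HB.pack (fun c : chain A n => op F i (sn b (ttof c)))
  (GRing.isLinear.Build k (chain A n) TT *:%R _ L).
rewrite -[RHS]/(G c) -[LHS]/((@ttof k A m \o bullet m (ar F) F i) c).
apply: tpower_ext => s ss /=; rewrite -/(elem n s) bulletE ?cochP // !ttofE //; last first.
  by rewrite size_insert ss //; lia.
by rewrite opsn /op YE ?cochP // ss le snsn addbb.
Qed.

Lemma ttof_rotate n (c : chain A n) : ttof (rotate c) = sn (odd n) (tau (ttof c)).
Proof.
rewrite -tausn.
have L : linear (fun c : chain A n => tau (sn (odd n) (ttof c))).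
  by move=> a x y; rewrite linearP sn_linear linearP.
pose G : {linear chain A n -> TT} := HB.pack (fun c : chain A n => tau (sn (odd n) (ttof c)))
  (GRing.isLinear.Build k (chain A n) TT *:%R _ L).
rewrite -[RHS]/(G c) -[LHS]/((@ttof k A n \o @rotate k A n) c).
apply: tpower_ext => s ss /=; rewrite -/(elem n s) rotateE // !ttofE ?size_rotr //.
by rewrite tausn tauE ss /par /= snsn negbK addbb.
Qed.

Lemma ttof_iter_rotate n r (c : chain A n) :
  ttof (iter r (@rotate k A n) c) = sn (odd r && odd n) (iter r tau (ttof c)).
Proof.
elim: r => [|r IH] //=; rewrite ttof_rotate IH tausn snsn.
by congr sn; do 2!case: odd.
Qed.

Lemma sn_sum (V : zmodType) (b : bool) (r : seq nat) (K : nat -> V) :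
  sn b (\sum_(j <- r) K j) = \sum_(j <- r) sn b (K j).
Proof. by case: b; rewrite /sn ?sumrN. Qed.

Lemma opD_sn (V : zmodType) b (x y : V) : sn b (x + y) = sn b x + sn b y.
Proof. by case: b; rewrite /sn ?opprD. Qed.

Lemma op_out_mu n F i j X : len n X -> (n < i + ar F)%N -> op F i (op muc j X) = 0.
Proof.
case: n => [|n] lX lt.
  by rewrite (@op_out _ _ 0 muc j X lX) ?op0 //= addn2.
by apply: (@op_out _ _ n) => //; apply: (@len_op _ _ n.+1 n muc); rewrite /= ?addn2.
Qed.

Lemma ttof_sg n (z : int) (c : chain A n) : ttof (sg z *: c) = sn (odd `|z|) (ttof c).
Proof. by rewrite sgZ; case: (odd _) => //; rewrite /sn linearN. Qed.

Lemma ttof_boundary n (c : chain A n) : ttof (boundary c) = bd (ttof c).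
Proof.
case: n c => [|n] c.
  by rewrite (bd_len0 (len_ttof c)) /boundary /= linear0.
rewrite /boundary /= linearD /= ttof_sg linear_sum /bd; congr (_ + _); last first.
  rewrite (ttof_bullet (F := muc)) ?ttof_rotate ?opsn ?snsn /= ?addn2 //.
  by rewrite /sn /=; case: odd.
have -> : rho muc 0 (ttof c) = rho muc 0 (ttof c) - rho muc (0 + n.+1) (ttof c).
  rewrite (@rho_lout _ _ n.+1 muc (0 + n.+1) _ (len_ttof c)) ?subr0 //=; lia.
rewrite -rho_sum /index_iota subn0 big_seq [RHS]big_seq; apply: eq_bigr => i.
rewrite mem_iota => /andP[_ lt] /=; rewrite ttof_sg (ttof_bullet (F := muc)) /= ?addn2 //.
by rewrite snsn addbb.
Qed.

Lemma ttof_contract n m F (c : chain A n) : (m + ar F)%N = n ->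
  ttof (contract m (ar F) F c) = sn (pa F) (cap F (ttof c)).
Proof.
move=> E; rewrite /contract (_ : (ar F <= n)%N); last by rewrite -E leq_addl.
have C : circ (ar F) (@mu k A) 2 F \in @cochain k A (ar F).+1.
  by apply: (@circ_cochain _ _ 2 _ 1) (cochP F) => //; exact: mu_cochain.
rewrite (ttof_bullet (F := Coch C)) /=; [|lia|lia].
rewrite andbF /cap; have := @Ycirc k A 2 (ar F) _ _ 1 0 (ttof c) (mu_cochain A) (cochP F) isT.
rewrite /op /= add0n => ->; rewrite (Ysnf _ _ _ C) andbT.
by rewrite /sn /pa; case: par; rewrite ?opprK.
Qed.

(** For arity [n + 1] no insertion to the right of [a_0] fits, so [rho F 1] vanishes and the
    separate formula for that case agrees with [lie]. *)
Lemma ttof_lie_der n m F (c : chain A n) : (m + ar F)%N = n.+1 ->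
  ttof (lie_der m (ar F) F c) = sn (pa F) (lie F (ttof c)).
Proof.
move=> E.
have par_absz : odd `|(ar F)%:Z - 1| = pa F := int_par _.
pose ex (i : nat) : int := n%:Z * (i%:Z - 1) + (ar F)%:Z - 1.
have Eex r : odd `|ex r.+1| = (odd n && odd r) (+) pa F.
  by rewrite -par_absz -oddM /ex; lia.
have term r : (ar F <= n.+1)%N -> ttof (bullet m (ar F) F 0 (iter r (@rotate k A n) c)) =
    sn (odd n && odd r) (op F 0 (iter r tau (ttof c))).
  by move=> le; rewrite ttof_bullet // andbF ttof_iter_rotate opsn andbC.
have le : (ar F <= n.+1)%N by rewrite -E leq_addl.
have E2 p : \sum_(1 <= i < p.+1) sn (odd `|ex i|)
   (ttof (bullet m (ar F) F 0 (iter i.-1 (@rotate k A n) c))) =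
   sn (pa F) (op F 0 (cycsum p (ttof c))).
  elim: p => [|p IH]; first by rewrite big_geq //= op0 sn0.
  rewrite big_nat_recr //= IH opD term // snsn Eex addbAC addbb.
  by case: (pa F); rewrite /sn /= ?opprD.
rewrite /lie_der /lie; case: ltnP => lt.
  rewrite linearD !linear_sum /= -/ex; under eq_bigr do rewrite ttof_sg.
  under [X in _ + X]eq_bigr do rewrite ttof_sg -/(ex _).
  rewrite E2 opD_sn; congr (_ + _).
  have -> : rho F 1 (ttof c) = rho F 1 (ttof c) - rho F (1 + (n - ar F).+1) (ttof c).
    by rewrite (@rho_lout _ _ n F (1 + _) _ (len_ttof c)) ?subr0 //; lia.
  rewrite -rho_sum sn_sum /index_iota subSS subn0 big_seq [RHS]big_seq.
  apply: eq_bigr => -[|i]; rewrite mem_iota // => /andP[_ li].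
  rewrite ttof_bullet ?snsn //; last lia.
  congr sn; rewrite odd_mulz int_par -/(pa F).
  have -> : odd `|i.+1%:Z - 1| = odd i by lia.
  by rewrite /=; case: (pa F); case: odd.
have EF : ar F = n.+1 by apply/eqP; rewrite eqn_leq lt le.
have -> : (ar F == n.+1) = true by rewrite EF eqxx.
rewrite ttof_sg par_absz linear_sum /= (@rho_lout _ _ n F 1 _ (len_ttof c)) ?add0r; last by rewrite EF.
have E3 r : \sum_(0 <= i < r) ttof (sg (i%:Z * n%:Z) *: bullet m (ar F) F 0 (iter i (@rotate k A n) c))
    = op F 0 (cycsum r (ttof c)).
  elim: r => [|r IH]; first by rewrite big_geq //= op0.
  rewrite big_nat_recr //= IH // opD; congr (_ + _).
  by rewrite ttof_sg term // snsn odd_mulz /= andbC addbb.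
by rewrite E3 EF.
Qed.

Lemma bd_cap n F X : len n X ->
  bd (cap F X) = - cap (dl F) X - sn (pa F) (cap F (bd X)).
Proof.
move=> lX; rewrite {1}/bd mu_cap.
have -> : cap F (bd X) = cap F (rho muc 0 X) + cap F (op muc 0 (tau X)) by rewrite -capD.
suff -> : op muc 0 (tau (cap F X)) = - sn (pa F) (cap F (op muc 0 (tau X))).
  by case: (pa F); rewrite /sn /= ?capN; zmodule.
have lt := len_tau lX.
have [le|gt] := ltnP (ar F) n; last first.
  have -> : cap F (op muc 0 (tau X)) = 0.
    by rewrite /cap (op_out_mu _ lt) ?op0.
  rewrite sn0 oppr0; move: gt; rewrite leq_eqVlt => /orP[/eqP E|gt].
    by apply: (@op_out _ _ 0 muc) => //; apply: len_tau; apply: (len_cap lX); rewrite E.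
  by rewrite (cap_out lX) // tau0 op0.
have lw : len (n - ar F).+1 (op F 1 X) by apply: (len_op _ lX); lia.
rewrite {1}/cap (tau_op (F := muc) lw) /= ?add0n; last lia.
rewrite (tau_op lX) ?add1n // mu_assoc /cap (@op_swap _ _ F muc 1 0 2) // /pe pa_mu.
by case: (pa F); rewrite /sn /= ?opN ?opprK.
Qed.
End Bridge.

Section NormalizedChains.
Variables (k : comNzRingType) (A : regUnitalHomAss k).
Local Notation coch := (@coch k A).
Local Notation TT := (@ttensor k A).
Local Notation tau := (@tau k A).
Local Notation E := (op (onec A)).
Implicit Types (X : TT).

Lemma ttof_connes n (c : chain A n) : ttof (connes c) =
  E 0 (cycsum n.+1 (ttof c)) - sn (odd n.+1) (tau (E 0 (cycsum n.+1 (ttof c)))).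
Proof.
have term r : ttof (rotate (bullet n.+1 0 (const_cochain (Defs.one A)) n.+1
    (iter r (@rotate k A n) c))) = sn (odd r && odd n) (E 0 (iter r tau (ttof c))).
  rewrite ttof_rotate (ttof_bullet (F := onec A)) /= ?addn0 // ttof_iter_rotate.
  rewrite !opsn !tausn (tau_op_last (n := n)) ?addn0 //; last exact: len_itau (len_ttof c).
  by rewrite /= !snsn; congr sn; rewrite /pa /par; do 2!case: odd.
have H q : ttof (\sum_(0 <= i < q) sg (i%:Z * n%:Z) *:
    (let y := rotate (bullet n.+1 0 (const_cochain (Defs.one A)) n.+1
                        (iter i (@rotate k A n) c)) in y - rotate y)) =
    E 0 (cycsum q (ttof c)) - sn (odd n.+1) (tau (E 0 (cycsum q (ttof c)))).
  elim: q => [|q IH]; first by rewrite big_geq // linear0 /= op0 tau0 sn0 subr0.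
  rewrite big_nat_recr //= linearD /= IH ttof_sg odd_mulz /= linearB /= [ttof (rotate (rotate _))]ttof_rotate !term.
  rewrite opD tauD tausn [odd n.+1]/=; case: (odd n); case: (odd q); rewrite /sn /= ?opprK; zmodule.
exact: H.
Qed.

Definition Dn n X : Prop := if n is m.+1 then degs m n X else X = 0.

Lemma degsZ n l a X : degs n l X -> degs n l (a *: X).
Proof.
elim: l X => [|l IH] X /=; first by move=> ->; rewrite scaler0.
move=> [u [v [lu dv ->]]]; exists (a *: u), (a *: v); split; last by rewrite linearZ scalerDr.
  by have := len_linear a lu (len0 A n); rewrite addr0.
exact: IH.
Qed.

Lemma DnD n X Z : Dn n X -> Dn n Z -> Dn n (X + Z).
Proof. by case: n => [|n]; [move=> /= -> ->; rewrite addr0 | exact: degsD]. Qed.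
Lemma DnN n X : Dn n X -> Dn n (- X).
Proof. by case: n => [|n]; [move=> /= ->; rewrite oppr0 | exact: degsN]. Qed.
Lemma DnB n X Z : Dn n X -> Dn n Z -> Dn n (X - Z).
Proof. by move=> dx dz; apply: DnD => //; apply: DnN. Qed.

Lemma spanned_ind (V : lmodType k) (P Q : V -> Prop) : Q 0 ->
  (forall a x y, Q x -> Q y -> Q (a *: x + y)) -> (forall x, P x -> Q x) ->
  forall x, x \in spanned P -> Q x.
Proof.
move=> Q0 QD QP x /asboolP[s [Ps ->]]; elim: s Ps => [|[a y] s IH] Ps.
  by rewrite big_nil.
rewrite big_cons; apply: QD; first by apply: QP; apply: (Ps (a, y)); rewrite inE eqxx.
by apply: IH => c cs; apply: Ps; rewrite inE cs orbT.
Qed.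

Lemma degenerate_Dn n (u : chain A n) :
  u \in spanned (@degenerate k A n) -> Dn n (ttof u).
Proof.
move: u; apply: spanned_ind => [|a x y dx dy|u [s [ss os ->]] {u}].
- by rewrite linear0; case: n => [|n] //; exact: (@degs0 _ _ n n.+1).
- rewrite linearP; case: n x y dx dy => [|n] x y /=; first by move=> -> ->; rewrite scaler0 addr0.
  by move=> dx dy; apply: (@degsD _ _ n n.+1) => //; apply: (@degsZ n n.+1).
case: s ss os => [|a s] //= ss os; move: ss; case/path.splitPr: s / os => s1 s2 ss.
rewrite ttofE //; case: n ss => [|n] [ss]; first by move: ss; rewrite size_cat addnS.
rewrite size_cat /= addnS in ss; have n_eq : (size s1 + size s2)%N = n by case: ss.
(* Inserting 1 applies [alpha^-1] to the other entries, so these are twisted by [alpha]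
   beforehand. *)
pose w := map (twist A) ((a :: s1) ++ s2).
have sw : size w = n.+1 by rewrite /w size_map size_cat /= -n_eq.
have -> : tt (a :: s1 ++ Defs.one A :: s2) = sn (odd (size s1).+1) (E (size s1).+1 (tt w)).
  rewrite /op YE ?cochP // sw snsn /= addn0.
  have -> : ((size s1).+1 <= n.+1)%N by rewrite ltnS -n_eq leq_addr.
  rewrite /w map_cat (@insert_cat k A 0 _ (size s1).+1 _ [::]) ?size_map //.
  by rewrite !mapK ?addbb //; exact: twistK.
case: odd; rewrite /sn; [apply: degsN|]; (apply: degsE; [by apply/andP; split=> //; rewrite ltnS -n_eq leq_addr | by apply: len_tt; rewrite sw]).
Qed.

Lemma Dn_degenerate n X : Dn n X -> tolen n X \in spanned (@degenerate k A n).
Proof.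
case: n => [|n] /=; first by move=> ->; rewrite linear0 rpred0.
move=> dX; have {dX}: degs n n.+1 X := dX; move: X; apply: degs_ind => [|x y dx dy|i y /andP[i0 le] ly].
- by rewrite linear0 rpred0.
- by rewrite linearD rpredD.
move: y ly; apply: len_ind => [|a x y dx dy|s ss].
- by rewrite op0 linear0 rpred0.
- by rewrite linearP linearP rpredD // rpredZ.
rewrite /op YE ?cochP // ss /= addn0 (leq_trans le) //.
have -> (b : bool) x : tolen n.+1 (sn b x) = sn b (tolen n.+1 x).
  by case: b; rewrite /sn ?linearN.
rewrite /tolen ttliftE; last exact: elem_mlin.
have D : elem n.+1 (insert 0 (const_cochain (Defs.one A)) i s) \in spanned (@degenerate k A n.+1).
  apply: spannedP; exists (insert 0 (const_cochain (Defs.one A)) i s); split=> //.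
    by rewrite size_insert ss ?addn0 ?subn0.
  have [|s1 [s2 [s3 [-> s1i /size0nil ->]]]] := @split3 k A i 0 s; first by rewrite addn0 ss.
  rewrite insert_cat //; case: s1 s1i => [|a s1] s1i; first by rewrite -s1i in i0.
  by rewrite /= mem_cat inE eqxx orbT.
by rewrite /sn; case: ifP => _; rewrite ?rpredN.
Qed.

Lemma normalizeP n (u v : chain A n) : normalize u = normalize v <-> Dn n (ttof u - ttof v).
Proof.
rewrite /normalize qprojP -linearB; split; first exact: degenerate_Dn.
by move=> /Dn_degenerate; rewrite ttofK.
Qed.

Lemma bd_Dn n X : Dn n.+1 X -> Dn n (bd X).
Proof. by case: n => [|n]; [exact: bd_degs0 | exact: bd_degs]. Qed.

Lemma Dn_acyclic n X : len n X -> Dn n X -> bd X = 0 -> exists2 v, len n.+1 v & X = bd v.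
Proof.
case: n => [|n] lX; first by move=> /= -> _; exists 0; [exact: len0 | rewrite bd0].
exact: degs_acyclic.
Qed.

(** Only the sign of the rotated term can differ, and there the rotation has moved the inserted 1
    from position 0 to position 1. *)
Lemma connes_Dn n (c : chain A n) : Dn n.+1 (ttof (connes c) - connesq n (ttof c)).
Proof.
rewrite ttof_connes /connesq.
have D := tau_E0_degs (len_cycsum n.+1 (len_ttof c)).
have -> : forall a b d : TT, a - b - (a - d) = d - b by move=> a b d; zmodule.
by apply: (@degsD _ _ n n.+1); [exact: D | apply: degsN; case: (odd n.+1) => //; apply: degsN].
Qed.

Lemma connesq_Dn n X : len n X -> Dn n X -> Dn n.+1 (connesq n X).
Proof.
move=> lX dX; have D := tau_E0_degs (len_cycsum n.+1 lX).
apply: (@degsD _ _ n n.+1); last exact: degsN.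
case: n lX dX D => [|n] lX dX D; first by rewrite dX cycsum0 op0; exact: degs0.
exact: E0_cycsum_degs.
Qed.

Lemma connesqD n : {morph @connesq k A n : x y / x + y}.
Proof. by move=> x y; rewrite /connesq cycsumD opD tauD; zmodule. Qed.
Lemma connesqN n : {morph @connesq k A n : x / - x}.
Proof. by move=> x; rewrite /connesq cycsumN opN tauN; zmodule. Qed.
Lemma connesq0 n : @connesq k A n 0 = 0.
Proof. by rewrite /connesq cycsum0 op0 tau0 subrr. Qed.
End NormalizedChains.

(** * Passing to classes *)

Section Classes.
Variables (k : comNzRingType) (V : lmodType k) (Z : submodClosed V) (B : V -> Prop).
Hypotheses (B0 : B 0) (BD : forall a u v, B u -> B v -> B (a *: u + v)).
Local Notation H := (subquot Z B).

Definition cls (x : V) : H :=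
  if insub x is Some z then qproj _ (z : submod Z) else 0.
Definition rep (c : H) : V := val (qrepr c).

Lemma rep_in c : rep c \in Z. Proof. exact: valP. Qed.

Lemma clsE (x : V) (z : submod Z) : val z = x -> cls x = qproj _ z.
Proof. by move=> <-; rewrite /cls valK. Qed.

Lemma repK c : cls (rep c) = c.
Proof. by rewrite (clsE (z := qrepr c)) // qreprK. Qed.

Lemma cls_linear a x y : x \in Z -> y \in Z -> cls (a *: x + y) = a *: cls x + cls y.
Proof.
move=> zx zy; rewrite (clsE (x := x) (z := Submod zx)) // (clsE (x := y) (z := Submod zy)) //.
by rewrite (clsE (x := a *: x + y) (z := a *: Submod zx + Submod zy)) ?linearP.
Qed.

Lemma cls_eq x y : x \in Z -> y \in Z -> cls x = cls y <-> B (x - y).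
Proof.
move=> zx zy; rewrite (clsE (x := x) (z := Submod zx)) // (clsE (x := y) (z := Submod zy)) //.
rewrite qprojP; split=> [|b]; last by apply: spannedP; rewrite raddfB.
have: forall z : submod Z, z \in spanned (fun z : submod Z => B (val z)) -> B (val z).
  apply: spanned_ind => [|a u v bu bv|//]; first by rewrite raddf0.
  by rewrite linearP; exact: BD.
by move=> h /h; rewrite raddfB.
Qed.

Lemma representsP (c : H) x : represents c x <-> x \in Z /\ c = cls x.
Proof.
split=> [[z <- ->]|[zx ->]]; first by split; [exact: valP | rewrite (clsE (z := z))].
by exists (Submod zx) => //; exact: clsE.
Qed.

Lemma rep_cls x : x \in Z -> B (rep (cls x) - x).
Proof. by move=> zx; apply/cls_eq => //; [exact: rep_in | exact: repK]. Qed.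
End Classes.

Section GradedClasses.
Variables (k : comNzRingType) (A : regUnitalHomAss k).
Local Notation cocycle := (@cocycle k A).
Local Notation is_coboundary := (@is_coboundary k A).
Local Notation TT := (@ttensor k A).
Implicit Types (u v : seq A -> A) (X : TT) (z : int).

(* In terms of representatives: membership in the cocycles, exactness, the
   class and a choice of representative, in any integral degree. *)
Definition cin z u : Prop := if z is Posz p then u \in cocycle p else u = 0.
Definition cex z u : Prop := if z is Posz p then is_coboundary p u else True.
Definition ccls z : (seq A -> A) -> cohomology A z :=
  match z return (seq A -> A) -> cohomology A z with
  | Posz p => fun u => cls _ _ u
  | Negz _ => fun _ => 0
  end.
Definition crep z : cohomology A z -> seq A -> A :=
  match z return cohomology A z -> seq A -> A with
  | Posz p => fun c => rep c
  | Negz _ => fun _ => 0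
  end.

Lemma cin_lin z a u v : cin z u -> cin z v -> cin z (a *: u + v).
Proof.
case: z => [p|p] /=; last by move=> -> ->; rewrite scaler0 addr0.
by move=> zu zv; rewrite rpredD ?rpredZ.
Qed.

Lemma crep_in z (c : cohomology A z) : cin z (crep c).
Proof. by case: z c => [p|p] c //=; exact: rep_in. Qed.

Lemma crepK z (c : cohomology A z) : ccls z (crep c) = c.
Proof. by case: z c => [p|p] c; [exact: repK | exact: esym (thinmx0 c)]. Qed.

Lemma ccls_lin z a u v : cin z u -> cin z v ->
  ccls z (a *: u + v) = a *: ccls z u + ccls z v.
Proof. by case: z => [p|p] /=; [exact: cls_linear | rewrite scaler0 addr0]. Qed.

Lemma ccls_eq z u v : cin z u -> cin z v -> cex z (u - v) -> ccls z u = ccls z v.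
Proof.
case: z => [p|p] //= zu zv b; apply/cls_eq => //.
- exact: is_coboundary0.
- exact: is_coboundaryD.
Qed.

Lemma crep_cls z u : cin z u -> cex z (crep (ccls z u) - u).
Proof.
case: z => [p|p] //= zu; apply: rep_cls => //.
- exact: is_coboundary0.
- exact: is_coboundaryD.
Qed.

Definition hin z X : Prop := if z is Posz n then len n X /\ bd X = 0 else X = 0.
Definition hex z X : Prop := if z is Posz n then exists2 v, len n.+1 v & X = bd v else True.
Definition hcls z : TT -> homology A z :=
  match z return TT -> homology A z with
  | Posz n => fun X => cls _ _ (tolen n X)
  | Negz _ => fun _ => 0
  end.
Definition hrep z : homology A z -> TT :=
  match z return homology A z -> TT with
  | Posz n => fun c => ttof (rep c)
  | Negz _ => fun _ => 0
  end.

Lemma hin_lin z a X Y : hin z X -> hin z Y -> hin z (a *: X + Y).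
Proof.
case: z => [n|n] /=; last by move=> -> ->; rewrite scaler0 addr0.
move=> [lX dX] [lY dY]; split; first exact: len_linear.
have bdZ (b : k) Z : bd (b *: Z) = b *: bd Z by rewrite /bd !linearZ scalerDr.
by rewrite bdD bdZ dX dY scaler0 addr0.
Qed.

Lemma tolen_cycle n X : len n X -> bd X = 0 -> tolen n X \in @Defs.cycle k A n.
Proof.
move=> lX dX; apply/eqP; apply: (can_inj (@ttofK k A n.-1)).
by rewrite ttof_boundary tolenK // dX linear0.
Qed.

Lemma is_boundary0 n : @is_boundary k A n 0.
Proof. by exists 0; rewrite linear0. Qed.
Lemma is_boundaryD n a (x y : chain A n) : is_boundary x -> is_boundary y ->
  is_boundary (a *: x + y).
Proof. by move=> [u ->] [v ->]; exists (a *: u + v); rewrite linearP. Qed.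

Lemma hrep_in z (c : homology A z) : hin z (hrep c).
Proof.
case: z c => [n|n] c //=; split; first exact: len_ttof.
by rewrite -ttof_boundary (eqP (rep_in c)) linear0.
Qed.

Lemma hrepK z (c : homology A z) : hcls z (hrep c) = c.
Proof.
case: z c => [n|n] c; last exact: esym (thinmx0 c).
by rewrite /= ttofK; exact: repK.
Qed.

Lemma hcls_lin z a X Y : hin z X -> hin z Y ->
  hcls z (a *: X + Y) = a *: hcls z X + hcls z Y.
Proof.
case: z => [n|n] /=; last by rewrite scaler0 addr0.
by move=> [lX dX] [lY dY]; rewrite linearP /= cls_linear //; apply: tolen_cycle.
Qed.

Lemma hex_boundary n X : hex (Posz n) X -> is_boundary (tolen n X).
Proof.
by move=> [v [y ->] ->]; exists y; rewrite -ttof_boundary ttofK.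
Qed.

Lemma hcls_eq z X Y : hin z X -> hin z Y -> hex z (X - Y) -> hcls z X = hcls z Y.
Proof.
case: z => [n|n]; last by [].
move=> [lX dX] [lY dY] h; have b := hex_boundary h.
have E : tolen n (X - Y) = tolen n X - tolen n Y := raddfB _ _ _.
rewrite E in b; apply: (proj2 (cls_eq _ _ (tolen_cycle lX dX) (tolen_cycle lY dY))) b.
- exact: is_boundary0.
- exact: is_boundaryD.
Qed.

Lemma hrep_cls z X : hin z X -> hex z (hrep (hcls z X) - X).
Proof.
case: z => [n|n]; last by [].
move=> [lX dX]; have [||y E] := @rep_cls _ _ _ (@is_boundary k A n) _ _ (tolen n X) (tolen_cycle lX dX).
- exact: is_boundary0.
- exact: is_boundaryD.
exists (ttof y); first exact: len_ttof.
by rewrite -ttof_boundary -E linearB /= tolenK.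
Qed.
End GradedClasses.

(** * Cup product and bracket on cohomology classes *)

Section CohomologyOperations.
Variables (k : comNzRingType) (A : regUnitalHomAss k).
Local Notation cocycle := (@cocycle k A).
Local Notation is_coboundary := (@is_coboundary k A).
Local Notation HC := (cohomology A).
Implicit Types (u v w : seq A -> A) (p q r n : int).

Lemma cocycle_cochain (p : nat) u : u \in cocycle p -> u \in @cochain k A p.
Proof. by case/andP. Qed.

Lemma cin_mlin z u : cin z u -> mlin u.
Proof.
case: z => [p|p] /=; first by move/cocycle_cochain; exact: cochain_mlin.
by move=> -> s1 s2 a x y; rewrite scaler0 addr0.
Qed.

Lemma cin_cochain z u : cin z u -> u \in @cochain k A `|z|%N.
Proof. by case: z => [p|p] /=; [exact: cocycle_cochain | move=> ->; rewrite rpred0]. Qed.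

Lemma cin0 z : @cin k A z 0.
Proof. by case: z => [p|p] //=; rewrite rpred0. Qed.
Lemma cex0 z : @cex k A z 0.
Proof. by case: z => [p|p] //=; exact: is_coboundary0. Qed.
Lemma cexD z a u v : cex z u -> cex z v -> cex z (a *: u + v).
Proof. by case: z => [p|p] //=; exact: is_coboundaryD. Qed.
Lemma cexN z u : cex z u -> cex z (- u).
Proof. by move=> bu; have := cexD (-1) bu (cex0 z); rewrite scaleN1r addr0. Qed.
Lemma cex_sn z b u : cex z u -> cex z (sn b u).
Proof. by case: b => //; exact: cexN. Qed.
Lemma cinB z u v : cin z u -> cin z v -> cin z (u - v).
Proof. by move=> cu cv; have := cin_lin (-1) cv cu; rewrite scaleN1r addrC. Qed.
Lemma cinD z u v : cin z u -> cin z v -> cin z (u + v).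
Proof. by move=> cu cv; have := cin_lin 1 cu cv; rewrite scale1r. Qed.
Lemma cin_sn z b u : cin z u -> cin z (sn b u).
Proof. by case: b => //= cu; have := cinB (cin0 z) cu; rewrite sub0r. Qed.

Lemma bracket0l (p q : nat) v : mlin v -> bracket p q 0 v = 0.
Proof.
move=> mv; have := bracket_linl p q 0 0 1 mv; rewrite !scale1r addr0 => E.
by apply: (addrI (bracket p q 0 v)); rewrite -E addr0.
Qed.
Lemma bracket0r (p q : nat) u : mlin u -> bracket p q u 0 = 0.
Proof. by move=> mu; rewrite bracketC bracket0l // sn0 oppr0. Qed.
Lemma cup0l (p q : nat) v : cup p q 0 v = 0.
Proof.
have := cup_linl p q 0 0 v 1; rewrite !scale1r addr0 => E.
by apply: (addrI (cup p q 0 v)); rewrite -E addr0.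
Qed.
Lemma cup0r (p q : nat) u : u \in @cochain k A p -> cup p q u 0 = 0.
Proof.
move=> cu; have := cup_linr q 0 0 1 cu; rewrite !scale1r addr0 => E.
by apply: (addrI (cup p q u 0)); rewrite -E addr0.
Qed.
Lemma bracket00 u v : bracket 0 0 u v = 0.
Proof. by rewrite bracketE /circsum /= !big_nil /sn /= opprK addr0. Qed.

Lemma brk_in p q n u v : n = p + q - 1 -> cin p u -> cin q v ->
  cin n (bracket `|p| `|q| u v).
Proof.
case: p => [p|p] e cu cv; last by rewrite [u]cu bracket0l; [exact: cin0 | exact: cin_mlin cv].
case: q e cv => [q|q] e cv; last by rewrite [v]cv bracket0r; [exact: cin0 | exact: cin_mlin cu].
case: n e => [n|n] e; last first.
  have [-> ->] : p = 0%N /\ q = 0%N by split; lia.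
  by rewrite bracket00.
have -> : n = (p + q).-1 by lia.
exact: bracket_cocycle.
Qed.

Lemma brk_exl p q n u v : n = p + q - 1 -> cin p u -> cex p u -> cin q v ->
  cex n (bracket `|p| `|q| u v).
Proof.
case: p => [p|p] e cu bu cv; last by rewrite [u]cu bracket0l; [exact: cex0 | exact: cin_mlin cv].
case: q e cv => [q|q] e cv; last by rewrite [v]cv bracket0r; [exact: cex0 | exact: cin_mlin cu].
case: n e => [n|//] e; have -> : n = (p + q).-1 by lia.
exact: bracket_exactl.
Qed.

Lemma brk_exr p q n u v : n = p + q - 1 -> cin p u -> cin q v -> cex q v ->
  cex n (bracket `|p| `|q| u v).
Proof.
move=> e cu cv bv; rewrite bracketC; apply: cexN; apply: cex_sn.
by apply: (brk_exl _ cv bv cu); rewrite e; lia.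
Qed.

Lemma cup_in p q n u v : n = p + q -> cin p u -> cin q v -> cin n (cup `|p| `|q| u v).
Proof.
move=> -> {n}; case: p => [p|p] cu cv; last by rewrite [u]cu cup0l; exact: cin0.
case: q cv => [q|q] cv; last by rewrite [v]cv cup0r ?(cin_cochain cu) //; exact: cin0.
exact: cup_cocycle.
Qed.

Lemma cup_exl p q n u v : n = p + q -> cin p u -> cex p u -> cin q v ->
  cex n (cup `|p| `|q| u v).
Proof.
move=> -> {n}; case: p => [p|p] cu bu cv; last by rewrite [u]cu cup0l; exact: cex0.
case: q cv => [q|q] cv; last by rewrite [v]cv cup0r ?(cin_cochain cu) //; exact: cex0.
exact: cup_exactl.
Qed.

Lemma cup_exr p q n u v : n = p + q -> cin p u -> cin q v -> cex q v ->
  cex n (cup `|p| `|q| u v).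
Proof.
move=> -> {n}; case: p => [p|p] cu cv bv; last by rewrite [u]cu cup0l; exact: cex0.
case: q cv bv => [q|q] cv bv; last by rewrite [v]cv cup0r ?(cin_cochain cu) //; exact: cex0.
exact: cup_exactr.
Qed.

Definition Gcup p q n (a : HC p) (b : HC q) : HC n :=
  ccls n (cup `|p| `|q| (crep a) (crep b)).
Definition Gbrk p q n (a : HC p) (b : HC q) : HC n :=
  ccls n (bracket `|p| `|q| (crep a) (crep b)).

Lemma GbrkE p q n u v : n = p + q - 1 -> cin p u -> cin q v ->
  Gbrk n (ccls p u) (ccls q v) = ccls n (bracket `|p| `|q| u v).
Proof.
move=> e cu cv; have cu' := crep_in (ccls p u); have cv' := crep_in (ccls q v).
apply: ccls_eq; [exact: brk_in | exact: brk_in |].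
have -> : bracket `|p| `|q| (crep (ccls p u)) (crep (ccls q v)) - bracket `|p| `|q| u v
  = 1 *: bracket `|p| `|q| (crep (ccls p u) - u) (crep (ccls q v))
    + bracket `|p| `|q| u (crep (ccls q v) - v).
  rewrite scale1r.
  have := bracket_linl `|p| `|q| (crep (ccls p u) - u) u 1 (cin_mlin cv').
  have := bracket_linr `|p| `|q| (crep (ccls q v) - v) v 1 (cin_mlin cu).
  rewrite !scale1r !subrK => -> ->; zmodule.
apply: cexD.
  by apply: brk_exl cv' => //; [exact: cinB | exact: crep_cls].
by apply: brk_exr cu _ _ => //; [exact: cinB | exact: crep_cls].
Qed.

Lemma GcupE p q n u v : n = p + q -> cin p u -> cin q v ->
  Gcup n (ccls p u) (ccls q v) = ccls n (cup `|p| `|q| u v).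
Proof.
move=> e cu cv; have cu' := crep_in (ccls p u); have cv' := crep_in (ccls q v).
apply: ccls_eq; [exact: cup_in | exact: cup_in |].
have -> : cup `|p| `|q| (crep (ccls p u)) (crep (ccls q v)) - cup `|p| `|q| u v
  = 1 *: cup `|p| `|q| (crep (ccls p u) - u) (crep (ccls q v))
    + cup `|p| `|q| u (crep (ccls q v) - v).
  rewrite scale1r.
  have := cup_linl `|p| `|q| (crep (ccls p u) - u) u (crep (ccls q v)) 1.
  have := cup_linr `|q| (crep (ccls q v) - v) v 1 (cin_cochain cu).
  rewrite !scale1r !subrK => -> ->; zmodule.
apply: cexD.
  by apply: cup_exl cv' => //; [exact: cinB | exact: crep_cls].
by apply: cup_exr cu _ _ => //; [exact: cinB | exact: crep_cls].
Qed.

Lemma ccls_sg z e u : cin z u -> ccls z (sg e *: u) = sg e *: ccls z u.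
Proof.
move=> cu; have := ccls_lin (sg e) cu (cin0 z); rewrite !addr0 => ->.
by have := ccls_lin (-1) (cin0 z) (cin0 z); rewrite scaler0 addr0 scaleN1r addNr => ->; rewrite addr0.
Qed.

Lemma cls_ind z (P : HC z -> Prop) : (forall u, cin z u -> P (ccls z u)) -> forall c, P c.
Proof. by move=> h c; rewrite -[c]crepK; apply: h; exact: crep_in. Qed.

Lemma ccls_ext z u v : cin z u -> cin z v ->
  (forall m : nat, z = m -> is_coboundary m (u - v)) -> ccls z u = ccls z v.
Proof. by move=> cu cv h; apply: ccls_eq => //; case: z {cu cv} h => [m|m] //= h; exact: h. Qed.

Lemma Gcup_bilinear p q n : n = p + q -> bilinear_for *:%R *:%R (@Gcup p q n).
Proof.
move=> e; split.
  elim/cls_ind=> w cw; move=> a x; move: x; elim/cls_ind=> u cu; elim/cls_ind=> v cv /=.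
  rewrite -ccls_lin // !GcupE //; last exact: cin_lin.
  by rewrite cup_linl ccls_lin //; exact: cup_in.
elim/cls_ind=> w cw; move=> a x; move: x; elim/cls_ind=> u cu; elim/cls_ind=> v cv /=.
rewrite -ccls_lin // !GcupE //; last exact: cin_lin.
by rewrite (cup_linr _ _ _ _ (cin_cochain cw)) ccls_lin //; exact: cup_in.
Qed.

Lemma Gbrk_bilinear p q n : n = p + q - 1 -> bilinear_for *:%R *:%R (@Gbrk p q n).
Proof.
move=> e; split.
  elim/cls_ind=> w cw; move=> a x; move: x; elim/cls_ind=> u cu; elim/cls_ind=> v cv /=.
  rewrite -ccls_lin // !GbrkE //; last exact: cin_lin.
  by rewrite (bracket_linl _ _ _ _ _ (cin_mlin cw)) ccls_lin //; exact: brk_in.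
elim/cls_ind=> w cw; move=> a x; move: x; elim/cls_ind=> u cu; elim/cls_ind=> v cv /=.
rewrite -ccls_lin // !GbrkE //; last exact: cin_lin.
by rewrite (bracket_linr _ _ _ _ _ (cin_mlin cw)) ccls_lin //; exact: brk_in.
Qed.

Lemma cclsD z u v : cin z u -> cin z v -> ccls z (u + v) = ccls z u + ccls z v.
Proof. by move=> cu cv; have := ccls_lin 1 cu cv; rewrite !scale1r. Qed.
Lemma ccls0 z : @ccls k A z 0 = 0.
Proof. by apply: (addrI (ccls z 0)); rewrite -cclsD ?addr0 //; exact: cin0. Qed.
Lemma cclsN z u : cin z u -> ccls z (- u) = - ccls z u.
Proof.
by move=> cu; have := ccls_lin (-1) cu (cin0 z); rewrite ccls0 !addr0 !scaleN1r.
Qed.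
Lemma ccls_sn z e b u : cin z u -> odd `|e| = b -> ccls z (sn b u) = sg e *: ccls z u.
Proof. by move=> cu <-; rewrite -sgZ ccls_sg. Qed.

Lemma neg0 (p : nat) (f : HC (Negz p)) : f = 0.
Proof. exact: thinmx0. Qed.

Section BilinearZero.
Variables (p q n : int).
Lemma Gcup0l (g : HC q) : n = p + q -> Gcup n (0 : HC p) g = 0.
Proof.
move=> e; have := (Gcup_bilinear e).1 g 1 0 0; rewrite scale1r addr0 /= scale1r => E.
by apply: (addrI (Gcup n (0 : HC p) g)); rewrite -E addr0.
Qed.
Lemma Gcup0r (f : HC p) : n = p + q -> Gcup n f (0 : HC q) = 0.
Proof.
move=> e; have := (Gcup_bilinear e).2 f 1 0 0; rewrite scale1r addr0 /= scale1r => E.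
by apply: (addrI (Gcup n f (0 : HC q))); rewrite -E addr0.
Qed.
Lemma Gbrk0l (g : HC q) : n = p + q - 1 -> Gbrk n (0 : HC p) g = 0.
Proof.
move=> e; have := (Gbrk_bilinear e).1 g 1 0 0; rewrite scale1r addr0 /= scale1r => E.
by apply: (addrI (Gbrk n (0 : HC p) g)); rewrite -E addr0.
Qed.
Lemma Gbrk0r (f : HC p) : n = p + q - 1 -> Gbrk n f (0 : HC q) = 0.
Proof.
move=> e; have := (Gbrk_bilinear e).2 f 1 0 0; rewrite scale1r addr0 /= scale1r => E.
by apply: (addrI (Gbrk n f (0 : HC q))); rewrite -E addr0.
Qed.
End BilinearZero.

Lemma GcupC p q n (f : HC p) (g : HC q) : n = p + q -> n = q + p ->
  Gcup n f g = sg (p * q) *: Gcup n g f.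
Proof.
case: p f => [p|p] f e e'; last by rewrite [f]neg0 Gcup0l // Gcup0r // scaler0.
case: q g e e' => [q|q] g e e'; last by rewrite [g]neg0 Gcup0l // Gcup0r // scaler0.
move: f g; elim/cls_ind=> u cu; elim/cls_ind=> v cv.
rewrite !GcupE // -(ccls_sn (cup_in e' cv cu) (odd_mulz p q)).
apply: ccls_ext; [exact: cup_in | by apply: cin_sn; exact: cup_in |].
move=> m em; have -> : m = (p + q)%N by lia.
exact: cupC.
Qed.

Lemma GcupA p q r pq qr n (f : HC p) (g : HC q) (h : HC r) :
  pq = p + q -> n = pq + r -> qr = q + r -> n = p + qr ->
  Gcup n (Gcup pq f g) h = Gcup n f (Gcup qr g h).
Proof.
move=> e1 e2 e3 e4.
case: p f e1 e4 => [p|p] f e1 e4; last by rewrite [f]neg0 !Gcup0l.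
case: q g e1 e3 => [q|q] g e1 e3; last by rewrite [g]neg0 Gcup0l // Gcup0r // Gcup0l // Gcup0r.
case: r h e2 e3 => [r|r] h e2 e3; last by rewrite [h]neg0 !Gcup0r.
move: f g h; elim/cls_ind=> u cu; elim/cls_ind=> v cv; elim/cls_ind=> w cw.
rewrite (GcupE e1 cu cv) (GcupE e3 cv cw).
rewrite (GcupE e2 (cup_in e1 cu cv) cw) (GcupE e4 cu (cup_in e3 cv cw)).
congr ccls.
have -> : `|pq|%N = (p + q)%N by lia.
have -> : `|qr|%N = (q + r)%N by lia.
exact: (cup_assoc (Coch (cin_cochain cu)) (Coch (cin_cochain cv)) (Coch (cin_cochain cw))).
Qed.

Lemma GbrkC p q n (f : HC p) (g : HC q) : n = p + q - 1 -> n = q + p - 1 ->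
  Gbrk n f g = - (sg ((p - 1) * (q - 1)) *: Gbrk n g f).
Proof.
case: p f => [p|p] f e e'; last by rewrite [f]neg0 Gbrk0l // Gbrk0r // scaler0 oppr0.
case: q g e e' => [q|q] g e e'; last by rewrite [g]neg0 Gbrk0l // Gbrk0r // scaler0 oppr0.
move: f g; elim/cls_ind=> u cu; elim/cls_ind=> v cv.
rewrite !GbrkE // bracketC cclsN; last by apply: cin_sn; exact: brk_in.
by rewrite (ccls_sn (e := (Posz p - 1) * (Posz q - 1)) (brk_in e' cv cu)) // odd_mulz !int_par.
Qed.

Lemma Gbrk_jacobi p q r pq pr qr n (f : HC p) (g : HC q) (h : HC r) :
  qr = q + r - 1 -> n = p + qr - 1 -> pq = p + q - 1 -> n = pq + r - 1 ->
  pr = p + r - 1 -> n = q + pr - 1 ->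
  Gbrk n f (Gbrk qr g h) = Gbrk n (Gbrk pq f g) h
      + sg ((p - 1) * (q - 1)) *: Gbrk n g (Gbrk pr f h).
Proof.
move=> e1 e2 e3 e4 e5 e6.
case: p f e2 e3 e5 => [p|p] f e2 e3 e5; last first.
  by rewrite [f]neg0 !Gbrk0l // Gbrk0r // scaler0 addr0.
case: q g e1 e3 e6 => [q|q] g e1 e3 e6; last first.
  by rewrite [g]neg0 !Gbrk0l // !Gbrk0r // Gbrk0l // scaler0 addr0.
case: r h e1 e4 e5 => [r|r] h e1 e4 e5; last first.
  by rewrite [h]neg0 !Gbrk0r // scaler0 addr0.
move: f g h; elim/cls_ind=> u cu; elim/cls_ind=> v cv; elim/cls_ind=> w cw.
have b1 := brk_in e1 cv cw; have b2 := brk_in e3 cu cv; have b3 := brk_in e5 cu cw.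
rewrite (GbrkE e1 cv cw) (GbrkE e3 cu cv) (GbrkE e5 cu cw).
rewrite (GbrkE e2 cu b1) (GbrkE e4 b2 cw) (GbrkE e6 cv b3).
rewrite -(ccls_sn (b := par p && par q) (brk_in e6 cv b3)); last first.
  by rewrite odd_mulz !int_par.
have := brk_in e4 b2 cw; have := brk_in e6 cv b3; have := brk_in e2 cu b1.
move=> c1 c3 c2; rewrite -cclsD //; last exact: cin_sn.
congr ccls.
(* In degree -1 the absolute value is 1 while the truncated predecessor is 0. The two readings of
   the arity differ only there, where the inner bracket is zero. *)
have lblr (x y z : nat) (a b c : seq A -> A) (t : int) : t = Posz y + Posz z - 1 -> mlin a ->
    bracket x `|t| a (bracket y z b c) = bracket x (y + z).-1 a (bracket y z b c).
  move=> et ma; case: (posnP (y + z)) => h; last by have -> : `|t|%N = (y + z).-1 by lia.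
  have [-> ->] : y = 0%N /\ z = 0%N by split; lia.
  by rewrite bracket00 !bracket0r.
have lbll (x y z : nat) (a b c : seq A -> A) (t : int) : t = Posz y + Posz z - 1 -> mlin a ->
    bracket `|t| x (bracket y z b c) a = bracket (y + z).-1 x (bracket y z b c) a.
  move=> et ma; case: (posnP (y + z)) => h; last by have -> : `|t|%N = (y + z).-1 by lia.
  have [-> ->] : y = 0%N /\ z = 0%N by split; lia.
  by rewrite bracket00 !bracket0l.
rewrite (lblr _ _ _ _ _ _ _ e1 (cin_mlin cu)) (lbll _ _ _ _ _ _ _ e3 (cin_mlin cw)).
rewrite (lblr _ _ _ _ _ _ _ e5 (cin_mlin cv)).
exact: bracket_jacobi (cin_cochain cu) (cin_cochain cv) (cin_cochain cw).
Qed.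

Lemma Gbrk_cup p q r pq pr qr n (f : HC p) (g : HC q) (h : HC r) :
  qr = q + r -> n = p + qr - 1 -> pq = p + q - 1 -> n = pq + r ->
  pr = p + r - 1 -> n = q + pr ->
  Gbrk n f (Gcup qr g h) = Gcup n (Gbrk pq f g) h
      + sg ((p - 1) * q) *: Gcup n g (Gbrk pr f h).
Proof.
move=> e1 e2 e3 e4 e5 e6.
case: p f e2 e3 e5 => [p|p] f e2 e3 e5; last first.
  by rewrite [f]neg0 !Gbrk0l // Gcup0l // Gcup0r // scaler0 addr0.
case: q g e1 e3 e6 => [q|q] g e1 e3 e6; last first.
  by rewrite [g]neg0 !Gcup0l // !Gbrk0r // Gcup0l // scaler0 addr0.
case: r h e1 e4 e5 => [r|r] h e1 e4 e5; last first.
  by rewrite [h]neg0 !Gcup0r // !Gbrk0r // Gcup0r // scaler0 addr0.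
move: f g h; elim/cls_ind=> u cu; elim/cls_ind=> v cv; elim/cls_ind=> w cw.
have b1 := cup_in e1 cv cw; have b2 := brk_in e3 cu cv; have b3 := brk_in e5 cu cw.
rewrite (GcupE e1 cv cw) (GbrkE e3 cu cv) (GbrkE e5 cu cw).
rewrite (GbrkE e2 cu b1) (GcupE e4 b2 cw) (GcupE e6 cv b3).
rewrite -(ccls_sn (b := par p && odd q) (cup_in e6 cv b3)); last first.
  by rewrite odd_mulz int_par.
rewrite -cclsD; [|exact: cup_in|by apply: cin_sn; exact: cup_in].
apply: ccls_ext; [exact: brk_in|apply: cinD; [exact: cup_in|by apply: cin_sn; exact: cup_in]|].
move=> m em.
have -> : `|qr|%N = (q + r)%N by lia.
have E2 : cup `|pq| r (bracket p q u v) w = cup (p + q).-1 r (bracket p q u v) w.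
  case: (posnP (p + q)) => h; last by have -> : `|pq|%N = (p + q).-1 by lia.
  have [-> ->] : p = 0%N /\ q = 0%N by split; lia.
  by rewrite bracket00 !cup0l.
have E3 : cup q `|pr| v (bracket p r u w) = cup q (p + r).-1 v (bracket p r u w).
  case: (posnP (p + r)) => h; last by have -> : `|pr|%N = (p + r).-1 by lia.
  have [-> ->] : p = 0%N /\ r = 0%N by split; lia.
  by rewrite bracket00 !(cup0r _ (cin_cochain cv)).
rewrite /= E2 E3; have -> : m = (p + (q + r)).-1 by lia.
exact: bracket_cup.
Qed.

Definition hochschild_gerstenhaber : gerstenhaber HC :=
  @Gerstenhaber k HC (fun p q n _ => @Gcup p q n) (fun p q n _ => @Gbrk p q n)
    Gcup_bilinear Gbrk_bilinear (fun p q n e e' f g => GcupC f g e e')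
    (fun p q r pq qr n e1 e2 e3 e4 f g h => GcupA f g h e1 e2 e3 e4)
    (fun p q n e e' f g => GbrkC f g e e')
    (fun p q r pq pr qr n e1 e2 e3 e4 e5 e6 f g h => Gbrk_jacobi f g h e1 e2 e3 e4 e5 e6)
    (fun p q r pq pr qr n e1 e2 e3 e4 e5 e6 f g h => Gbrk_cup f g h e1 e2 e3 e4 e5 e6).
End CohomologyOperations.

(** * Cap product, Connes operator and Lie action on homology classes *)

Section HomologyOperations.
Variables (k : comNzRingType) (A : regUnitalHomAss k).
Local Notation cocycle := (@cocycle k A).
Local Notation TT := (@ttensor k A).
Local Notation HC := (cohomology A).
Local Notation HO := (homology A).
Implicit Types (u v w : seq A -> A) (X : TT) (p q r n m l : int).

Definition capf (p : nat) u X : TT := sn (par p) (Y 2 (@mu k A) 0 (Y p u 1 X)).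
Definition lief (p : nat) u X : TT :=
  sn (par p) (tail (Y p u) 1 X + Y p u 0 (cycsum p X)).

Lemma capfE F X : capf (ar F) F X = sn (pa F) (cap F X). Proof. by []. Qed.
Lemma liefE F X : lief (ar F) F X = sn (pa F) (lie F X). Proof. by []. Qed.

Lemma capf_linl (p : nat) u v a X : u \in @cochain k A p -> v \in @cochain k A p ->
  capf p (a *: u + v) X = a *: capf p u X + capf p v X.
Proof. by move=> cu cv; rewrite /capf Y_linf // linearP sn_linear. Qed.
Lemma capf_linear (p : nat) u : linear (capf p u).
Proof. by move=> a X X'; rewrite /capf !linearP sn_linear. Qed.
HB.instance Definition _ (p : nat) u := GRing.isLinear.Build k TT TT *:%R (capf p u) (capf_linear p u).

Lemma capf0l (p : nat) X : capf p 0 X = 0.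
Proof. by rewrite /capf Y0f linear0 sn0. Qed.
Lemma lief0l (p : nat) X : lief p 0 X = 0.
Proof.
rewrite -[0 : seq A -> A]/(fn (Coch (rpred0 (@cochain k A p)))) -[p in lief p]/(ar (Coch (rpred0 (@cochain k A p)))).
by rewrite liefE /lie rho_fn0 // op_fn0 // addr0 sn0.
Qed.
Lemma lief0r (p : nat) u : u \in @cochain k A p -> lief p u 0 = 0.
Proof.
move=> cu; rewrite -[u]/(fn (Coch cu)) -[p]/(ar (Coch cu)) liefE /lie.
by rewrite rho0 cycsum0 op0 addr0 sn0.
Qed.

Lemma hin0 z : @hin k A z 0.
Proof. by case: z => [n|n] //=; split; [exists 0; rewrite linear0 | exact: bd0]. Qed.
Lemma hex0 z : @hex k A z 0.
Proof. by case: z => [n|n] //=; exists 0; [exists 0; rewrite linear0 | rewrite bd0]. Qed.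
Lemma hexD z X X' : hex z X -> hex z X' -> hex z (X + X').
Proof.
case: z => [n|n] //= [v lv ->] [v' lv' ->]; exists (v + v'); first exact: lenD.
by rewrite bdD.
Qed.
Lemma hex_sn z b X : hex z X -> hex z (sn b X).
Proof.
case: z => [n|n] //= [v lv ->]; exists (sn b v); first exact: len_sn.
by rewrite bdsn.
Qed.
Lemma hinB z X X' : hin z X -> hin z X' -> hin z (X - X').
Proof. by move=> hX hX'; have := hin_lin (-1) hX' hX; rewrite scaleN1r addrC. Qed.
Lemma hinD z X X' : hin z X -> hin z X' -> hin z (X + X').
Proof. by move=> hX hX'; have := hin_lin 1 hX hX'; rewrite scale1r. Qed.
Lemma hin_sn z b X : hin z X -> hin z (sn b X).
Proof. by case: b => // hX; have := hinB (hin0 z) hX; rewrite sub0r. Qed.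

Lemma cap_in p n m u X : m = n - p -> cin p u -> hin n X -> hin m (capf `|p| u X).
Proof.
case: p => [p|p] e cu; last by rewrite [u]cu capf0l => _; exact: hin0.
case: n e => [n|n] e; last by move=> ->; rewrite linear0; exact: hin0.
have [F [aF fF cF]] := cocycleP cu; subst p u; move=> [lX dX]; rewrite capfE.
case: m e => [m|m] e; last by rewrite (cap_out lX) ?sn0 //=; lia.
apply: hin_sn; split; first by apply: len_cap lX _; lia.
by rewrite (bd_cap _ lX) dX cap0 sn0 subr0 /cap op_dclosed // op0 oppr0.
Qed.

Lemma cap_exl p n m u X : m = n - p -> cin p u -> cex p u -> hin n X ->
  hex m (capf `|p| u X).
Proof.
case: p => [p|p] e cu; last by rewrite [u]cu capf0l => _ _; exact: hex0.
case: n e => [n|n] e bu; last by move=> ->; rewrite linear0; exact: hex0.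
case: m e => [m|//] e [lX dX].
have [[H [pH uH]]|->] := coboundary_coch cu bu; last by rewrite capf0l; exact: hex0.
subst p u; rewrite (capfE (dl H)); apply: hex_sn.
have := bd_cap H lX; rewrite dX cap0 sn0 subr0 => E.
exists (- cap H X); last by rewrite bdN E opprK.
by apply: lenN; apply: len_cap lX _; lia.
Qed.

Lemma cap_exr p n m u X : m = n - p -> cin p u -> hex n X -> hex m (capf `|p| u X).
Proof.
case: p => [p|p] e cu; last by rewrite [u]cu capf0l => _; exact: hex0.
case: m e => [m|//] e.
case: n e => [n|n] e; last lia.
have [F [aF fF cF]] := cocycleP cu; subst p u; move=> [v lv ->]; rewrite capfE.
have := bd_cap F lv; rewrite [cap (dl F) v]/cap op_dclosed // op0 oppr0 sub0r => E.
exists (- cap F v); first by apply: lenN; apply: len_cap lv _; lia.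
by rewrite bdN E opprK.
Qed.

Lemma con_in n m X : m = n + 1 -> hin n X -> hin m (connesq `|n| X).
Proof.
move=> -> {m}; case: n => [n|n]; last by move=> ->; rewrite connesq0; exact: hin0.
have -> : Posz n + 1 = Posz n.+1 by lia.
move=> [lX dX]; split; first exact: len_connesq.
by rewrite (bd_connesq lX) dX connesq0 oppr0.
Qed.

Lemma con_ex n m X : m = n + 1 -> hin n X -> hex n X -> hex m (connesq `|n| X).
Proof.
move=> -> {m}; case: n => [n|n]; last by move=> ->; rewrite connesq0 => _; exact: hex0.
have -> : Posz n + 1 = Posz n.+1 by lia.
move=> _ [v lv ->] /=; exists (- connesq n.+1 v).
  by apply: lenN; exact: len_connesq.
by rewrite bdN (bd_connesq lv) opprK.
Qed.

Definition Cact p n m (a : HC p) (c : HO n) : HO m :=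
  hcls m (capf `|p| (crep a) (hrep c)).
Definition CB n m (c : HO n) : HO m := hcls m (connesq `|n| (hrep c)).
(* Cartan's formula is taken as the definition of the Lie action on homology;
   [ClieE] identifies it with the one induced by [lief]. *)
Definition Clie p n m (a : HC p) (c : HO n) : HO m :=
  CB m (Cact (n - p) a c) - sg p *: Cact m a (CB (n + 1) c).

Lemma CactE p n m u X : m = n - p -> cin p u -> hin n X ->
  Cact m (ccls p u) (hcls n X) = hcls m (capf `|p| u X).
Proof.
move=> e cu hX; have cu' := crep_in (ccls p u); have hX' := hrep_in (hcls n X).
apply: hcls_eq; [exact: cap_in e cu' hX' | exact: cap_in e cu hX |].
have -> : capf `|p| (crep (ccls p u)) (hrep (hcls n X)) - capf `|p| u X
  = capf `|p| (crep (ccls p u) - u) (hrep (hcls n X))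
    + capf `|p| u (hrep (hcls n X) - X).
  have := capf_linl 1 (hrep (hcls n X)) (cin_cochain (cinB cu' cu)) (cin_cochain cu).
  rewrite !scale1r subrK linearB /= => ->; zmodule.
apply: hexD.
  by apply: cap_exl e _ _ hX'; [exact: cinB | exact: crep_cls].
by apply: cap_exr e cu _; exact: hrep_cls.
Qed.

Lemma CBE n m X : m = n + 1 -> hin n X -> CB m (hcls n X) = hcls m (connesq `|n| X).
Proof.
move=> e hX; have hX' := hrep_in (hcls n X).
apply: hcls_eq; [exact: con_in e hX' | exact: con_in e hX |].
rewrite -connesqN -connesqD; apply: con_ex e _ _; first exact: hinB.
exact: hrep_cls.
Qed.

Lemma hcls_ind z (P : HO z -> Prop) : (forall X, hin z X -> P (hcls z X)) -> forall c, P c.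
Proof. by move=> h c; rewrite -[c]hrepK; apply: h; exact: hrep_in. Qed.

Lemma connesqZ (n : nat) a X : @connesq k A n (a *: X) = a *: connesq n X.
Proof.
have cZ (q : nat) : cycsum q (a *: X) = a *: cycsum q X.
  by elim: q => [|q IH] /=; rewrite ?scaler0 // IH linearZ scalerDr.
by rewrite /connesq cZ linearZ /= linearZ /= scalerBr.
Qed.

Lemma CB_linear n m : m = n + 1 -> linear (@CB n m).
Proof.
move=> e a; elim/hcls_ind=> X hX; elim/hcls_ind=> X' hX'.
rewrite -hcls_lin // !CBE //; last exact: hin_lin.
by rewrite connesqD connesqZ hcls_lin //; exact: con_in.
Qed.

Lemma Cact_bilinear p n m : m = n - p -> bilinear_for *:%R *:%R (@Cact p n m).
Proof.
move=> e; split.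
  elim/hcls_ind=> X hX; move=> a x; move: x; elim/cls_ind=> u cu; elim/cls_ind=> v cv /=.
  rewrite -ccls_lin // !CactE //; last exact: cin_lin.
  by rewrite (capf_linl _ _ (cin_cochain cu) (cin_cochain cv)) hcls_lin //; apply: (cap_in e).
elim/cls_ind=> w cw; move=> a x; move: x; elim/hcls_ind=> X hX; elim/hcls_ind=> X' hX' /=.
rewrite -hcls_lin // !CactE //; last exact: hin_lin.
by rewrite linearP hcls_lin //; apply: (cap_in e).
Qed.

Lemma ClieB p n l l' m (a : HC p) (c : HO n) : l = n - p -> m = l + 1 -> l' = n + 1 ->
  Clie m a c = CB m (Cact l a c) - sg p *: Cact m a (CB l' c).
Proof. by move=> -> _ ->. Qed.

Lemma hneg0 (n : nat) (c : HO (Negz n)) : c = 0.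
Proof. exact: thinmx0. Qed.

Section Zeros.
Variables (p n m : int).
Lemma Cact0l (c : HO n) : m = n - p -> Cact m (0 : HC p) c = 0.
Proof.
move=> e; have := (Cact_bilinear e).1 c 1 0 0; rewrite scale1r addr0 /= scale1r => E.
by apply: (addrI (Cact m (0 : HC p) c)); rewrite -E addr0.
Qed.
Lemma Cact0r (a : HC p) : m = n - p -> Cact m a (0 : HO n) = 0.
Proof.
move=> e; have := (Cact_bilinear e).2 a 1 0 0; rewrite scale1r addr0 /= scale1r => E.
by apply: (addrI (Cact m a (0 : HO n))); rewrite -E addr0.
Qed.
Lemma Clie_bilinear : m = n - p + 1 -> bilinear_for *:%R *:%R (@Clie p n m).
Proof.
move=> e; have e1 : m = (n + 1) - p by lia.
have e2 : n + 1 = n + 1 by []; have e3 : n - p = n - p by [].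
split=> [c|a] b x y; rewrite /Clie.
  rewrite /= (Cact_bilinear e3).1 (Cact_bilinear e1).1 /= (CB_linear e).
  by rewrite !scalerBr !scalerDr !scalerA opprD [sg p * b]mulrC addrACA.
rewrite /= (Cact_bilinear e3).2 (CB_linear e2).
rewrite (Cact_bilinear e1).2 /= (CB_linear e).
by rewrite !scalerBr !scalerDr !scalerA opprD [sg p * b]mulrC addrACA.
Qed.
End Zeros.

Lemma Clie0l p n m (c : HO n) : m = n - p + 1 -> Clie m (0 : HC p) c = 0.
Proof.
move=> e; have := (Clie_bilinear e).1 c 1 0 0; rewrite scale1r addr0 /= scale1r => E.
by apply: (addrI (Clie m (0 : HC p) c)); rewrite -E addr0.
Qed.
Lemma Clie0r p n m (a : HC p) : m = n - p + 1 -> Clie m a (0 : HO n) = 0.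
Proof.
move=> e; have := (Clie_bilinear e).2 a 1 0 0; rewrite scale1r addr0 /= scale1r => E.
by apply: (addrI (Clie m a (0 : HO n))); rewrite -E addr0.
Qed.

Lemma len_cartan_homotopy (m n : nat) F X : (m + ar F)%N = n.+1 -> len n X ->
  len m.+1 (cartan_homotopy n F X).
Proof.
move=> e lX; rewrite /cartan_homotopy.
have lk : len m.+1 (op (onec A) 0 (kap F n.+1 X)) by apply: len_one; exact: len_kap lX e.
apply: lenD; first by apply: lenB => //; exact: len_tau.
apply: len_sn; apply: (@len_op _ _ n.+1); last by rewrite addSn e.
by apply: len_one; exact: len_cycsum.
Qed.

(** In degrees [m >= 0] the homotopy also shows that the result is a cycle: it differs by a boundary
    from a combination of cycles. *)
Lemma lief_cartan p n m u X : m = n - p + 1 -> cin p u -> hin n X ->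
  hin m (lief `|p| u X) /\
  hex m (lief `|p| u X - (connesq `|n - p| (capf `|p| u X)
                          - sn (odd `|p|) (capf `|p| u (connesq `|n| X)))).
Proof.
case: p => [p|p] e cu; last first.
  rewrite [u]cu !capf0l lief0l connesq0 sn0 !subrr => _; split; [exact: hin0|exact: hex0].
have hC := cap_in (erefl (n - Posz p)) cu; have hC1 := cap_in (n := n + 1) (m := m) _ cu.
case: n e hC hC1 => [n|n] e hC hC1; last first.
  move=> ->; rewrite lief0r ?(cin_cochain cu) // connesq0 !linear0 connesq0 sn0 !subrr.
  by split; [exact: hin0|exact: hex0].
move=> hX; have := hX => -[lX dX]; move/(_ _ hX) in hC.
have {}hC1 := hC1 (connesq n X) ltac:(lia) (con_in (erefl _) hX).
have {}hC := con_in e hC.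
have [F [aF fF cF]] := cocycleP cu; subst p u.
case: m e hC hC1 => [m|m] e hC hC1.
  have h : hex (Posz m) (lief (ar F) F X - (connesq `|Posz n - Posz (ar F)| (capf (ar F) F X)
                          - sn (odd (ar F)) (capf (ar F) F (connesq n X)))).
    exists (sn (pa F) (cartan_homotopy n F X)).
      by apply/len_sn/len_cartan_homotopy => //; lia.
    rewrite bdsn liefE (cartan_cycle lX cF dX) !capfE.
    have -> : (if (ar F <= n)%N then connesq (n - ar F) (cap F X) else 0)
       = connesq `|Posz n - Posz (ar F)| (cap F X).
      have [le|gt] := leqP (ar F) n; last by rewrite (cap_out lX gt) connesq0.
      by congr connesq; lia.
    have -> : odd (ar F) = ~~ pa F by rewrite /pa /par negbK.
    by case: (pa F); rewrite /sn /= ?connesqN; zmodule.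
  split=> //; case: h => v lv /(canRL (subrK _)) ->.
  apply: hinD; first by split; [exact: len_bd | exact: bd_bd lv].
  by apply: hinB => //; apply: hin_sn.
have lt : (n.+1 < ar F)%N by lia.
split=> //=; rewrite liefE /lie (rho_lout lX); last by rewrite ltnW.
by rewrite (op_out (len_cycsum _ lX)) ?addr0 ?sn0.
Qed.

Lemma hclsB z X X' : hin z X -> hin z X' -> hcls z (X - X') = hcls z X - hcls z X'.
Proof. by move=> h h'; rewrite addrC -scaleN1r hcls_lin // scaleN1r addrC. Qed.
Lemma hcls0 z : @hcls k A z 0 = 0.
Proof. by have := hclsB (hin0 z) (hin0 z); rewrite !subrr. Qed.
Lemma hcls_sn z e b X : hin z X -> odd `|e| = b -> hcls z (sn b X) = sg e *: hcls z X.
Proof.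
move=> h <-; rewrite -sgZ -[sg e *: X]addr0 hcls_lin ?hcls0 ?addr0 //; exact: hin0.
Qed.

Lemma ClieE p n m u X : m = n - p + 1 -> cin p u -> hin n X ->
  Clie m (ccls p u) (hcls n X) = hcls m (lief `|p| u X).
Proof.
move=> e cu hX; have [h1 h2] := lief_cartan e cu hX.
have e1 : n - p = n - p by []. have e2 : n + 1 = n + 1 by [].
have e3 : m = n + 1 - p by lia.
have c1 := cap_in e1 cu hX; have c2 := con_in e2 hX; have c3 := cap_in e3 cu c2.
have c4 := con_in e c1.
rewrite /Clie (CactE e1 cu hX) (CBE e2 hX) (CBE e c1) (CactE e3 cu c2).
rewrite -(hcls_sn (b := odd `|p|) c3) // -hclsB //; last exact: hin_sn.
by symmetry; apply: hcls_eq => //; apply: hinB => //; apply: hin_sn.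
Qed.

Lemma Cact_cup p q pq n l m (f : HC p) (g : HC q) (x : HO n) :
  pq = p + q -> m = n - pq -> l = n - q -> m = l - p ->
  Cact m (Gcup pq f g) x = Cact m f (Cact l g x).
Proof.
move=> e1 e2 e3 e4.
case: p f e1 e4 => [p|p] f e1 e4; last by rewrite [f]neg0 Gcup0l // !Cact0l.
case: q g e1 e3 => [q|q] g e1 e3; last by rewrite [g]neg0 Gcup0r // !Cact0l // Cact0r.
move: f g x; elim/cls_ind=> u cu; elim/cls_ind=> v cv; elim/hcls_ind=> X hX.
rewrite (GcupE e1 cu cv) (CactE e2 (cup_in e1 cu cv) hX) (CactE e3 cv hX).
rewrite (CactE e4 cu (cap_in e3 cv hX)); congr hcls.
have -> : `|pq|%N = (p + q)%N by lia.
have [F [aF fF cF]] := cocycleP cu; have [G [aG fG cG]] := cocycleP cv; subst p q u v.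
rewrite (capfE (cupc F G)) [capf `|ar G| _ _]capfE [RHS]capfE cap_cup capsn.
by rewrite pa_cup; koszul.
Qed.

Lemma Cact_brk p q pq n l l' m (f : HC p) (g : HC q) (x : HO n) :
  pq = p + q - 1 -> m = n - pq -> l = n - q + 1 -> m = l - p -> l' = n - p ->
  m = l' - q + 1 ->
  Cact m (Gbrk pq f g) x = Cact m f (Clie l g x)
    - sg (p * (q + 1)) *: Clie m g (Cact l' f x).
Proof.
move=> e1 e2 e3 e4 e5 e6.
case: p f e1 e4 e5 => [p|p] f e1 e4 e5; last first.
  by rewrite [f]neg0 Gbrk0l // !Cact0l // Clie0r // scaler0 subr0.
case: q g e1 e3 e6 => [q|q] g e1 e3 e6; last first.
  by rewrite [g]neg0 Gbrk0r // !Clie0l // Cact0l // Cact0r // scaler0 subr0.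
case: n x e2 e3 e5 => [n|n] x e2 e3 e5; last first.
  by rewrite [x]hneg0 !Cact0r // !Clie0r // Cact0r // scaler0 subr0.
move: f g x; elim/cls_ind=> u cu; elim/cls_ind=> v cv; elim/hcls_ind=> X hX.
have b1 := brk_in e1 cu cv; have c1 := cap_in e5 cu hX.
have [h1 _] := lief_cartan e3 cv hX; have [h2 _] := lief_cartan e6 cv c1.
have h3 := cap_in e4 cu h1; have h4 := cap_in e2 b1 hX.
rewrite (GbrkE e1 cu cv) (CactE e2 b1 hX) (CactE e5 cu hX) (ClieE e3 cv hX).
rewrite (ClieE e6 cv c1) (CactE e4 cu h1).
rewrite -(hcls_sn (b := odd p && par q) h2); last first.
  by rewrite odd_mulz; congr (_ && _); rewrite /par; lia.
rewrite -hclsB //; last exact: hin_sn.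
apply: hcls_eq => //; first by apply: hinB => //; exact: hin_sn.
case: m e2 e4 e6 {h2 h3 h4} => [m|m] e2 e4 e6 //.
have [F [aF fF cF]] := cocycleP cu; have [G [aG fG cG]] := cocycleP cv; subst p q u v.
case: hX => lX dX; have := cap_br_cycle lX cF cG dX => E.
have {e1 e2 e3 e4 e5 e6 b1} [pqE en] : `|pq|%N = `|(ar F + ar G)%:Z - 1|%N /\ (m + ar F + ar G)%N = n.+1.
  by split; lia.
(* The sign cancels that of [cap (br F G)] in [cap_br_cycle] and passes from [cap] to [i] for the
   bracket. *)
exists (sn (pe F G (+) (pa F (+) pa G)) (cap_homotopy F G X)).
  apply/len_sn/lenB.
    have lk : len (m + ar G) (kap F (ar G) X) by apply: len_kap lX _; lia.
    by apply: len_op lk _; lia.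
  apply: len_sn; have lo : len (m + ar F) (op G 0 (cycsum (ar G) X)).
    by apply: len_op (len_cycsum _ lX) _; lia.
  by apply: len_rho lo _; lia.
have -> : capf `|pq| (bracket `|ar F| `|ar G| F G) X = sn (pa F (+) pa G) (cap (br F G) X).
  rewrite pqE -fn_br; have [h0|h0] := posnP (ar F + ar G).
    by rewrite /cap (op_fn0 _ _ (br00 h0)) op0 sn0 (br00 h0) capf0l.
  have -> : `|(ar F + ar G)%:Z - 1|%N = ar (br F G) by rewrite /=; lia.
  rewrite capfE; congr sn; rewrite /pa /par /=.
  by case: (ar F) (ar G) h0 => [|a] [|b] //= _; rewrite ?addn0 ?addSn ?add0n //= ?oddD; case: (odd _); rewrite //=; case: (odd _).
rewrite [capf `|ar F| F X]capfE [capf _ F _]capfE !liefE bdsn E /pe.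
have -> : odd (ar F) = ~~ pa F by rewrite /pa /par negbK.
rewrite -/(pa G).
have lN Z : lie G (- Z) = - lie G Z by rewrite /lie cycsumN !addE opprD.
by case: (pa F); case: (pa G); rewrite /sn /= ?capN ?lN; zmodule.
Qed.

Lemma CB_square n m l (x : HO n) : m = n + 1 -> l = m + 1 -> CB l (CB m x) = 0.
Proof.
move=> e1 e2; move: x; elim/hcls_ind=> X hX.
rewrite (CBE e1 hX) (CBE e2 (con_in e1 hX)).
case: n e1 hX => [n|n] e1 hX; last by rewrite hX !connesq0 hcls0.
have -> : `|m|%N = n.+1 by lia.
by case: hX => lX _; rewrite (connesq2 lX) hcls0.
Qed.

Lemma sgB1 (e : int) : sg (e - 1) = - sg e :> k.
Proof.
rewrite /sg -signr_odd -[in RHS]signr_odd.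
have -> : odd `|e - 1| = ~~ odd `|e| by lia.
by rewrite signrN.
Qed.

(** Since [B^2 = 0], both sides reduce to [B i_g B] up to sign. *)
Lemma CB_Clie q n l m n' (g : HC q) (x : HO n) : l = n - q + 1 -> m = l + 1 -> n' = n + 1 ->
  CB m (Clie l g x) = sg (q - 1) *: Clie m g (CB n' x).
Proof.
move=> e1 e2 e3; have e4 : n - q = n - q by []. have e5 : l = (n - q) + 1 by lia.
have e6 : l = n' - q by lia. have e7 : n' + 1 = n' + 1 by [].
rewrite (ClieB _ _ e4 e5 e3) (ClieB _ _ e6 e2 e7) (CB_square x e3 e7).
rewrite Cact0r; last lia.
rewrite scaler0 subr0 addrC -scaleN1r scalerA CB_linear // (CB_square _ e5 e2) addr0.
by rewrite mulN1r sgB1.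
Qed.

Lemma Clie_brk p q pq n l l' m (f : HC p) (g : HC q) (x : HO n) :
  pq = p + q - 1 -> m = n - pq + 1 -> l = n - q + 1 -> m = l - p + 1 -> l' = n - p + 1 ->
  m = l' - q + 1 ->
  Clie m (Gbrk pq f g) x = Clie m f (Clie l g x)
    - sg ((p - 1) * (q - 1)) *: Clie m g (Clie l' f x).
Proof.
move=> e1 e2 e3 e4 e5 e6.
have d1 : n - pq = n - pq by []. have d2 : m = (n - pq) + 1 by lia.
have d3 : n + 1 = n + 1 by []. have d4 : n - pq = l - p by lia.
have d5 : n - p = n - p by []. have d6 : n - pq = n - p - q + 1 by lia.
have d7 : m = (n + 1) - pq by lia. have d8 : l + 1 = (n + 1) - q + 1 by lia.
have d9 : m = (l + 1) - p by lia. have d10 : l' = (n + 1) - p by lia.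
have d11 : l + 1 = l + 1 by [].
rewrite (ClieB _ _ d1 d2 d3) (Cact_brk f g x e1 d1 e3 d4 d5 d6).
rewrite (Cact_brk f g (CB (n + 1) x) e1 d7 d8 d9 d10 e6).
rewrite (ClieB f (Clie l g x) d4 d2 d11) (CB_Clie g x e3 d11 d3).
rewrite (ClieB f x d5 e5 d3).
have CBB (X : HO (n - pq)) a (X' : HO (n - pq)) : CB m (X - a *: X') = CB m X - a *: CB m X'.
  by rewrite [X - _]addrC -scaleNr (CB_linear d2) scaleNr [LHS]addrC.
have LB (X : HO l') a (X' : HO l') : Clie m g (X - a *: X') = Clie m g X - a *: Clie m g X'.
  by rewrite [X - _]addrC -scaleNr (Clie_bilinear e6).2 /= scaleNr [LHS]addrC.
have AZ a (X : HO (l + 1)) : Cact m f (a *: X) = a *: Cact m f X.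
  by rewrite -[a *: X]addr0 (Cact_bilinear d9).2 /= Cact0r // addr0.
rewrite CBB LB AZ (CB_Clie g _ d6 d2 e5) !sgZ.
set x1 := CB m _; set x2 := Clie m g _; set x3 := Cact m f _; set x4 := Clie m g _.
rewrite !odd_mulz; have -> : odd `|pq| = odd `|p| (+) odd `|q - 1| by lia.
have -> : odd `|q + 1| = odd `|q - 1| by lia.
have -> : odd `|p - 1| = ~~ odd `|p| by lia.
move: x1 x2 x3 x4; rewrite /homology; move: (extend0 _ _) => V x1 x2 x3 x4.
by case: (odd `|p|); case: (odd `|q - 1|); rewrite /sn /=; zmodule.
Qed.

Definition hochschild_precalculus : precalculus HC HO :=
  @Precalculus k HC HO (hochschild_gerstenhaber A)
    (fun p n m _ => @Cact p n m) (fun p n m _ => @Clie p n m)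
    Cact_bilinear Clie_bilinear
    (fun p q pq n l m e1 e2 e3 e4 f g x => Cact_cup f g x e1 e2 e3 e4)
    (fun p q pq n l l' m e1 e2 e3 e4 e5 e6 f g x => Clie_brk f g x e1 e2 e3 e4 e5 e6)
    (fun p q pq n l l' m e1 e2 e3 e4 e5 e6 f g x => Cact_brk f g x e1 e2 e3 e4 e5 e6).

Definition hochschild_calculus : calculus HC HO :=
  @Calculus k HC HO hochschild_precalculus (fun n m _ => @CB n m) CB_linear
    (fun n m l e e' x => CB_square x e e')
    (fun p n l l' m e1 e2 e3 e4 e5 f x => ClieB f x e2 e3 e4).
End HomologyOperations.

(** * Representatives of classes and the calculus *)

Section Representatives.
Variables (k : comNzRingType) (A : regUnitalHomAss k).

Lemma represents_ccls (p : nat) (a : HH A p) f :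
  represents a f <-> cin p f /\ a = ccls p f.
Proof. exact: representsP. Qed.

Lemma represents_hcls n (c : HHd A n) (x : chain A n) :
  represents c x <-> hin n (ttof x) /\ c = hcls n (ttof x).
Proof.
rewrite representsP /= ttofK; split=> [[zx ->]|[[_ dx] ->]]; split=> //.
  by split; [exact: len_ttof | rewrite -ttof_boundary (eqP zx) linear0].
by rewrite -[x]ttofK; apply: tolen_cycle => //; exact: len_ttof.
Qed.

Lemma normalize0P n (u : chain A n) : normalize u = 0 <-> Dn n (ttof u).
Proof.
have E : normalize (0 : chain A n) = 0 by exact: linear0.
by rewrite -E normalizeP linear0 subr0.
Qed.

Lemma ttof_addbd n (z : chain A n) (y : chain A n.+1) :
  ttof (z + boundary y) = ttof z + bd (ttof y).
Proof. by rewrite [LHS]raddfD -ttof_boundary. Qed.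

(** Two cycles with the same normalized representative differ, up to a boundary, by a degenerate
    cycle, which is a boundary by [Dn_acyclic]. *)
Lemma nrepresents_unique n (c c' : HHd A n) (x : chain A n) :
  nrepresents c x -> nrepresents c' x -> c = c'.
Proof.
move=> [_ [z [y [/represents_hcls[hz ->] /normalizeP E]]]].
move=> [_ [z' [y' [/represents_hcls[hz' ->] /normalizeP E']]]].
apply: (@hcls_eq k A (Posz n)) => //=.
rewrite ttof_addbd in E; rewrite ttof_addbd in E'.
have l1 := len_ttof z; have l1' := len_ttof z'.
have l2 := len_ttof y; have l2' := len_ttof y'.
case: hz hz' => _ dz [_ dz'].
have D : Dn n (ttof z - ttof z' + bd (ttof y - ttof y')).
  by have := DnB E' E; rewrite bdD bdN; congr Dn; zmodule.
have L : len n (ttof z - ttof z' + bd (ttof y - ttof y')).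
  by apply: lenD; [exact: lenB | apply: len_bd; exact: lenB].
have dL : bd (ttof z - ttof z' + bd (ttof y - ttof y')) = 0.
  by rewrite bdD (bd_bd (lenB l2 l2')) bdD bdN dz dz' subrr addr0.
have [v lv Ev] := Dn_acyclic L D dL.
exists (v - (ttof y - ttof y')); first by apply: lenB => //; exact: lenB.
by rewrite bdD bdN -Ev addrK.
Qed.

Lemma nrepresents_connes n (c : HHd A n) (x : chain A n) :
  nrepresents c x -> nrepresents (CB (n := n) n.+1 c : HHd A n.+1) (connes x).
Proof.
move=> [_ [z [y [/represents_hcls[hz ->] /normalizeP]]]].
rewrite ttof_addbd => D.
have e : Posz n.+1 = Posz n + 1 by lia.
have l0 := len_ttof x; have l1 := len_ttof z; have l2 := len_ttof y; have [_ dz] := hz.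
have D1 : Dn n.+1 (ttof (connes x) - (connesq n (ttof z) - bd (connesq n.+1 (ttof y)))).
  have L : len n (ttof x - (ttof z + bd (ttof y))).
    by apply: lenB => //; apply: lenD => //; exact: len_bd.
  have := DnD (connes_Dn x) (connesq_Dn L D); congr Dn.
  by rewrite connesqD connesqN connesqD (bd_connesq l2) /=; zmodule.
have hC := con_in e hz.
split.
  apply/normalize0P; rewrite ttof_boundary; have := bd_Dn D1; congr Dn.
  have B0 : bd (connesq n (ttof z) - bd (connesq n.+1 (ttof y))) = 0.
    rewrite bdD (bd_connesq l1) dz connesq0 bdN.
    by rewrite (bd_bd (len_connesq l2)) !oppr0 addr0.
  by rewrite bdD bdN B0 oppr0 addr0.
(* Modulo degenerate chains [x] is [z + boundary y], and [connesq] anticommutes with the boundary;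
   hence the minus sign. *)
exists (tolen n.+1 (connesq n (ttof z))), (tolen n.+2 (- connesq n.+1 (ttof y))).
have K1 := tolenK (len_connesq l1); have K2 := tolenK (lenN (len_connesq l2)).
split; last by apply/normalizeP; rewrite ttof_addbd K1 K2 bdN.
apply/represents_hcls; rewrite K1; split; first by case: hC.
exact: (CBE e hz).
Qed.
End Representatives.

Theorem theorem3p7 (k : comNzRingType)
    (char0 : forall n : nat, n.+1%:R != 0 :> k)
    (A : regUnitalHomAss k) :
  exists C : calculus (cohomology A) (homology A),
  [/\ forall (p q n : nat) (e : n%:Z = p%:Z + q%:Z)
        (a : HH A p) (b : HH A q) (f g : seq A -> A),
        represents a f -> represents b g ->
        represents (gcup C e a b : HH A n) (cup p q f g),
      forall (p q n : nat) (e : n%:Z = p%:Z + q%:Z - 1)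
        (a : HH A p) (b : HH A q) (f g : seq A -> A),
        represents a f -> represents b g ->
        represents (gbrk C e a b : HH A n) (bracket p q f g),
      forall (p n m : nat) (e : m%:Z = n%:Z - p%:Z)
        (a : HH A p) (c : HHd A n) (f : seq A -> A) (x : chain A n),
        represents a f -> represents c x ->
        represents (cact C e a c : HHd A m) (contract m p f x),
      forall (p n m : nat) (e : m%:Z = n%:Z - p%:Z + 1)
        (a : HH A p) (c : HHd A n) (f : seq A -> A) (x : chain A n),
        represents a f -> represents c x ->
        represents (clie C e a c : HHd A m) (lie_der m p f x)
    & forall (n : nat) (e : n.+1%:Z = n%:Z + 1)
        (c : HHd A n) (c' : HHd A n.+1) (x : chain A n),
        nrepresents c x ->
        (nrepresents c' (connes x) <-> c' = cB C e c)].
Proof.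
exists (hochschild_calculus A); split.
- move=> p q n e a b f g /represents_ccls[cf ->] /represents_ccls[cg ->].
  by apply/represents_ccls; split; [exact: (cup_in e cf cg) | exact: (GcupE e cf cg)].
- move=> p q n e a b f g /represents_ccls[cf ->] /represents_ccls[cg ->].
  by apply/represents_ccls; split; [exact: (brk_in e cf cg) | exact: (GbrkE e cf cg)].
- move=> p n m e a c f x /represents_ccls[cf ->] /represents_hcls[hx ->].
  apply/represents_hcls; have [F [aF fF cF]] := cocycleP cf; subst p f.
  rewrite ttof_contract; last lia.
  by split; [exact: (cap_in e cf hx) | exact: (CactE e cf hx)].
- move=> p n m e a c f x /represents_ccls[cf ->] /represents_hcls[hx ->].
  apply/represents_hcls; have [F [aF fF cF]] := cocycleP cf; subst p f.
  rewrite ttof_lie_der; last lia.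
  by split; [case: (lief_cartan e cf hx) | exact: (ClieE e cf hx)].
move=> n e c c' x rx; have rC := nrepresents_connes rx.
by split=> [rc'|->]; [exact: nrepresents_unique rc' rC | exact: rC].
Qed.
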